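(* For real $t$ let $f_t(x)=-t\tanh(t\tan x)$. Let $t_0\in(0,\pi)$ be a virtual cycle parameter (virtual center parameter) of order $m\ge 1$, i.e. there is $c_0\in\{\pi/2,-\pi/2\}$ with $f_{t_0}^{m-1}(t_0)=c_0$ (so that, taking the appropriate directional limit at the pole $c_0$, $f_{t_0}^m(t_0)=t_0$). Then the tangent family $f_t$ is transversal at $t_0$: the function $$\Phi(t)=f_t^{m-1}(t)-c_0$$ satisfies $\Phi'(t_0)\neq 0$.
   Context: $f_t=T_t^2$ restricted to $\mathbb{R}$, where $T_t(z)=it\tan z$. The map $f_t$ is discontinuous at the poles $k\pi+\pi/2$ ($k\in\mathbb{Z}$) of the tangent, where it has one-sided limits $f_t((k\pi+\pi/2)^-)=-t$ and $f_t((k\pi+\pi/2)^+)=t$. ``Virtual cycle parameter of order $m$'' means that $f_{t_0}^{m-1}(t_0)=c_0$ and none of the points $f_{t_0}^{i}(t_0)$, $0\le i<m-1$, is a pole, so that the points $c_0, c_1=t_0, c_2=f_{t_0}(t_0),\dots,c_{m-1}=f_{t_0}^{m-2}(t_0)$ are distinct when $m\geq 2$. Thus $\Phi$ is smooth near $t_0$. *)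

(* Defs.v *)
From Stdlib Require Import Reals.
From Coquelicot Require Import Coquelicot.
Open Scope R_scope.

Definition pole (x : R) : Prop := exists k : Z, x = IZR k * PI + PI / 2.

(* The restriction to the real line of T_t o T_t, where T_t(z) = i t tan z.
   As [tan] is total, [ftan t] has an arbitrary value at a pole; only its values
   at other points are meaningful. *)
Definition ftan (t x : R) : R := - t * tanh (t * tan x).

(* [t0] is a virtual cycle parameter of order [m] with virtual centre [c0]:
   the orbit of [t0] is at the pole [c0] after [m - 1] steps and meets no pole
   earlier, so [ftan t0] is only ever applied at non-poles.  [0 < m]
   makes the truncated subtraction [m - 1] the true one. *)
Definition virtual_cycle_parameter (m : nat) (t0 c0 : R) : Prop :=
  (0 < m)%nat /\
  (c0 = PI / 2 \/ c0 = - (PI / 2)) /\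
  Nat.iter (m - 1) (ftan t0) t0 = c0 /\
  (forall i : nat, (i < m - 1)%nat -> ~ pole (Nat.iter i (ftan t0) t0)).

(* The parameter [t] is both the index of the map and the starting point. *)
Definition Phi (m : nat) (c0 t : R) : R := Nat.iter (m - 1) (ftan t) t - c0.

(* Differentiability is explicit since [Derive] is a total operator. *)
Definition transversal (m : nat) (t0 c0 : R) : Prop :=
  ex_derive (Phi m c0) t0 /\ Derive (Phi m c0) t0 <> 0.

(* Main.v *)
(* Let [T z = i t0 tan z], so that [T o T] is [f], and let [X_0 = t0^2, ..., X_n = (pi/2)^2] be
   the squares of the points of the [T]-orbit of [t0].  The derivative of [Phi] at [t0] is, up to a
   nonzero factor, [sum_i xi_i] where [xi_i] is the product over [j < i] of [sin (2 p) / (2 p)]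
   at [p = T^j t0].  If this sum vanishes, then [q z = sum_i xi_i / (z^2 - X_i)] is invariant under
   the push-forward of quadratic differentials, [sum_k q (z + k pi) = T'(z)^2 q (T z)], by the
   partial fractions of the cotangent, and [q] is integrable over a quadrant.  Since [T] maps the
   half strip [0 < Re z < pi/2, 0 < Im z] bijectively onto a quadrant, which is also tiled by the
   translates and reflections of the half strip, there is no cancellation in the series:
   [|q (z - pi)| + |q (z + k pi)| = |q (z - pi) + q (z + k pi)|] for [k >= 1].  On the real axis
   [q (z - pi)] changes sign at its simple pole [z = pi - t0], so [q] vanishes at all the points
   [pi - t0 + k pi], and hence has no pole at [t0], which contradicts [xi_0 = 1]. *)

(* The factor between [Phi'] and the sum comes from logarithmic derivatives with respect to [ln t]:
   the step from [p] to [i t tan p] turns the logarithmic derivative [A] into [1 + A / e], where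
   [e = sin (2 p) / (2 p)]. The [xi_i] clear these denominators. Pushing [1 / (z^2 - p^2)] forward
   gives [e T'^2] times the difference of the poles at [T p] and at the asymptotic value [t0] of
   [T]; hence [xi_(i+1) = xi_i e_i]. The chain closes because [e] vanishes at the end point
   [+-pi/2], and the vanishing sum makes the contributions at [t0] add up to [xi_0 = 1]. The same
   vanishing gives [q] decay of order [|z|^-4], hence a finite mass, and only a finite mass can be
   cancelled. Squares are used because the orbit of [T] alternates between the two axes: all [X_i]
   are real, so [|q|] is symmetric in both axes and one quadrant carries all the information. Two
   consequences of [|tanh| < 1] drive the last step: [pi/2 < t0], so that [pi - t0] lies on the base
   of the half strip, and [X_i < X_0] for [i > 0], so that the pole at [t0] is not merged with
   another one. They require a second orbit point, so [m = 1] is separate. *)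
From mathcomp Require all_boot all_order all_algebra all_classical all_reals all_analysis.
From mathcomp Require measurable_realfun ring lra Rstruct Rstruct_topology.

(** * Integration over plane regions *)

Module PlanarMeasure.
Import all_boot all_order all_algebra all_classical all_reals all_analysis measurable_realfun.
Import mathcomp.algebra_tactics.ring mathcomp.algebra_tactics.lra.
Set Implicit Arguments. Unset Strict Implicit. Unset Printing Implicit Defensive.
Import Order.TTheory GRing.Theory Num.Theory numFieldNormedType.Exports.
Local Open Scope classical_set_scope.
Local Open Scope ring_scope.

Section exhaustion.
Context d (T : measurableType d) (R : realType) (mu : {measure set T -> \bar R}).
Local Open Scope ereal_scope.

(** Cutting the union into the disjoint layers [seqDU F] turns the integral into a series whose
    partial sums are integrals over the [F n]. This carries inequalities from compact segments to
    open intervals and half lines. *)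
Lemma ge0_integral_bigcup_le (F : (set T)^nat) (f : T -> \bar R) (M : \bar R) :
  (forall n, measurable (F n)) -> nondecreasing_seq F ->
  measurable_fun (\bigcup_n F n) f ->
  (forall x, (\bigcup_n F n) x -> 0 <= f x) ->
  (forall n, \int[mu]_(x in F n) f x <= M) ->
  \int[mu]_(x in \bigcup_n F n) f x <= M.
Proof.
move=> mF ndF mf f0 FM.
have M0 : 0 <= M.
  apply: le_trans (FM 0%N); apply: integral_ge0 => x Fx; apply: f0.
  by exists 0%N.
rewrite seqDU_bigcup_eq ge0_integral_bigcup//; last 3 first.
- by move=> ?; apply: measurableD => //; exact: bigsetU_measurable.
- by rewrite -seqDU_bigcup_eq.
- by move=> x; rewrite -seqDU_bigcup_eq; exact: f0.
have sF n : seqDU F n `<=` \bigcup_n F n.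
  by rewrite seqDU_bigcup_eq; exact: bigcup_sup.
apply: lime_le => /=.
  apply: is_cvg_nneseries => n _ _.
  by apply: integral_ge0 => x /sF; exact: f0.
apply: nearW => n.
rewrite -ge0_integral_bigsetU//=; first last.
- move=> x; rewrite -bigcup_seq => -[k _ /sF]; exact: f0.
- apply: measurable_funS mf; first exact: bigcup_measurable.
  by rewrite -bigcup_seq => x [k _ /sF].
- exact: (sub_trivIset (@subsetT _ _)).
- exact: iota_uniq.
- by move=> k; apply: measurableD => //; exact: bigsetU_measurable.
(* The first [n.+1] layers have union [F n] by monotonicity; with no layer the integral is [0]. *)
rewrite big_mkord -bigsetU_seqDU.
case: n => [|n]; first by rewrite big_ord0 integral_set0.
apply: le_trans (FM n).
rewrite le_eqVlt; apply/orP; left; apply/eqP; congr (integral _ _ _).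
apply/seteqP; split => x.
  rewrite -(bigcup_mkord _ F) => -[k /= kn]; have := ndF _ _ (ltnSE kn).
  by move=> /subsetPset; exact.
by move=> Fx; rewrite -(bigcup_mkord _ F); exists n => /=.
Qed.

End exhaustion.

Section plane_measurability.
Context {R : realType}.
Implicit Types (A : set (R * R)) (f : R -> R -> R).

(** Neighbourhoods are squares, as in [locally_2d] and [continuity_2d_pt] of Coquelicot, so that
    openness and continuity established there can be transferred unchanged. *)
Definition box_open A := forall p, A p ->
  exists2 e : R, 0 < e & forall q, `|q.1 - p.1| < e -> `|q.2 - p.2| < e -> A q.

Definition box_continuous A f := forall p, A p -> forall e : R, 0 < e ->
  exists2 d : R, 0 < d & forall q, `|q.1 - p.1| < d -> `|q.2 - p.2| < d ->
    `|f q.1 q.2 - f p.1 p.2| < e.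

(** [A] is the union of the boxes with rational end points that it contains, and these are countably
    many. *)
Lemma box_open_measurable A : box_open A ->
  measurable (A : set (measurableTypeR R * measurableTypeR R)).
Proof.
move=> oA.
pose box (r : rat * rat * rat * rat) : set (R * R) :=
  `]ratr r.1.1.1, ratr r.1.1.2[ `*` `]ratr r.1.2, ratr r.2[.
(* [unpickle] is partial: a number that codes no box inside [A] contributes the empty set. *)
pose F n := if unpickle n is Some r then
  if `[< box r `<=` A >] then box r else set0 else set0.
have -> : A = \bigcup_n F n.
  apply/seteqP; split=> [[x y] /[dup] Axy /oA[e e0 eA]|x [n _]]; last first.
    by rewrite /F; case: (unpickle n) => //= r; case: asboolP => // + rx; exact.
  have near z : exists a b : rat, [/\ ratr a < z, z < ratr b,
      z - e < ratr a & ratr b < z + e].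
    have /rat_in_itvoo[a /itvP ha] : z - e < z by rewrite ltrBlDr ltrDl.
    have /rat_in_itvoo[b /itvP hb] : z < z + e by rewrite ltrDl.
    by exists a, b; rewrite ?ha ?hb.
  have [a [b [ax xb ea be]]] := near x; have [c [d [cy yd ec de]]] := near y.
  exists (pickle (a, b, c, d)); first exact: I.
  rewrite /F pickleK; case: asboolP.
    move=> _; split; rewrite /= in_itv /=.
      by rewrite ax xb.
    by rewrite cy yd.
  case=> -[u v] [/=]; rewrite !in_itv /= => /andP[au ub] /andP[cv vd].
  have dist z w (r s : R) : z - e < r -> s < z + e -> r < w -> w < s ->
      `|w - z| < e.
    move=> h1 h2 h3 h4; rewrite ltr_norml ltrBlDl (lt_trans h4 h2) andbT.
    by rewrite ltrBrDl (lt_trans h1 h3).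
  by apply: eA => /=; [exact: dist ea be au ub|exact: dist ec de cv vd].
apply: bigcupT_measurable => n; rewrite /F; case: (unpickle n) => // r.
by case: asboolP => // _; apply: measurableX; exact: measurable_itv.
Qed.

Lemma box_continuous_measurable A f : box_open A -> box_continuous A f ->
  measurable_fun (A : set (measurableTypeR R * measurableTypeR R))
    (fun p => f p.1 p.2).
Proof.
move=> oA cf; apply: (measurability _ (RGenOInfty.measurableE R)).
move=> /= _ [_ [a ->]] <-.
apply: box_open_measurable => p [Ap] /=; rewrite in_itv/= andbT => afp.
have [e e0 eA] := oA _ Ap.
have [|d d0 df] := cf _ Ap (f p.1 p.2 - a); first by rewrite subr_gt0.
exists (Num.min e d); first by rewrite lt_min e0.
move=> q; rewrite !lt_min => /andP[qe1 qd1] /andP[qe2 qd2]; split; first exact: eA.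
have := df _ qd1 qd2; rewrite /= in_itv/= andbT ltr_norml => /andP[+ _].
by rewrite opprB ltrBrDr subrK.
Qed.

End plane_measurability.

(** * One-variable change of variables, as an inequality *)

Section substitution_inequality.
Context {R : realType}.
Notation mu := (@lebesgue_measure R).
Variables (A : set R) (F f : R -> R).
Hypothesis oA : open A.
Hypothesis iA : is_interval A.
Hypothesis dF : forall x, A x -> is_derive x 1 F (f x).
Hypothesis cf : forall x, A x -> {for x, continuous f}.

Lemma continuous_primitive x : A x -> {for x, continuous F}.
Proof.
by move=> Ax; apply/differentiable_continuous/derivable1_diffP; have [] := dF Ax.
Qed.

Lemma derive1_primitive x : A x -> derive1 F x = f x.
Proof. by move=> Ax; rewrite derive1E; have [_] := dF Ax. Qed.

Lemma continuous_derive1_primitive x : A x -> {for x, continuous (derive1 F)}.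
Proof.
move=> Ax; rewrite /prop_for /continuous_at derive1_primitive//.
apply: cvg_trans (cf Ax); apply: near_eq_cvg.
have : \forall y \near x, A y by exact: open_nbhs_nbhs.
by apply: filterS => y Ay; rewrite derive1_primitive.
Qed.

Lemma segment_sub a b : A a -> A b -> `[a, b] `<=` A.
Proof. by move=> Aa Ab x /=; rewrite in_itv/= => xab; exact: iA xab. Qed.

(** These are the regularity conditions of the change of variables formula on a segment; the
    one-sided limits exist because the end points lie in [A], where [F] is continuously
    differentiable. *)
Lemma C1_segment a b : A a -> A b -> [/\ {in `]a, b[, continuous (derive1 F)},
  cvg (derive1 F x @[x --> a^'+]), cvg (derive1 F x @[x --> b^'-]) &
  derivable_oo_LRcontinuous F a b].
Proof.
move=> Aa Ab; have sA x : x \in `]a, b[ -> A x.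
  by move=> /subset_itv_oo_cc /(segment_sub Aa Ab).
split.
- by move=> x /sA; exact: continuous_derive1_primitive.
- apply/cvg_ex; exists (derive1 F a); apply: cvg_at_right_filter.
  exact: continuous_derive1_primitive.
- apply/cvg_ex; exists (derive1 F b); apply: cvg_at_left_filter.
  exact: continuous_derive1_primitive.
- split; first by move=> x /sA /dF [].
  + by apply: cvg_at_right_filter; exact: continuous_primitive.
  + by apply: cvg_at_left_filter; exact: continuous_primitive.
Qed.

Lemma within_segment (g : R -> R) a b :
  (forall x, A x -> {for x, continuous g}) -> A a -> A b ->
  {within `[a, b], continuous g}.
Proof.
move=> cg Aa Ab; apply: continuous_in_subspaceT => x /[!inE] xab.
exact/cg/(segment_sub Aa Ab).
Qed.

Section increasing.
Hypothesis f0 : forall x, A x -> 0 < f x.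

Lemma primitive_increasing : {in A &, {homo F : x y / x < y}}.
Proof.
move=> x y /[!inE] Ax Ay xy; apply: (@gtr0_derive1_incr _ _ x y) => //.
- by move=> z /subset_itv_oo_cc /(segment_sub Ax Ay) /dF [].
- move=> z /subset_itv_oo_cc /(segment_sub Ax Ay) Az.
  by rewrite derive1_primitive// f0.
- exact: within_segment continuous_primitive Ax Ay.
Qed.

(** The formula holds with equality on [[a, b]], and nonnegativity allows the domain to grow to [A].
    As [a] and [b] are free, the image can be exhausted later without discussing [F] at the ends of
    [A]. *)
Lemma increasing_substitution_le (G : R -> R) a b :
  (forall x, A x -> {for F x, continuous G}) -> (forall x, A x -> 0 <= G (F x)) ->
  A a -> A b -> a <= b ->
  (\int[mu]_(x in `[F a, F b]) (G x)%:E <=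
   \int[mu]_(x in A) (G (F x) * f x)%:E)%E.
Proof.
move=> cG G0 Aa Ab ab; have [c1 c2 c3 c4] := C1_segment Aa Ab.
have sA := segment_sub Aa Ab.
have cGF x : A x -> {for x, continuous (fun x => G (F x) * f x)}.
  move=> Ax; apply: continuousM; last exact: cf.
  by apply: continuous_comp; [exact: continuous_primitive|exact: cG].
rewrite integration_by_substitution_increasing//; last 2 first.
- by move=> x y /sA Ax /sA Ay; apply: primitive_increasing; rewrite inE.
(* By the intermediate value theorem every point of the segment is a value of [F], and [G] is
   continuous at such values. *)
- apply: continuous_in_subspaceT => y /[!inE] /= yab.
  have [|x xab <-] := IVT ab (within_segment continuous_primitive Aa Ab) (v := y).
    rewrite /Num.min /Num.max.
    by case: ltP yab => FF; rewrite !in_itv/=; lra.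
  exact/cG/sA.
under eq_integral.
  by move=> x /[!inE] /sA Ax; rewrite fctE derive1_primitive//=; over.
apply: ge0_subset_integral => //=.
- exact: open_measurable.
- apply/measurable_EFinP; apply: open_continuous_measurable_fun => // x.
  by rewrite inE; exact: cGF.
- by move=> x Ax; rewrite lee_fin mulr_ge0 ?G0// ltW// f0.
Qed.

End increasing.

Section decreasing.
Hypothesis f0 : forall x, A x -> f x < 0.

Lemma primitive_decreasing : {in A &, {homo F : x y /~ x < y}}.
Proof.
move=> x y /[!inE] Ax Ay xy; apply: (@ltr0_derive1_decr _ _ y x) => //.
- by move=> z /subset_itv_oo_cc /(segment_sub Ay Ax) /dF [].
- move=> z /subset_itv_oo_cc /(segment_sub Ay Ax) Az.
  by rewrite derive1_primitive// f0.
- exact: within_segment continuous_primitive Ay Ax.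
Qed.

Lemma decreasing_substitution_le (G : R -> R) a b :
  (forall x, A x -> {for F x, continuous G}) -> (forall x, A x -> 0 <= G (F x)) ->
  A a -> A b -> a <= b ->
  (\int[mu]_(x in `[F b, F a]) (G x)%:E <=
   \int[mu]_(x in A) (G (F x) * - f x)%:E)%E.
Proof.
move=> cG G0 Aa Ab ab; have [c1 c2 c3 c4] := C1_segment Aa Ab.
have sA := segment_sub Aa Ab.
have cGF x : A x -> {for x, continuous (fun x => G (F x) * - f x)}.
  move=> Ax; apply: continuousM; last by apply: continuousN; exact: cf.
  by apply: continuous_comp; [exact: continuous_primitive|exact: cG].
rewrite integration_by_substitution_decreasing//; last 2 first.
- by move=> x y /sA Ax /sA Ay; apply: primitive_decreasing; rewrite inE.
- apply: continuous_in_subspaceT => y /[!inE] /= yab.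
  have [|x xab <-] := IVT ab (within_segment continuous_primitive Aa Ab) (v := y).
    rewrite /Num.min /Num.max.
    by case: ltP yab => FF; rewrite !in_itv/=; lra.
  exact/cG/sA.
under eq_integral.
  by move=> x /[!inE] /sA Ax; rewrite !fctE derive1_primitive//=; over.
apply: ge0_subset_integral => //=.
- exact: open_measurable.
- apply/measurable_EFinP; apply: open_continuous_measurable_fun => // x.
  by rewrite inE; exact: cGF.
- by move=> x Ax; rewrite lee_fin mulr_ge0 ?G0// oppr_ge0 ltW// f0.
Qed.

End decreasing.
End substitution_inequality.

Section half_line.
Context {R : realType}.
Notation mu := (@lebesgue_measure R).
Local Notation halfline := (`]0%R, +oo[%classic : set R).

Lemma is_interval_itv (i : interval R) : is_interval [set` i].
Proof. exact: interval_is_interval. Qed.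

Lemma halfline_bigcup : halfline = \bigcup_n `[n.+1%:R^-1, n.+1%:R]%classic.
Proof.
apply/seteqP; split=> x /=; rewrite in_itv/= ?andbT; last first.
  case=> n _; rewrite /= in_itv/= => /andP[+ _]; apply: lt_le_trans.
  by rewrite invr_gt0.
move=> x0; pose n := Num.bound (x + x^-1); exists n => //=.
have xV0 : 0 < x^-1 by rewrite invr_gt0.
have := archi_boundP (addr_ge0 (ltW x0) (ltW xV0)); rewrite -/n => hn.
have n1 : x + x^-1 < n.+1%:R by apply: lt_trans hn _; rewrite ltr_nat.
rewrite in_itv/=; apply/andP; split; last by lra.
by rewrite -[leRHS]invrK lef_pV2 ?posrE//; lra.
Qed.

Lemma nondecreasing_halfline_segment :
  nondecreasing_seq (fun n => `[n.+1%:R^-1, n.+1%:R]%classic : set R).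
Proof.
move=> m n mn; apply/subsetPset => x /=; rewrite !in_itv/= => /andP[mx xm].
apply/andP; split; last by apply: le_trans xm _; rewrite ler_nat.
by apply: le_trans mx; rewrite lef_pV2 ?posrE// ler_nat.
Qed.

(** Each segment [[1/(n+1), n+1]] has values [F a] and [F b] as end points, so the inequality on
    segments passes to their union. *)
Lemma increasing_substitution_halfline_le (A : set R) (F f G : R -> R) :
  open A -> is_interval A -> (forall x, A x -> is_derive x 1 F (f x)) ->
  (forall x, A x -> {for x, continuous f}) -> (forall x, A x -> 0 < f x) ->
  (forall y : R, 0 < y -> exists2 x, A x & F x = y) ->
  (forall y : R, 0 < y -> {for y, continuous G}) -> (forall y : R, 0 < y -> 0 <= G y) ->
  (forall x, A x -> 0 < F x) ->
  (\int[mu]_(x in halfline) (G x)%:E <= \int[mu]_(x in A) (G (F x) * f x)%:E)%E.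
Proof.
move=> oA iA dF cf f0 surF cG G0 F0.
rewrite halfline_bigcup; apply: ge0_integral_bigcup_le => //.
- exact: nondecreasing_halfline_segment.
- rewrite -halfline_bigcup; apply/measurable_EFinP.
  apply: open_continuous_measurable_fun => [|x]; first exact: interval_open.
  by rewrite inE/= in_itv/= andbT; exact: cG.
- by move=> x; rewrite -halfline_bigcup /= in_itv/= andbT lee_fin; exact: G0.
move=> n.
have [a Aa <-] : exists2 x, A x & F x = n.+1%:R^-1 by apply: surF; rewrite invr_gt0.
have [b Ab <-] : exists2 x, A x & F x = n.+1%:R by exact: surF.
(* If [b < a], then [F b < F a] and the segment is empty. *)
have [ab|ab] := leP a b; last first.
  have ba : F b < F a by have incF := primitive_increasing iA dF f0; apply: incF; rewrite ?inE.
  rewrite set_itv_ge; last by rewrite bnd_simp -ltNge.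
  rewrite integral_set0.
  apply: integral_ge0 => x Ax; rewrite lee_fin mulr_ge0//; last exact/ltW/f0.
  exact/G0/F0.
by apply: increasing_substitution_le => // x Ax; [exact/cG/F0|exact/G0/F0].
Qed.

(** Here the exhaustion is taken in the source: the segments [[1/(n+1), n+1]] are sent to
    [[F (n+1), F (1/(n+1))]], and these cover []0, T[] by surjectivity. *)
Lemma decreasing_substitution_halfline_le (F f G : R -> R) (T : R) :
  (forall x : R, 0 < x -> is_derive x 1 F (f x)) ->
  (forall x : R, 0 < x -> {for x, continuous f}) -> (forall x : R, 0 < x -> f x < 0) ->
  (forall y : R, 0 < y < T -> exists2 x, 0 < x & F x = y) ->
  (forall x : R, 0 < x -> 0 < F x < T) ->
  (forall y : R, 0 < y < T -> {for y, continuous G}) ->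
  (forall y : R, 0 < y < T -> 0 <= G y) ->
  (\int[mu]_(x in `]0%R, T[) (G x)%:E <=
   \int[mu]_(x in halfline) (G (F x) * - f x)%:E)%E.
Proof.
move=> dF cf f0 surF F0 cG G0.
have hl x : halfline x -> 0 < x by rewrite /= in_itv/= andbT.
have hlE x : 0 < x -> halfline x by rewrite /= in_itv/= andbT.
have oA : open halfline by exact: interval_open.
have iA : is_interval halfline by exact: is_interval_itv.
have decF x y : 0 < x -> x < y -> F y < F x.
  have dF' z : halfline z -> is_derive z 1 F (f z) by move=> /hl; exact: dF.
  have f0' z : halfline z -> f z < 0 by move=> /hl; exact: f0.
  move=> x0 xy; have dec := primitive_decreasing iA dF' f0'; apply: dec => //.
  - by rewrite inE; apply: hlE; exact: lt_trans xy.
  - by rewrite inE; exact: hlE.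
have ndecF x y : 0 < x -> x <= y -> F y <= F x.
  by move=> x0; rewrite le_eqVlt => /predU1P[->//|]; move/(decF _ _ x0)/ltW.
have inv0 n : 0 < n.+1%:R^-1 :> R by rewrite invr_gt0.
have -> : `]0%R, T[%classic = \bigcup_n `[F n.+1%:R, F n.+1%:R^-1]%classic.
  apply/seteqP; split=> y /=; rewrite in_itv/=.
    move=> /surF[x /hlE + <-]; rewrite halfline_bigcup => -[n _].
    rewrite /= in_itv/= => /andP[nx xn]; exists n => //=; rewrite in_itv/=.
    by rewrite !ndecF//; exact: lt_le_trans nx.
  case=> n _ /=; rewrite in_itv/= => /andP[yl yr].
  have /andP[p1 _] := F0 _ (ltr0Sn R n); have /andP[_ p2] := F0 _ (inv0 n).
  by rewrite (lt_le_trans p1 yl) (le_lt_trans yr p2).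
have JE : \bigcup_n `[F n.+1%:R, F n.+1%:R^-1]%classic `<=` `]0%R, T[%classic.
  move=> y [n _] /=; rewrite !in_itv/= => /andP[yl yr].
  have /andP[p1 _] := F0 _ (ltr0Sn R n); have /andP[_ p2] := F0 _ (inv0 n).
  by rewrite (lt_le_trans p1 yl) (le_lt_trans yr p2).
apply: ge0_integral_bigcup_le => //.
- move=> m n mn; apply/subsetPset => x /=; rewrite !in_itv/= => /andP[l r].
  rewrite (le_trans _ l) ?(le_trans r)//; apply: ndecF => //.
    by rewrite lef_pV2 ?posrE// ler_nat.
  by rewrite ler_nat.
- apply: measurable_funS JE _; first exact: measurable_itv.
  apply/measurable_EFinP; apply: open_continuous_measurable_fun => [|x].
    exact: interval_open.
  by rewrite inE/= in_itv/=; exact: cG.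
- by move=> x /JE; rewrite /= in_itv/= lee_fin; exact: G0.
move=> n; apply: decreasing_substitution_le => //.
- by move=> z /hl; exact: dF.
- by move=> z /hl; exact: cf.
- by move=> z /hl; exact: f0.
- by move=> z /hl /F0; exact: cG.
- by move=> z /hl /F0; exact: G0.
- exact: hlE.
- exact: hlE.
- by rewrite (@le_trans _ _ 1) ?ler1n// invf_le1// ler1n.
Qed.

End half_line.

(** * Tonelli's theorem on open regions *)

Section region.
Context {R : realType}.
Notation mu := (@lebesgue_measure R).
Local Notation mu2 := (mu \x mu)%E.
Local Open Scope ereal_scope.
Variables (W : set (R * R)) (f : R -> R -> R).
Hypothesis oW : box_open W.
Hypothesis cf : box_continuous W f.
Hypothesis f0 : forall p, W p -> (0 <= f p.1 p.2)%R.

(** The zero extension brings a region with varying sections under Tonelli's theorem on the whole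
    plane. *)
Let g := (fun p : R * R => (f p.1 p.2)%:E) \_ W.

Let g0 p : 0 <= g p.
Proof. by apply: erestrict_ge0 => q Wq; rewrite lee_fin f0. Qed.

Let mW : measurable (W : set (measurableTypeR R * measurableTypeR R)).
Proof. exact: box_open_measurable. Qed.

Lemma region_measurable :
  measurable_fun (W : set (measurableTypeR R * measurableTypeR R))
    (fun p => (f p.1 p.2)%:E).
Proof. by apply/measurable_EFinP; exact: box_continuous_measurable. Qed.

Let mg : measurable_fun [set: measurableTypeR R * measurableTypeR R] g.
Proof. have [+ _] := measurable_restrictT (fun p : R * R => (f p.1 p.2)%:E) mW.
apply; exact: region_measurable. Qed.

Let sec1 x : \int[mu]_(y in [set y | W (x, y)]) (f x y)%:E = \int[mu]_y g (x, y).
Proof.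
rewrite integral_mkcond; apply: eq_integral => y _; rewrite /g /patch.
by congr (if _ then _ else _); apply/idP/idP; rewrite !inE.
Qed.

Let sec2 y : \int[mu]_(x in [set x | W (x, y)]) (f x y)%:E = \int[mu]_x g (x, y).
Proof.
rewrite integral_mkcond; apply: eq_integral => x _; rewrite /g /patch.
by congr (if _ then _ else _); apply/idP/idP; rewrite !inE.
Qed.

Lemma region_tonelli1 : \int[mu2]_(p in W) (f p.1 p.2)%:E =
  \int[mu]_x \int[mu]_(y in [set y | W (x, y)]) (f x y)%:E.
Proof.
rewrite integral_mkcond -/g; transitivity (\int[mu]_x fubini_F mu g x).
  exact: (@fubini_tonelli1 _ _ _ _ R mu mu g mg g0).
by apply: eq_integral => x _; rewrite sec1.
Qed.

Lemma region_tonelli2 : \int[mu2]_(p in W) (f p.1 p.2)%:E =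
  \int[mu]_y \int[mu]_(x in [set x | W (x, y)]) (f x y)%:E.
Proof.
rewrite integral_mkcond -/g; transitivity (\int[mu]_x fubini_G mu g x).
  exact: (@fubini_tonelli2 _ _ _ _ R mu mu g mg g0).
by apply: eq_integral => x _; rewrite sec2.
Qed.

Lemma region_section1_measurable : measurable_fun [set: measurableTypeR R]
  (fun x => \int[mu]_(y in [set y | W (x, y)]) (f x y)%:E).
Proof.
under [X in measurable_fun _ X]funext do rewrite sec1.
exact: measurable_fun_fubini_tonelli_F.
Qed.

Lemma region_section2_measurable : measurable_fun [set: measurableTypeR R]
  (fun y => \int[mu]_(x in [set x | W (x, y)]) (f x y)%:E).
Proof.
under [X in measurable_fun _ X]funext do rewrite sec2.
exact: measurable_fun_fubini_tonelli_G.
Qed.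

Lemma region_section1_ge0 x : 0 <= \int[mu]_(y in [set y | W (x, y)]) (f x y)%:E.
Proof. by rewrite sec1; apply: integral_ge0. Qed.

Lemma region_section2_ge0 y : 0 <= \int[mu]_(x in [set x | W (x, y)]) (f x y)%:E.
Proof. by rewrite sec2; apply: integral_ge0. Qed.

(** A positive value at [p] would keep [f] above half of it on a small box, which has positive
    measure. *)
Lemma region_eq0 : \int[mu2]_(p in W) (f p.1 p.2)%:E = 0 ->
  forall p, W p -> f p.1 p.2 = 0%R.
Proof.
move=> i0 p Wp; apply/eqP; rewrite eq_le f0// andbT leNgt; apply/negP => fp0.
have fp2 : (0 < f p.1 p.2 / 2)%R by rewrite divr_gt0.
have [e e0 eW] := oW Wp; have [d d0 df] := cf Wp fp2.
pose m : R := Num.min e d; have m0 : (0 < m)%R by rewrite lt_min e0.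
pose B : set (R * R) :=
  `](p.1 - m)%R, (p.1 + m)%R[%classic `*` `](p.2 - m)%R, (p.2 + m)%R[%classic.
have mB : measurable (B : set (measurableTypeR R * measurableTypeR R)).
  by apply: measurableX; exact: measurable_itv.
have near (r s : R) : s \in `](r - m)%R, (r + m)%R[ -> (`|s - r| < e)%R /\ (`|s - r| < d)%R.
  rewrite in_itv/= => /andP[h1 h2]; apply/andP; rewrite -lt_min -/m.
  by rewrite ltr_norml ltrBlDl h2 andbT ltrBrDl.
have BW : B `<=` W by move=> q [/= /near[? ?] /near[? ?]]; apply: eW.
have fB q : B q -> (f p.1 p.2 / 2 <= f q.1 q.2)%R.
  move=> [/= /near[? h1] /near[? h2]]; have := df _ h1 h2.
  by rewrite ltr_norml => /andP[+ _]; lra.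
have : \int[mu2]_(q in B) (f p.1 p.2 / 2)%:E <= 0.
  rewrite -i0; apply: (@le_trans _ _ (\int[mu2]_(q in B) (f q.1 q.2)%:E)).
    apply: ge0_le_integral => //.
    - by move=> q _; rewrite lee_fin ltW.
    - exact: measurable_funS region_measurable.
  apply: ge0_subset_integral => //; first exact: region_measurable.
rewrite integral_cst//= product_measure1E//; try exact: measurable_itv.
rewrite /= !lebesgue_measure_itv/= !lte_fin !ifT; [|lra|lra].
by rewrite -!EFinD -!EFinM lee_fin leNgt !mulr_gt0//; lra.
Qed.

End region.

Section translation.
Context {R : realType}.
Notation mu := (@lebesgue_measure R).
Local Open Scope ereal_scope.

(** Lebesgue measure is determined by its values on intervals, and translation preserves their
    length. *)
Lemma lebesgue_measureD (c : R) (A : set R) : measurable A ->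
  pushforward mu (fun x : measurableTypeR R => (x + c)%R : measurableTypeR R) A = mu A.
Proof.
move=> mA; apply/esym/lebesgue_measure_unique => //; first exact: measurable_funD.
move=> ? _ [[a b]] _ <-.
rewrite /= /pushforward (_ : _ @^-1` _ = `](a - c)%R, (b - c)%R]%classic).
  rewrite !lebesgue_measure_itv/= !lte_fin ltrD2r.
  by case: ifPn => // _; rewrite -!EFinB; congr EFin; ring.
by apply/seteqP; split => x /=; rewrite !in_itv/= ltrBlDr lerBrDr.
Qed.

Lemma ge0_integral_translation (f : R -> \bar R) (a b c : R) :
  measurable_fun `](a + c)%R, (b + c)%R[ f ->
  (forall x, `](a + c)%R, (b + c)%R[%classic x -> 0 <= f x) ->
  \int[mu]_(x in `]a, b[) f (x + c)%R = \int[mu]_(x in `](a + c)%R, (b + c)%R[) f x.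
Proof.
move=> mf f0.
have mphi : measurable_fun setT
    (fun x : measurableTypeR R => (x + c)%R : measurableTypeR R).
  exact: measurable_funD.
have -> : `]a, b[%classic = (fun x : measurableTypeR R => (x + c)%R : measurableTypeR R)
    @^-1` `](a + c)%R, (b + c)%R[%classic.
  by apply/seteqP; split => x /=; rewrite !in_itv/= !ltrD2r.
rewrite -(ge0_integral_pushforward mphi)//; last first.
  by move=> x; rewrite inE; exact: f0.
by apply: eq_measure_integral => A mA _; exact: lebesgue_measureD.
Qed.

(** The map [x -> c - x] is a sign change followed by a translation, and Lebesgue measure is
    invariant under both. *)
Lemma ge0_integral_reflection (f : R -> \bar R) (a b c : R) :
  measurable_fun `](c - b)%R, (c - a)%R[ f ->
  (forall x, `](c - b)%R, (c - a)%R[%classic x -> 0 <= f x) ->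
  \int[mu]_(x in `]a, b[) f (c - x)%R = \int[mu]_(x in `](c - b)%R, (c - a)%R[) f x.
Proof.
move=> mf f0.
have mphi : measurable_fun setT (-%R : measurableTypeR R -> measurableTypeR R).
  exact: oppr_measurable.
have -> : `]a, b[%classic = (-%R : measurableTypeR R -> measurableTypeR R)
    @^-1` `](- b)%R, (- a)%R[%classic.
  by apply/seteqP; split => x /=; rewrite !in_itv/= !ltrN2 andbC.
pose g x := f (x + c)%R.
have mg : measurable_fun `](- b)%R, (- a)%R[ g.
  apply: (measurable_comp (F := `](c - b)%R, (c - a)%R[%classic)) => //.
    move=> _ [x /= + <-]; rewrite !in_itv/= => /andP[? ?]; apply/andP; split; lra.
  exact/measurable_funTS/measurable_funD.
have g0 : {in `](- b)%R, (- a)%R[%classic, forall y, 0 <= g y}.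
  move=> x; rewrite inE/= in_itv/= => /andP[? ?]; apply: f0.
  by rewrite /= in_itv/=; apply/andP; split; lra.
transitivity (\int[mu]_(x in `](- b)%R, (- a)%R[) g x).
  transitivity (\int[pushforward mu (-%R : measurableTypeR R -> measurableTypeR R)]_(y in `](- b)%R, (- a)%R[) g y).
    rewrite (ge0_integral_pushforward mphi)//.
    by apply: eq_integral => x _; rewrite /g/= addrC.
  by apply: eq_measure_integral => A mA _; exact: lebesgue_measureN.
rewrite (@ge0_integral_translation f) ?(addrC _ c)//.
Qed.

End translation.

(** * Change of variables from the half strip to the quadrant *)

Section planar_substitution.
Context {R : realType}.
Notation mu := (@lebesgue_measure R).
Local Notation mu2 := (mu \x mu)%E.
Local Notation halfline := (`]0%R, +oo[%classic : set R).

Lemma box_continuous1 A (f : R -> R -> R) x y :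
  box_continuous A f -> A (x, y) -> {for x, continuous (f^~ y)}.
Proof.
move=> cf Axy; apply/cvgrPdist_lt => e e0; have [d d0 df] := cf _ Axy _ e0.
near=> z; rewrite distrC; apply: (df (z, y)) => /=; last by rewrite subrr normr0.
by near: z; apply: cvgr_distC_lt.
Unshelve. all: end_near. Qed.

Lemma box_continuous2 A (f : R -> R -> R) x y :
  box_continuous A f -> A (x, y) -> {for y, continuous (f x)}.
Proof.
move=> cf Axy; apply/cvgrPdist_lt => e e0; have [d d0 df] := cf _ Axy _ e0.
near=> z; rewrite distrC; apply: (df (x, z)) => /=; first by rewrite subrr normr0.
by near: z; apply: cvgr_distC_lt.
Unshelve. all: end_near. Qed.

Variables (h : R) (H L : R -> R -> R) (lo top : R -> R) (U dU V dV : R -> R -> R).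

Definition quadrant : set (R * R) := [set p | 0 < p.1 /\ 0 < p.2].
Definition half_strip : set (R * R) := [set p | 0 < p.1 < h /\ 0 < p.2].
(** Intermediate region, the image of the half strip under [(x, y) -> (x, U x y)]. The curve [lo]
    bounds its sections at fixed [u] and [top] bounds those at fixed [x], one description for each
    order of integration. *)
Let W : set (R * R) := [set p | 0 < p.2 /\ lo p.2 < p.1 < h].

Lemma quadrant_open : box_open quadrant.
Proof.
move=> [x y] [/= x0 y0]; exists (Num.min x y); first by rewrite lt_min x0.
move=> [u v] /=; rewrite !lt_min !ltr_norml.
by move=> /andP[/andP[? ?] ?] /andP[? /andP[? ?]]; split => /=; lra.
Qed.

Lemma half_strip_open : box_open half_strip.
Proof.
move=> [x y] [/= /andP[x0 xh] y0]; exists (Num.min (Num.min x (h - x)) y).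
  by rewrite !lt_min x0 y0 subr_gt0 xh.
move=> [u v] /=; rewrite !lt_min !ltr_norml.
move=> /andP[/andP[/andP[? ?] /andP[? ?]] _] /andP[_ /andP[? ?]].
by split => /=; [apply/andP; split; lra|lra].
Qed.

Hypothesis H0 : forall p, quadrant p -> 0 <= H p.1 p.2.
Hypothesis cH : box_continuous quadrant H.
Hypothesis WE : forall x u, W (x, u) <-> 0 < x < h /\ 0 < u < top x.
Hypothesis oW : box_open W.
Hypothesis cK : box_continuous W (fun x u => H (V x u) u * dV x u).
Hypothesis VP : forall x u, W (x, u) ->
  [/\ is_derive x 1 (V^~ u) (dV x u), {for x, continuous (dV^~ u)},
      0 < dV x u & 0 < V x u].
Hypothesis V_surj : forall u v, 0 < u -> 0 < v -> exists2 x, W (x, u) & V x u = v.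
Hypothesis UP : forall x y, half_strip (x, y) ->
  [/\ is_derive y 1 (U x) (dU x y), {for y, continuous (dU x)},
      dU x y < 0 & 0 < U x y < top x].
Hypothesis U_surj : forall x u, 0 < x < h -> 0 < u < top x ->
  exists2 y, 0 < y & U x y = u.
Hypothesis LE : forall x y, half_strip (x, y) ->
  L x y = H (V x (U x y)) (U x y) * dV x (U x y) * - dU x y.
Hypothesis cL : box_continuous half_strip L.

Let K0 p : W p -> 0 <= H (V p.1 p.2) p.2 * dV p.1 p.2.
Proof.
case: p => x u /= Wp; have [_ _ /ltW dV0 V0] := VP Wp; have [u0 _] := Wp.
by rewrite mulr_ge0//; apply: (H0 (p := (V x u, u))).
Qed.

Let L0 p : half_strip p -> 0 <= L p.1 p.2.
Proof.
case: p => x y Sp; rewrite LE//=; have [_ _ dU0 Ut] := UP Sp; have [xh _] := Sp.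
rewrite mulr_ge0 ?oppr_ge0 ?(ltW dU0)//; apply: (K0 (p := (x, U x y))).
exact/WE.
Qed.

(* The substitution is performed one variable at a time by Tonelli; only the inequality
   is needed, which avoids discussing the boundary values of [U] and [V]. *)
Lemma planar_substitution_le :
  (\int[mu2]_(p in quadrant) (H p.1 p.2)%:E <=
   \int[mu2]_(p in half_strip) (L p.1 p.2)%:E)%E.
Proof.
have msec := region_section1_measurable oW cK K0.
(* First the ordinate [u] of the quadrant is fixed and its abscissa is written [V x u]. *)
apply: (@le_trans _ _ (\int[mu2]_(p in W) (H (V p.1 p.2) p.2 * dV p.1 p.2)%:E)%E).
  rewrite (region_tonelli2 quadrant_open cH H0) (region_tonelli2 oW cK K0).
  apply: ge0_le_integral => //.
  - by move=> u _; exact: (@region_section2_ge0 _ quadrant H H0).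
  - exact: region_section2_measurable quadrant_open cH H0.
  - exact: region_section2_measurable oW cK K0.
  move=> u _; have [u0|u0] := ltP 0 u; last first.
    rewrite [X in integral _ X _](_ : _ = set0).
      by rewrite integral_set0; exact: (@region_section2_ge0 _ W (fun x u => H (V x u) u * dV x u) K0).
    by apply/seteqP; split => v // -[_ /=]; rewrite ltNge u0.
  have -> : [set v | quadrant (v, u)] = halfline.
    apply/seteqP; split => v; rewrite /quadrant /= in_itv/= andbT; first by case.
    by [].
  have -> : [set x | W (x, u)] = `]lo u, h[%classic.
    apply/seteqP; split => x; rewrite /W /= in_itv/=; first by case.
    by [].
  have WuE x : `]lo u, h[%classic x -> W (x, u).
    by rewrite /W /= in_itv/=.
  apply: (increasing_substitution_halfline_le (F := V^~ u) (f := dV^~ u)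
    (G := H^~ u)) => //.
  - exact: is_interval_itv.
  - by move=> x /WuE /VP[].
  - by move=> x /WuE /VP[].
  - by move=> x /WuE /VP[].
  - move=> v v0; have [x Wx <-] := V_surj u0 v0; exists x => //.
    by case: Wx; rewrite /= in_itv/=.
  - by move=> v v0; apply: (box_continuous1 cH).
  - by move=> v v0; apply: (H0 (p := (v, u))).
  - by move=> x /WuE /VP[].
(* Then [x] is fixed and [u] is written [U x y]. *)
rewrite (region_tonelli1 oW cK K0) (region_tonelli1 half_strip_open cL L0).
apply: ge0_le_integral => //.
- by move=> x _; exact: (@region_section1_ge0 _ W (fun x u => H (V x u) u * dV x u) K0).
- exact: region_section1_measurable half_strip_open cL L0.
move=> x _; have [xh|xh] := boolP (0 < x < h); last first.
  rewrite [X in integral _ X _](_ : _ = set0).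
    by rewrite integral_set0; exact: (@region_section1_ge0 _ half_strip L L0).
  by apply/seteqP; split => u // /WE [xh']; rewrite xh' in xh.
have -> : [set u | W (x, u)] = `]0%R, top x[%classic.
  apply/seteqP; split => u; first by move=> /WE[_]; rewrite /= in_itv.
  by rewrite /= in_itv/= => ut; apply/WE.
have -> : [set y | half_strip (x, y)] = halfline.
  apply/seteqP; split => y; rewrite /half_strip /= in_itv/= andbT; first by case.
  by [].
apply: (@le_trans _ _ (\int[mu]_(y in halfline)
    (H (V x (U x y)) (U x y) * dV x (U x y) * - dU x y)%:E)%E).
  apply: (decreasing_substitution_halfline_le (F := U x) (f := dU x)
    (G := fun u => H (V x u) u * dV x u)) => //.
  - by move=> y y0; have [] : [/\ _, _, _ & _] := UP (conj xh y0 : half_strip (x, y)).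
  - by move=> y y0; have [] : [/\ _, _, _ & _] := UP (conj xh y0 : half_strip (x, y)).
  - by move=> y y0; have [] : [/\ _, _, _ & _] := UP (conj xh y0 : half_strip (x, y)).
  - by move=> u /(U_surj xh).
  - by move=> y y0; have [] : [/\ _, _, _ & _] := UP (conj xh y0 : half_strip (x, y)).
  - by move=> u ut; apply: (box_continuous2 cK); apply/WE.
  - by move=> u ut; apply: (K0 (p := (x, u))); apply/WE.
rewrite le_eqVlt; apply/orP; left; apply/eqP/eq_integral => y.
by rewrite inE/= in_itv/= andbT => y0; rewrite LE.
Qed.

End planar_substitution.

(** * Folding the quadrant onto the half strip *)

Section folding.
Context {R : realType}.
Notation mu := (@lebesgue_measure R).
Local Notation mu2 := (mu \x mu)%E.
Local Notation halfline := (`]0%R, +oo[%classic : set R).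
Variables (h : R) (H : R -> R -> R).
Hypothesis h0 : 0 < h.
Hypothesis H0 : forall p, quadrant p -> 0 <= H p.1 p.2.
Hypothesis cH : box_continuous quadrant H.

(** The quadrant is folded like an accordion: even tiles are translated onto the strip and odd tiles
    are reflected onto it. *)
Definition fold_term (j : nat) (x y : R) : R :=
  if odd j then H (j.+1%:R * h - x) y else H (j%:R * h + x) y.

Definition tile (j : nat) : set (R * R) :=
  [set p | j%:R * h < p.1 < j.+1%:R * h /\ 0 < p.2].

Lemma tile_quadrant j : tile j `<=` quadrant.
Proof.
move=> [x y] [/= /andP[jx _] y0]; split => //=; apply: le_lt_trans jx.
by rewrite mulr_ge0// ltW.
Qed.

Lemma tile_open j : box_open (tile j).
Proof.
move=> [x y] [/= /andP[x0 xh] y0].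
exists (Num.min (Num.min (x - j%:R * h) (j.+1%:R * h - x)) y).
  by rewrite !lt_min y0 !subr_gt0 x0 xh.
move=> [u v] /=; rewrite !lt_min !ltr_norml.
move=> /andP[/andP[/andP[? ?] /andP[? ?]] _] /andP[_ /andP[? ?]].
by split => /=; [apply/andP; split; lra|lra].
Qed.

Lemma box_continuous_sub (A B : set (R * R)) (f : R -> R -> R) :
  A `<=` B -> box_continuous B f -> box_continuous A f.
Proof. by move=> AB cf p /AB; exact: cf. Qed.

Let mapsto j x y : half_strip h (x, y) ->
  tile j ((if odd j then j.+1%:R * h - x else j%:R * h + x), y).
Proof.
move=> [/= /andP[x0 xh] y0]; split => //=; rewrite -natr1.
by case: odd; apply/andP; split; lra.
Qed.

Lemma fold_term_ge0 j p : half_strip h p -> 0 <= fold_term j p.1 p.2.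
Proof.
case: p => x y /(mapsto j) /tile_quadrant; rewrite /fold_term.
by case: odd => /H0.
Qed.

Lemma fold_term_continuous j : box_continuous (half_strip h) (fold_term j).
Proof.
move=> [x y] Sp e e0; have /cH/(_ _ e0)[d d0 df] := tile_quadrant (mapsto j Sp).
exists d => // -[u v] /= xd yd; move: df; rewrite /fold_term; case: odd => df.
  apply: (df (j.+1%:R * h - u, v)) => //; move: xd; rewrite distrC /fst.
  by move: (_ * h) => c; rewrite (_ : c - u - (c - x) = x - u)//; ring.
apply: (df (j%:R * h + u, v)) => //; move: xd; rewrite /fst.
by move: (_ * h) => c; rewrite (_ : c + u - (c + x) = u - x)//; ring.
Qed.

Lemma integral_fold_term j : (\int[mu2]_(p in half_strip h) (fold_term j p.1 p.2)%:E =
  \int[mu2]_(p in tile j) (H p.1 p.2)%:E)%E.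
Proof.
have cT := box_continuous_sub (@tile_quadrant j) cH.
have T0 p : tile j p -> 0 <= H p.1 p.2 by move=> /tile_quadrant; exact: H0.
rewrite (region_tonelli2 (@half_strip_open _ h) (@fold_term_continuous j) (@fold_term_ge0 j)).
rewrite (region_tonelli2 (@tile_open j) cT T0).
apply: eq_integral => y _; have [y0|y0] := ltP 0 y; last first.
  rewrite [X in integral _ X _](_ : _ = set0); last first.
    by apply/seteqP; split => v // -[_ /=]; rewrite ltNge y0.
  rewrite [X in _ = integral _ X _](_ : _ = set0) ?integral_set0//.
  by apply/seteqP; split => v // -[_ /=]; rewrite ltNge y0.
have -> : [set x | half_strip h (x, y)] = `]0, h[%classic.
  apply/seteqP; split => x; rewrite /half_strip /= in_itv/=; first by case.
  by [].
have tileE : [set x | tile j (x, y)] = `](j%:R * h), (j.+1%:R * h)[%classic.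
  apply/seteqP; split => x; rewrite /tile /= in_itv/=; first by case.
  by [].
have inE' x : `](j%:R * h), (j.+1%:R * h)[%classic x -> tile j (x, y).
  by rewrite -tileE.
rewrite tileE.
have mH : measurable_fun `](j%:R * h), (j.+1%:R * h)[ (fun x => (H x y)%:E).
  apply/measurable_EFinP; apply: open_continuous_measurable_fun => [|x].
    exact: interval_open.
  by rewrite inE => /inE'; exact: box_continuous1.
have H0' x : `](j%:R * h), (j.+1%:R * h)[%classic x -> (0 <= (H x y)%:E)%E.
  by move=> /inE' /T0; rewrite lee_fin.
rewrite /fold_term; case: odd.
  have := @ge0_integral_reflection _ (fun x => (H x y)%:E) 0 h (j.+1%:R * h).
  rewrite subr0 (_ : j.+1%:R * h - h = j%:R * h); last by rewrite -natr1; ring.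
  by move=> <-.
have := @ge0_integral_translation _ (fun x => (H x y)%:E) 0 h (j%:R * h).
rewrite add0r (_ : h + j%:R * h = j.+1%:R * h); last by rewrite -natr1; ring.
by move=> <- //; apply: eq_integral => x _; rewrite addrC.
Qed.

(** The tiles are pairwise disjoint subsets of the quadrant; the vertical lines between them are
    left out. *)
Lemma sum_integral_fold_term n :
  (\int[mu2]_(p in half_strip h) (\sum_(j < n) fold_term j p.1 p.2)%:E <=
   \int[mu2]_(p in quadrant) (H p.1 p.2)%:E)%E.
Proof.
have mT j : measurable (tile j : set (measurableTypeR R * measurableTypeR R)).
  by apply: box_open_measurable; exact: tile_open.
have mQ : measurable (quadrant : set (measurableTypeR R * measurableTypeR R)).
  by apply: box_open_measurable; exact: quadrant_open.
have mS : measurable (half_strip h : set (measurableTypeR R * measurableTypeR R)).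
  by apply: box_open_measurable; exact: half_strip_open.
under eq_integral do rewrite -sumEFin.
rewrite ge0_integral_sum//; last 2 first.
- by move=> j; exact: region_measurable (@half_strip_open _ h) (@fold_term_continuous j).
- by move=> j p Sp; rewrite lee_fin fold_term_ge0.
under eq_bigr do rewrite integral_fold_term.
rewrite -(big_mkord xpredT (fun j => \int[mu2]_(p in tile j) (H p.1 p.2)%:E)%E).
have sub : \big[setU/set0]_(j <- index_iota 0 n) tile j `<=` quadrant.
  by rewrite -bigcup_seq => p [j _ /tile_quadrant].
have mH := region_measurable quadrant_open cH.
rewrite -ge0_integral_bigsetU//; last 4 first.
- exact: iota_uniq.
- move=> i j _ _ [[x y] [[/= /andP[h1 h2] _] [/= /andP[h3 h4] _]]].
  have /ltnSE ij : (i < j.+1)%N by rewrite -(ltr_nat R) -(ltr_pM2r h0); exact: lt_trans h1 h4.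
  have /ltnSE ji : (j < i.+1)%N by rewrite -(ltr_nat R) -(ltr_pM2r h0); exact: lt_trans h3 h2.
  by apply/eqP; rewrite eqn_leq ij.
- apply: measurable_funS sub mH => //.
- by move=> p /sub Qp; rewrite lee_fin H0.
apply: ge0_subset_integral => //.
by apply: bigsetU_measurable => j _; exact: mT.
Qed.

(** The bound up to every [e] says that [G] is at most the limit of the increasing partial sums.
    This limit is taken in the extended reals, where it always exists, and is integrated by monotone
    convergence. *)
Lemma folding_le (G : R -> R -> R) : box_continuous (half_strip h) G ->
  (forall p, half_strip h p -> 0 <= G p.1 p.2) ->
  (forall p, half_strip h p -> forall e : R, 0 < e ->
    exists n, G p.1 p.2 <= \sum_(j < n) fold_term j p.1 p.2 + e) ->
  (\int[mu2]_(p in half_strip h) (G p.1 p.2)%:E <=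
   \int[mu2]_(p in quadrant) (H p.1 p.2)%:E)%E.
Proof.
move=> cG G0 GE.
have mS : measurable (half_strip h : set (measurableTypeR R * measurableTypeR R)).
  by apply: box_open_measurable; exact: half_strip_open.
pose S n p : \bar R := (\sum_(j < n) fold_term j p.1 p.2)%:E.
have mterm n : measurable_fun (half_strip h : set (measurableTypeR R * measurableTypeR R)) (S n).
  rewrite /S; under eq_fun do rewrite -sumEFin.
  apply: emeasurable_sum => j.
  exact: region_measurable (@half_strip_open _ h) (@fold_term_continuous j).
have S0 n p : half_strip h p -> (0 <= S n p)%E.
  by move=> Sp; rewrite lee_fin sumr_ge0// => j _; rewrite fold_term_ge0.
have ndS p : half_strip h p -> nondecreasing_seq (S ^~ p).
  move=> Sp; apply/nondecreasing_seqP => n; rewrite lee_fin big_ord_recr/= lerDl.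
  exact: fold_term_ge0.
apply: (@le_trans _ _ (\int[mu2]_(p in half_strip h) limn (S ^~ p))%E).
  apply: ge0_le_integral => //.
  - exact: region_measurable (@half_strip_open _ h) cG.
  - apply: (emeasurable_fun_cvg S) => // p Sp.
    exact/ereal_nondecreasing_is_cvgn/ndS.
  move=> p Sp; apply/lee_addgt0Pr => e e0; have [n Gn] := GE _ Sp _ e0.
  apply: (@le_trans _ _ (S n p + e%:E)%E); first by rewrite -EFinD lee_fin.
  apply: leeD2r; apply: lime_ge; first exact/ereal_nondecreasing_is_cvgn/ndS.
  by exists n => // m /= nm; exact: ndS.
rewrite (@monotone_convergence _ _ _ mu2 _ mS S)//.
apply: lime_le.
  apply: ereal_nondecreasing_is_cvgn => m n mn; apply: ge0_le_integral => //.
  - by move=> p; exact: S0.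
  - by move=> p Sp; exact: ndS.
by apply: nearW => n; exact: sum_integral_fold_term.
Qed.

End folding.

(** * Finiteness of the mass *)

Section finiteness.
Context {R : realType}.
Notation mu := (@lebesgue_measure R).
Local Notation mu2 := (mu \x mu)%E.
Local Notation halfline := (`]0%R, +oo[%classic : set R).

(* Products [weight (x - a) * weight (y - b)] are integrable over the plane and
   dominate functions with a simple pole at [a + i b] and quartic decay. *)
Definition weight (s : R) : R := (Num.sqrt `|s| * (1 + `|s|))^-1.

Lemma weight_ge0 s : 0 <= weight s.
Proof. by rewrite invr_ge0 mulr_ge0// ?sqrtr_ge0// addr_ge0. Qed.

Lemma weight_continuous s : s != 0 -> {for s, continuous weight}.
Proof.
move=> s0; apply: continuousV.
  by rewrite mulf_neq0// ?sqrtr_eq0 -?ltNge ?normr_gt0// gt_eqF// ltr_wpDr.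
apply: continuousM; last by apply: continuousD; [exact: cvg_cst|exact: norm_continuous].
by apply: continuous_comp; [exact: norm_continuous|exact: sqrt_continuous].
Qed.

Lemma weight_measurable : measurable_fun [set: measurableTypeR R] weight.
Proof.
have m1 : measurable ([set 0] : set (measurableTypeR R)) by exact: measurable_set1.
(* The point [0], where [weight] is not continuous, is split off. *)
rewrite -(setUv [set (0 : R)]); apply/measurable_funU => //.
  exact: measurableC.
split; first exact: measurable_fun_set1.
apply: open_continuous_measurable_fun.
  by apply: closed_openC; exact: closed_eq.
by move=> x /[!inE] /eqP; exact: weight_continuous.
Qed.

(** This substitution from []0, 1[] to the half line makes [weight] bounded: the square cancels the
    square root singularity at [0], and the quotient brings infinity to [1]. *)
Let F (x : R) := (x / (1 - x)) ^+ 2.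
Let f (x : R) := 2 * (x / (1 - x)) * (1 - x) ^- 2.

Lemma integral_weight_halfline : (\int[mu]_(x in halfline) (weight x)%:E < +oo)%E.
Proof.
have lt1 (x : R) : `]0, 1[%classic x -> 0 < x /\ 0 < 1 - x.
  by rewrite /= in_itv/= => /andP[x0 x1]; rewrite subr_gt0.
apply: le_lt_trans (_ : (\int[mu]_(x in `]0%R, 1%R[) (weight (F x) * f x)%:E < +oo)%E).
  apply: (increasing_substitution_halfline_le (F := F)) => //.
  - exact: is_interval_itv.
  - move=> x /lt1[x0 x1].
    have x1' : 1 - x != 0 by rewrite gt_eqF.
    rewrite /F /f; apply: is_derive_eq.
    rewrite /GRing.scale/= ; field.
    exact: x1'.
  - move=> x /lt1[x0 x1]; have x1' : 1 - x != 0 by rewrite gt_eqF.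
    rewrite /f; apply: continuousM; last first.
      apply: continuousV; first by rewrite expf_neq0.
      apply: (@continuous_comp _ _ _ (fun x : R => 1 - x) (fun x => x ^+ 2)).
        by apply: continuousB => //; exact: cvg_cst.
      exact: exprn_continuous.
    apply: continuousM; first exact: cvg_cst.
    apply: continuousM => //; apply: continuousV => //.
    by apply: continuousB => //; exact: cvg_cst.
  - move=> x /lt1[x0 x1]; rewrite /f mulr_gt0 ?invr_gt0 ?exprn_gt0//.
    by rewrite mulr_gt0// divr_gt0.
  - move=> y y0; have r0 : 0 < Num.sqrt y by rewrite sqrtr_gt0.
    exists (Num.sqrt y / (1 + Num.sqrt y)).
      rewrite /= in_itv/= divr_gt0 ?addr_gt0// ltr_pdivrMr ?addr_gt0// mul1r.
      by rewrite /= ltrDr.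
    rewrite /F -[RHS]sqr_sqrtr ?ltW//; congr (_ ^+ 2); field.
    by rewrite gt_eqF ?addr_gt0//= addrK oner_neq0.
  - by move=> y y0; apply: weight_continuous; rewrite gt_eqF.
  - by move=> y _; exact: weight_ge0.
  - by move=> x /lt1[x0 x1]; rewrite /F exprn_gt0// divr_gt0.
(* [g] is the integrand after simplification; its denominator is at least [1/2], hence the bound
   [4]. *)
pose g (x : R) : R := 2 / ((1 - x) ^+ 2 + x ^+ 2).
have q0 (x : R) : 2^-1 <= (1 - x) ^+ 2 + x ^+ 2.
  rewrite -subr_ge0 (_ : _ - _ = (2 * x - 1) ^+ 2 / 2); last by field.
  by rewrite divr_ge0 ?sqr_ge0.
have q1 (x : R) : 0 < (1 - x) ^+ 2 + x ^+ 2 by apply: lt_le_trans (q0 x).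
have -> : (\int[mu]_(x in `]0%R, 1%R[) (weight (F x) * f x)%:E =
    \int[mu]_(x in `]0%R, 1%R[) (g x)%:E)%E.
  apply: eq_integral => x /[!inE] /lt1[x0 x1]; congr EFin.
  have r0 : 0 < x / (1 - x) by rewrite divr_gt0.
  rewrite /weight /F /f ger0_norm ?sqr_ge0// sqrtr_sqr gtr0_norm// /g.
  by field; rewrite !gt_eqF.
have cg (x : R) : {for x, continuous g}.
  apply: continuousM; first exact: cvg_cst.
  apply: continuousV; first by rewrite gt_eqF.
  apply: continuousD; last exact: exprn_continuous.
  apply: (@continuous_comp _ _ _ (fun x : R => 1 - x) (fun x => x ^+ 2)).
    by apply: continuousB => //; exact: cvg_cst.
  exact: exprn_continuous.
apply: le_lt_trans (_ : (\int[mu]_(x in `]0%R, 1%R[) (cst 4%:E x) < +oo)%E).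
  apply: ge0_le_integral => //.
  - by move=> x _; rewrite lee_fin divr_ge0// ltW.
  - by apply/measurable_EFinP/measurable_funTS; exact: continuous_measurable_fun.
  - move=> x _; rewrite lee_fin /g ler_pdivrMr//; have := q0 x; lra.
rewrite integral_cst//= lebesgue_measure_itv/= lte_fin ltr01.
by rewrite -EFinB -EFinM ltry.
Qed.

Lemma weightN s : weight (- s) = weight s.
Proof. by rewrite /weight normrN. Qed.

Let mweight : measurable_fun [set: measurableTypeR R] (fun x => (weight x)%:E).
Proof. by apply/measurable_EFinP; exact: weight_measurable. Qed.

Lemma integral_weight : (\int[mu]_x (weight x)%:E < +oo)%E.
Proof.
have c0 : (\int[mu]_(x in `[0%R, +oo[) (weight x)%:E < +oo)%E.
  rewrite -integral_itv_obnd_cbnd ?integral_weight_halfline//.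
  by apply: measurable_funTS; exact: mweight.
rewrite (_ : [set: R] = `]-oo, 0%R[%classic `|` `[0%R, +oo[%classic); last first.
  by rewrite itv_setU_setT.
rewrite ge0_integral_setU//=; last 3 first.
- exact: measurable_funTS.
- by move=> x _; rewrite lee_fin weight_ge0.
- apply/disj_setPS => x /=; rewrite !in_itv/= andbT => -[h1 h2].
  by have := lt_le_trans h1 h2; rewrite ltxx.
rewrite lte_add_pinfty//; apply: le_lt_trans c0.
rewrite (ge0_integration_by_substitution0 mweight); last first.
  by move=> x; rewrite lee_fin weight_ge0.
have -> : (\int[mu]_(r in `]-oo, 0%R]) (weight (- r))%:E =
    \int[mu]_(r in `]-oo, 0%R]) (weight r)%:E)%E.
  by apply: eq_integral => x _; rewrite weightN.
apply: ge0_subset_integral => //.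
- exact: measurable_funTS.
- by move=> x _; rewrite lee_fin weight_ge0.
- by move=> x /=; rewrite !in_itv/= => /ltW.
Qed.

Lemma integral_weight_translation a : (\int[mu]_x (weight (x - a))%:E < +oo)%E.
Proof.
have mphi : measurable_fun setT
    (fun x : measurableTypeR R => (x - a)%R : measurableTypeR R).
  exact: measurable_funB.
have := ge0_integral_pushforward mphi mu measurableT mweight.
rewrite preimage_setT /= => <-; last by move=> x _; rewrite lee_fin weight_ge0.
apply: le_lt_trans integral_weight.
rewrite le_eqVlt; apply/orP; left; apply/eqP.
by apply: eq_measure_integral => A mA _; exact: (lebesgue_measureD (- a)).
Qed.

End finiteness.

Section mass.
Context {R : realType}.
Notation mu := (@lebesgue_measure R).
Local Notation mu2 := (mu \x mu)%E.

Let plane := (measurableTypeR R * measurableTypeR R)%type.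

Lemma integral_weight_product (a b : R) :
  (\int[mu2]_p (weight (p.1 - a) * weight (p.2 - b))%:E < +oo)%E.
Proof.
have mw c : measurable_fun [set: measurableTypeR R] (fun x => weight (x - c)).
  exact: (measurableT_comp weight_measurable (measurable_funB _ _)).
have mg : measurable_fun [set: plane]
    (fun p => (weight (p.1 - a) * weight (p.2 - b))%:E).
  apply/measurable_EFinP; apply: measurable_funM.
    exact: (measurableT_comp (mw a) measurable_fst).
  exact: (measurableT_comp (mw b) measurable_snd).
have g0 (p : R * R) : (0 <= (weight (p.1 - a) * weight (p.2 - b))%:E)%E.
  by rewrite lee_fin mulr_ge0 ?weight_ge0.
have -> := @fubini_tonelli1 _ _ _ _ R mu mu _ mg g0.
rewrite /fubini_F /=.
have cst_fin c : (\int[mu]_x (weight (x - c))%:E)%E \is a fin_num.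
  rewrite ge0_fin_numE ?integral_weight_translation//.
  by apply: integral_ge0 => x _; rewrite lee_fin weight_ge0.
under eq_integral => x _.
  under eq_integral do rewrite EFinM.
  rewrite ge0_integralZl//; last 3 first.
  - by apply/measurable_EFinP; exact: mw.
  - by move=> y _; rewrite lee_fin weight_ge0.
  - by rewrite lee_fin weight_ge0.
  over.
rewrite /= ge0_integralZr//.
- by rewrite lte_mul_pinfty// ?integral_weight_translation//; apply: integral_ge0 => x _; rewrite lee_fin weight_ge0.
- by apply/measurable_EFinP; exact: mw.
- by move=> y _; rewrite lee_fin weight_ge0.
- by apply: integral_ge0 => x _; rewrite lee_fin weight_ge0.
Qed.

Lemma vertical_line_null (a : R) : mu2.-negligible [set p : plane | p.1 = a].
Proof.
exists ([set a] `*` setT); split => //.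
- by apply: measurableX => //; exact: measurable_set1.
- rewrite product_measure1E//.
  by rewrite /= lebesgue_measure_set1 mul0e.
Qed.

Lemma horizontal_line_null (b : R) : mu2.-negligible [set p : plane | p.2 = b].
Proof.
exists (setT `*` [set b]); split => //.
- by apply: measurableX => //; exact: measurable_set1.
- rewrite product_measure1E//.
  by rewrite /= lebesgue_measure_set1 mule0.
Qed.

(** The bound is asked only off the lines [x = a i] and [y = b i]: there [weight] takes the default
    value [0] of an inverse at [0] and dominates nothing. These countably many lines form a null
    set. *)
Lemma quadrant_integral_fin (H : R -> R -> R) (n : nat) (K a b : nat -> R) :
  (forall p, quadrant p -> 0 <= H p.1 p.2) -> box_continuous quadrant H ->
  (forall i, 0 <= K i) ->
  (forall x y, 0 < x -> 0 < y -> (forall i, x <> a i /\ y <> b i) ->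
    H x y <= \sum_(i < n) K i * (weight (x - a i) * weight (y - b i))) ->
  (\int[mu2]_(p in quadrant) (H p.1 p.2)%:E < +oo)%E.
Proof.
move=> H0 cH K0 HK.
have mQ : measurable (quadrant : set plane).
  by apply: box_open_measurable; exact: quadrant_open.
have mw c : measurable_fun [set: measurableTypeR R] (fun x => weight (x - c)).
  exact: (measurableT_comp weight_measurable (measurable_funB _ _)).
pose g i (p : plane) : R := weight (p.1 - a i) * weight (p.2 - b i).
have g0 i p : 0 <= g i p by rewrite mulr_ge0 ?weight_ge0.
have mg i : measurable_fun [set: plane] (fun p => (g i p)%:E).
  apply/measurable_EFinP; apply: measurable_funM.
    exact: (measurableT_comp (mw _) measurable_fst).
  exact: (measurableT_comp (mw _) measurable_snd).
apply: le_lt_trans (_ : (\int[mu2]_(p in quadrant)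
    \sum_(i < n) (K i)%:E * (g i p)%:E < +oo)%E).
  apply: ae_ge0_le_integral => //.
  - exact: region_measurable quadrant_open cH.
  - by move=> p _; apply: sume_ge0 => i _; rewrite mule_ge0 ?lee_fin.
  - apply: emeasurable_sum => i; apply: emeasurable_funM => //.
    exact: measurable_funTS.
  have nlines : \forall p \ae mu2, forall i, p.1 <> a i /\ p.2 <> b i.
    apply: ae_foralln => i.
    have [N [mN N0 subN]] := vertical_line_null (a i).
    have [M [mM M0 subM]] := horizontal_line_null (b i).
    exists (N `|` M); split; first exact: measurableU.
      exact: null_set_setU.
    move=> p /= /not_andP[/contrapT h|/contrapT h]; [left; exact: subN|right; exact: subM].
  apply: negligibleS nlines => p /=; apply: contra_not => hp [p1 p2].
  rewrite sumEFin lee_fin; exact: HK.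
rewrite ge0_integral_sum//.
- apply: lte_sum_pinfty => i _.
  rewrite ge0_integralZl//; last 3 first.
  - exact: measurable_funTS.
  - by move=> p _; rewrite lee_fin.
  - by rewrite lee_fin.
  rewrite lte_mul_pinfty//; first by rewrite lee_fin.
  apply: le_lt_trans (integral_weight_product (a i) (b i)).
  apply: (@ge0_subset_integral _ _ _ mu2 _ _ mQ measurableT _ (mg i)) => //.
  by move=> p _; rewrite lee_fin.
- move=> i; apply: emeasurable_funM => //; exact: measurable_funTS.
- by move=> i p _; rewrite mule_ge0 ?lee_fin.
Qed.

(** The three inequalities leave no room for the integral of [rho]. Finiteness of [M] makes the
    integral of [L] finite, so that it can be cancelled. *)
Lemma excess_eq0 (h : R) (L rho : R -> R -> R) (M : \bar R) :
  box_continuous (half_strip h) L -> (forall p, half_strip h p -> 0 <= L p.1 p.2) ->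
  box_continuous (half_strip h) rho -> (forall p, half_strip h p -> 0 <= rho p.1 p.2) ->
  (M < +oo -> M <= \int[mu2]_(p in half_strip h) (L p.1 p.2)%:E ->
  \int[mu2]_(p in half_strip h) (L p.1 p.2 + rho p.1 p.2)%:E <= M ->
  forall p, half_strip h p -> rho p.1 p.2 = 0%R)%E.
Proof.
move=> cL L0 cr r0 Mfin ML LM; apply: (region_eq0 (@half_strip_open _ h) cr r0).
have mS : measurable (half_strip h : set plane).
  by apply: box_open_measurable; exact: half_strip_open.
move: LM; under eq_integral do rewrite EFinD.
rewrite ge0_integralD//; last 2 first.
- exact: region_measurable (@half_strip_open _ h) cL.
- exact: region_measurable (@half_strip_open _ h) cr.
set I := (X in (X + _)%E); set J := (X in (_ + X)%E) => IJ.
have J0 : (0 <= J)%E by apply: integral_ge0 => p Sp; rewrite lee_fin r0.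
have I0 : (0 <= I)%E by apply: integral_ge0 => p Sp; rewrite lee_fin L0.
have Ifin : I \is a fin_num.
  rewrite ge0_fin_numE//; apply: le_lt_trans Mfin; apply: le_trans IJ.
  by rewrite leeDl.
apply/eqP; rewrite eq_le J0 andbT -(leeD2lE _ _ Ifin) adde0.
exact: le_trans IJ ML.
Qed.

End mass.

End PlanarMeasure.

Require Import Defs.
From Stdlib Require Import Reals Lra Lia ZArith.
From Coquelicot Require Import Coquelicot.
Open Scope R_scope.

(** * The tangent in real coordinates *)

Lemma continuity_2d_pt_comp2 (H f g : R -> R -> R) (x y : R) :
  continuity_2d_pt H (f x y) (g x y) ->
  continuity_2d_pt f x y -> continuity_2d_pt g x y ->
  continuity_2d_pt (fun u v => H (f u v) (g u v)) x y.
Proof.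
intros cH cf cg eps.
destruct (cH eps) as [d Hd].
destruct (cf d) as [d1 H1]. destruct (cg d) as [d2 H2].
exists (mkposreal _ (Rmin_pos _ _ (cond_pos d1) (cond_pos d2))); simpl.
intros u v hu hv. apply Hd.
- apply H1; eapply Rlt_le_trans; eauto using Rmin_l.
- apply H2; eapply Rlt_le_trans; eauto using Rmin_r.
Qed.

(* For fixed [x], [bU x] is monotone in [y]; [bV x u] is the value of [bW x y] at the
   [y] with [bU x y = u], so the map factors into one-variable substitutions
   [(x, y) -> (x, u)] and [(x, u) -> (u, bV x u)]. *)
Section bipolar.
Variable t : R.
Hypothesis t0 : 0 < t.

(** This is [2 |cos (x + i y)|^2]. *)
Definition bden (x y : R) : R := cos (2 * x) + cosh (2 * y).
(* [t tan (x + i y) = bU x y + i bW x y]. *)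
Definition bU (x y : R) : R := t * sin (2 * x) / bden x y.
Definition bdU (x y : R) : R := - (2 * t * sin (2 * x) * sinh (2 * y) / bden x y ^ 2).
(** At fixed [x], the point [u + i v = t tan (x + i y)] moves on the circle [u^2 + v^2 = t^2 + t u
    (tan x - 1 / tan x)] through [i t] and [- i t]; the formula solves this for [v]. *)
Definition bV (x u : R) : R := sqrt ((t * tan x - u) * (t + u * tan x) / tan x).
Definition bdV (x u : R) : R := t * u * (1 + tan x ^ 2) ^ 2 / (2 * tan x ^ 2 * bV x u).
Definition bW (x y : R) : R := t * sinh (2 * y) / bden x y.

Lemma cosh_sqr (y : R) : cosh y ^ 2 = 1 + sinh y ^ 2.
Proof.
unfold cosh, sinh. assert (h : exp y * exp (- y) = 1).
{ rewrite <- exp_plus, Rplus_opp_r. apply exp_0. }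
field_simplify. replace (exp y ^ 2 + 2 * exp y * exp (- y) + exp (- y) ^ 2) with
 (exp y ^ 2 + 2 * (exp y * exp (- y)) + exp (- y) ^ 2) by ring.
replace (exp y ^ 2 - 2 * exp y * exp (- y) + exp (- y) ^ 2 + 4) with
 (exp y ^ 2 - 2 * (exp y * exp (- y)) + exp (- y) ^ 2 + 4) by ring.
rewrite h. field.
Qed.

Lemma cosh_2a (y : R) : cosh (2 * y) = 1 + 2 * sinh y ^ 2.
Proof.
unfold cosh, sinh.
replace (2 * y) with (y + y) by ring. replace (- (y + y)) with (- y + - y) by ring.
rewrite !exp_plus. assert (h : exp y * exp (- y) = 1).
{ rewrite <- exp_plus, Rplus_opp_r. apply exp_0. }
replace (1 + 2 * ((exp y - exp (- y)) / 2) ^ 2) with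
  (1 + (exp y * exp y + exp (- y) * exp (- y)) / 2 - exp y * exp (- y)) by field.
rewrite h. field.
Qed.

Lemma sinh_pos (y : R) : 0 < y -> 0 < sinh y.
Proof.
intros y0. unfold sinh. assert (exp (- y) < exp y) by (apply exp_increasing; lra). lra.
Qed.

Lemma cosh_pos (y : R) : 0 < cosh y.
Proof. unfold cosh. assert (h := exp_pos y); assert (h' := exp_pos (- y)). lra. Qed.

Lemma bden_pos (x y : R) : 0 < y -> 0 < bden x y.
Proof.
intros y0. unfold bden. rewrite cosh_2a.
assert (h := sinh_pos _ y0). assert (h' := COS_bound (2 * x)).
nra.
Qed.

Lemma sin_2_pos (x : R) : 0 < x < PI / 2 -> 0 < sin (2 * x).
Proof. intros hx. apply sin_gt_0; lra. Qed.

Lemma tan_pos (x : R) : 0 < x < PI / 2 -> 0 < tan x.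
Proof. intros hx. apply tan_gt_0; lra. Qed.

Lemma cos_pos (x : R) : 0 < x < PI / 2 -> 0 < cos x.
Proof. intros hx. apply cos_gt_0; lra. Qed.

Lemma atan_lt_iff (s x : R) : 0 < x < PI / 2 -> (atan s < x <-> s < tan x).
Proof.
intros hx. split; intros h.
- rewrite <- (tan_atan s) at 1. destruct (atan_bound s). apply tan_increasing; lra.
- rewrite <- (atan_tan x) by lra. apply atan_increasing; exact h.
Qed.

Definition bregion (x u : R) : Prop := 0 < u /\ atan (u / t) < x < PI / 2.

(** The boundary curve [u = t tan x] is solved once for [x] and once for [u]; the two orders of
    integration need one form each. *)
Lemma bregionE (x u : R) : bregion x u <-> 0 < x < PI / 2 /\ 0 < u < t * tan x.
Proof.
unfold bregion. split.
- intros [u0 [h1 h2]].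
  assert (0 < atan (u / t)).
  { rewrite <- atan_0. apply atan_increasing. apply Rdiv_lt_0_compat; lra. }
  assert (hx : 0 < x < PI / 2) by lra. apply (atan_lt_iff (u / t) x hx) in h1.
  split; [exact hx|]. split; [exact u0|].
  apply (Rmult_lt_reg_r (/ t)); [now apply Rinv_0_lt_compat|].
  replace (t * tan x * / t) with (tan x) by (field; lra). exact h1.
- intros [hx [u0 hu]]. split; [exact u0|]. split; [|lra].
  apply (atan_lt_iff (u / t) x hx). apply (Rmult_lt_reg_r t); [lra|].
  replace (u / t * t) with u by (field; lra). lra.
Qed.

Lemma continuity_pt_tan (x : R) : 0 < x < PI / 2 -> continuity_pt tan x.
Proof. intros hx. apply continuity_pt_filterlim.
apply (ex_derive_continuous tan x). exists (tan x ^ 2 + 1). apply is_derive_tan.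
apply Rgt_not_eq, cos_pos, hx.
Qed.

Lemma continuity_2d_tan (x u : R) : 0 < x < PI / 2 ->
  continuity_2d_pt (fun x _ => tan x) x u.
Proof.
intros hx. apply (continuity_1d_2d_pt_comp tan (fun x _ => x)).
- apply continuity_pt_tan, hx.
- apply continuity_2d_pt_id1.
Qed.

Lemma locally_2d_lt (f g : R -> R -> R) (x y : R) : continuity_2d_pt f x y ->
  continuity_2d_pt g x y -> f x y < g x y -> locally_2d (fun u v => f u v < g u v) x y.
Proof.
intros cf cg h.
assert (e0 : 0 < (g x y - f x y) / 2) by lra.
generalize (locally_2d_and _ _ _ _ (cf (mkposreal _ e0)) (cg (mkposreal _ e0))).
apply locally_2d_impl. apply locally_2d_forall. intros u v [h1 h2]. simpl in h1, h2.
apply Rabs_def2 in h1. apply Rabs_def2 in h2. lra.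
Qed.

Lemma bregion_open (x u : R) : bregion x u -> locally_2d bregion x u.
Proof.
intros [u0 [h1 h2]].
assert (c1 : locally_2d (fun _ v => 0 < v) x u).
{ apply (locally_2d_lt (fun _ _ => 0) (fun _ v => v)); auto using continuity_2d_pt_const, continuity_2d_pt_id2. }
assert (c2 : locally_2d (fun x u => atan (u / t) < x) x u).
{ apply (locally_2d_lt (fun _ u => atan (u / t)) (fun x _ => x)); auto using continuity_2d_pt_id1.
  apply (continuity_1d_2d_pt_comp atan (fun _ u => u / t)).
  - apply derivable_continuous_pt, derivable_pt_atan.
  - apply continuity_2d_pt_mult; auto using continuity_2d_pt_id2, continuity_2d_pt_const. }
assert (c3 : locally_2d (fun x _ => x < PI / 2) x u).
{ apply (locally_2d_lt (fun x _ => x) (fun _ _ => PI / 2)); auto using continuity_2d_pt_const, continuity_2d_pt_id1. }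
generalize (locally_2d_and _ _ _ _ c1 (locally_2d_and _ _ _ _ c2 c3)).
apply locally_2d_impl. apply locally_2d_forall. intros v w [k1 [k2 k3]]. split; auto.
Qed.

Lemma bV_arg_pos (x u : R) : bregion x u ->
  0 < (t * tan x - u) * (t + u * tan x) / tan x.
Proof.
intros h. apply bregionE in h. destruct h as [hx hu].
assert (hT := tan_pos _ hx).
apply Rdiv_lt_0_compat; [|exact hT]. apply Rmult_lt_0_compat; nra.
Qed.

Lemma bV_pos (x u : R) : bregion x u -> 0 < bV x u.
Proof. intros h. apply sqrt_lt_R0, bV_arg_pos, h. Qed.

Lemma bV_derive (x u : R) : bregion x u -> is_derive (fun x => bV x u) x (bdV x u).
Proof.
intros h. assert (hp := bV_arg_pos _ _ h). assert (hV := bV_pos _ _ h).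
apply bregionE in h. destruct h as [hx hu].
assert (hT := tan_pos _ hx). assert (hc := cos_pos _ hx).
assert (dT : is_derive tan x (1 + tan x ^ 2)).
{ replace (1 + tan x ^ 2) with (tan x ^ 2 + 1) by ring. apply is_derive_tan. lra. }
assert (dV : is_derive (fun x => (t * tan x - u) * (t + u * tan x) / tan x) x
  (t * u * (1 + tan x ^ 2) ^ 2 / tan x ^ 2)).
{ evar_last.
  - apply (is_derive_comp (fun T => (t * T - u) * (t + u * T) / T) tan).
    + auto_derive; [lra|reflexivity].
    + exact dT.
  - unfold scal; simpl; unfold mult; simpl. field. lra. }
evar_last.
- apply (is_derive_sqrt _ x _ dV hp).
- fold (bV x u). unfold bdV. field. split; [|lra]. apply Rgt_not_eq; exact hV.
Qed.

Lemma bdV_pos (x u : R) : bregion x u -> 0 < bdV x u.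
Proof.
intros h. assert (hV := bV_pos _ _ h). apply bregionE in h. destruct h as [hx hu].
assert (hT := tan_pos _ hx). unfold bdV. apply Rdiv_lt_0_compat.
- apply Rmult_lt_0_compat; [nra|]. apply pow_lt. nra.
- apply Rmult_lt_0_compat; [|exact hV]. assert (0 < tan x ^ 2) by (apply pow_lt, hT). lra.
Qed.

Lemma continuity_2d_pow2 (f : R -> R -> R) (x y : R) :
  continuity_2d_pt f x y -> continuity_2d_pt (fun u v => f u v ^ 2) x y.
Proof.
intros cf. apply (continuity_2d_pt_ext (fun u v => f u v * f u v)); [intros; ring|].
now apply continuity_2d_pt_mult.
Qed.

Lemma continuity_2d_div (f g : R -> R -> R) (x y : R) : g x y <> 0 ->
  continuity_2d_pt f x y -> continuity_2d_pt g x y ->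
  continuity_2d_pt (fun u v => f u v / g u v) x y.
Proof.
intros h cf cg. unfold Rdiv. apply continuity_2d_pt_mult; [exact cf|].
now apply continuity_2d_pt_inv.
Qed.

Lemma bV_continuous (x u : R) : bregion x u -> continuity_2d_pt bV x u.
Proof.
intros h. assert (hp := bV_arg_pos _ _ h). apply bregionE in h. destruct h as [hx hu].
assert (hT := tan_pos _ hx).
assert (cT := continuity_2d_tan x u hx).
unfold bV. apply (continuity_1d_2d_pt_comp sqrt
  (fun x u => (t * tan x - u) * (t + u * tan x) / tan x)).
{ apply continuity_pt_sqrt. lra. }
apply continuity_2d_div; [lra| |exact cT].
apply continuity_2d_pt_mult.
- apply continuity_2d_pt_minus; [|apply continuity_2d_pt_id2].
  apply continuity_2d_pt_mult; [apply continuity_2d_pt_const|exact cT].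
- apply continuity_2d_pt_plus; [apply continuity_2d_pt_const|].
  apply continuity_2d_pt_mult; [apply continuity_2d_pt_id2|exact cT].
Qed.

Lemma bdV_continuous (x u : R) : bregion x u -> continuity_2d_pt bdV x u.
Proof.
intros h. assert (hV := bV_pos _ _ h). assert (cV := bV_continuous _ _ h).
apply bregionE in h. destruct h as [hx hu].
assert (hT := tan_pos _ hx).
assert (cT := continuity_2d_tan x u hx).
unfold bdV. apply continuity_2d_div.
- assert (0 < tan x ^ 2) by (apply pow_lt, hT). apply Rgt_not_eq. nra.
- apply continuity_2d_pt_mult.
  + apply continuity_2d_pt_mult; [apply continuity_2d_pt_const|apply continuity_2d_pt_id2].
  + apply continuity_2d_pow2, continuity_2d_pt_plus; [apply continuity_2d_pt_const|].
    now apply continuity_2d_pow2.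
- apply continuity_2d_pt_mult; [|exact cV].
  apply continuity_2d_pt_mult; [apply continuity_2d_pt_const|now apply continuity_2d_pow2].
Qed.

(** At fixed [u] and [v], the circle equation becomes [T^2 = k T + 1] for [T = tan x]; its positive
    root is taken. *)
Lemma bV_surj (u v : R) : 0 < u -> 0 < v -> exists x, bregion x u /\ bV x u = v.
Proof.
intros u0 v0.
set (k := (v ^ 2 + u ^ 2 - t ^ 2) / (t * u)).
set (s := sqrt (k ^ 2 + 4)).
assert (hs : s ^ 2 = k ^ 2 + 4). { unfold s. rewrite pow2_sqrt; nra. }
assert (s0 : 0 <= s) by apply sqrt_pos.
set (T := (k + s) / 2).
assert (T0 : 0 < T). { unfold T. nra. }
assert (hT : T ^ 2 = k * T + 1). { unfold T. nra. }
assert (hk : k * (t * u) = v ^ 2 + u ^ 2 - t ^ 2). { unfold k. field. lra. }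
assert (hv : (t * T - u) * (t + u * T) = v ^ 2 * T).
{ replace ((t * T - u) * (t + u * T)) with (t ^ 2 * T - u ^ 2 * T - t * u + t * u * T ^ 2) by ring.
  rewrite hT. replace (t * u * (k * T + 1)) with (k * (t * u) * T + t * u) by ring.
  rewrite hk. ring. }
assert (huT : u < t * T). { assert (0 < v ^ 2 * T) by (apply Rmult_lt_0_compat; [apply pow_lt|]; lra).
  assert (0 < t + u * T) by nra. nra. }
exists (atan T).
assert (hx : 0 < atan T < PI / 2).
{ split; [rewrite <- atan_0; now apply atan_increasing|apply atan_bound]. }
split.
- apply bregionE. rewrite tan_atan. auto.
- unfold bV. rewrite tan_atan, hv. replace (v ^ 2 * T / T) with (v ^ 2) by (field; lra).
  rewrite <- Rsqr_pow2. apply sqrt_Rsqr. lra.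
Qed.

Lemma bU_derive (x y : R) : 0 < y -> is_derive (bU x) y (bdU x y).
Proof.
intros y0. assert (hd := bden_pos x y y0). unfold bU, bdU, bden in *.
unfold cosh, sinh in *.
auto_derive; [lra|]. field. lra.
Qed.

Lemma bdU_neg (x y : R) : 0 < x < PI / 2 -> 0 < y -> bdU x y < 0.
Proof.
intros hx y0. assert (hd := bden_pos x y y0). unfold bdU.
apply Ropp_lt_gt_0_contravar. apply Rdiv_lt_0_compat; [|now apply pow_lt].
assert (h1 := sin_2_pos x hx). assert (h2 : 0 < sinh (2 * y)) by (apply sinh_pos; lra).
apply Rmult_lt_0_compat; [nra|exact h2].
Qed.

Lemma sin_2_tan (x : R) : cos x <> 0 -> sin (2 * x) = 2 * tan x / (1 + tan x ^ 2).
Proof.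
intros hc. rewrite sin_2a. unfold tan. assert (h := sin2_cos2 x). unfold Rsqr in h.
assert (cos x * cos x + sin x * sin x <> 0) by lra.
replace (2 * (sin x / cos x) / (1 + (sin x / cos x) ^ 2)) with
  (2 * sin x * cos x / (sin x * sin x + cos x * cos x)).
- rewrite h. field.
- field. repeat split; nra.
Qed.

Lemma cos_2_tan (x : R) : cos x <> 0 -> cos (2 * x) = (1 - tan x ^ 2) / (1 + tan x ^ 2).
Proof.
intros hc. rewrite cos_2a. unfold tan. assert (h := sin2_cos2 x). unfold Rsqr in h.
assert (cos x * cos x + sin x * sin x <> 0) by lra.
replace ((1 - (sin x / cos x) ^ 2) / (1 + (sin x / cos x) ^ 2)) with
  ((cos x * cos x - sin x * sin x) / (sin x * sin x + cos x * cos x)).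
- rewrite h. field.
- field. repeat split; nra.
Qed.

Lemma bUE (x y : R) : 0 < x < PI / 2 -> 0 < y ->
  bU x y = t * tan x / (1 + (1 + tan x ^ 2) * sinh y ^ 2).
Proof.
intros hx y0. assert (hc := cos_pos _ hx). assert (hT := tan_pos _ hx).
assert (hs := sinh_pos _ y0).
unfold bU, bden. rewrite sin_2_tan, cos_2_tan, cosh_2a by lra.
field. repeat split; nra.
Qed.

Lemma bU_bound (x y : R) : 0 < x < PI / 2 -> 0 < y -> 0 < bU x y < t * tan x.
Proof.
intros hx y0. rewrite bUE by auto. assert (hT := tan_pos _ hx).
assert (hs := sinh_pos _ y0). assert (h2 : 0 < sinh y ^ 2) by now apply pow_lt.
assert (h3 : 0 < t * tan x) by nra.
split.
- apply Rdiv_lt_0_compat; nra.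
- apply (Rmult_lt_reg_r (1 + (1 + tan x ^ 2) * sinh y ^ 2)); [nra|].
  unfold Rdiv. rewrite Rmult_assoc, Rinv_l by nra. rewrite Rmult_1_r.
   assert (0 < (1 + tan x ^ 2) * sinh y ^ 2) by (apply Rmult_lt_0_compat; nra). nra.
Qed.

Lemma bW_pos (x y : R) : 0 < y -> 0 < bW x y.
Proof.
intros y0. apply Rdiv_lt_0_compat; [|apply bden_pos; exact y0].
apply Rmult_lt_0_compat; [exact t0|]. apply sinh_pos. lra.
Qed.

Lemma bU_surj (x u : R) : 0 < x < PI / 2 -> 0 < u < t * tan x ->
  exists y, 0 < y /\ bU x y = u.
Proof.
intros hx [u0 hu]. assert (hT := tan_pos _ hx).
(* [r] is the value of [sinh y ^ 2] obtained by solving [bUE]. *)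
set (r := (t * tan x / u - 1) / (1 + tan x ^ 2)).
assert (hq : 1 < t * tan x / u).
{ apply (Rmult_lt_reg_r u); [lra|]. unfold Rdiv. rewrite Rmult_assoc, Rinv_l; lra. }
assert (r0 : 0 < r). { apply Rdiv_lt_0_compat; [lra|nra]. }
exists (arcsinh (sqrt r)).
assert (y0 : 0 < arcsinh (sqrt r)).
{ rewrite <- arcsinh_0. apply arcsinh_lt. apply sqrt_lt_R0, r0. }
split; [exact y0|]. rewrite bUE by auto. rewrite sinh_arcsinh, pow2_sqrt by lra.
unfold r. field. split; [|split]; nra.
Qed.

Lemma bV_bU (x y : R) : 0 < x < PI / 2 -> 0 < y -> bV x (bU x y) = bW x y.
Proof.
intros hx y0. assert (hT := tan_pos _ hx). assert (hc := cos_pos _ hx).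
assert (hs := sinh_pos _ y0). assert (hd := bden_pos x y y0).
assert (h2y : 0 < sinh (2 * y)) by (apply sinh_pos; lra).
assert (hW : 0 < bW x y). { unfold bW. apply Rdiv_lt_0_compat; [nra|exact hd]. }
unfold bV. replace ((t * tan x - bU x y) * (t + bU x y * tan x) / tan x) with (Rsqr (bW x y)).
{ apply sqrt_Rsqr. lra. }
rewrite Rsqr_pow2. unfold bW. 
replace ((t * sinh (2 * y) / bden x y) ^ 2) with (t ^ 2 * sinh (2 * y) ^ 2 / bden x y ^ 2)
 by (field; lra).
replace (sinh (2 * y) ^ 2) with (cosh (2 * y) ^ 2 - 1) by (rewrite cosh_sqr; ring).
unfold bU, bden in *. rewrite cosh_2a, sin_2_tan, cos_2_tan in * by lra.
field. assert (0 < 1 + tan x ^ 2) by nra. repeat split; try nra.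
Qed.

(** The right side is [|t / cos z ^ 2| ^ 2], the squared modulus of the derivative of [t tan z]: the
    two one-variable substitutions together have the Jacobian of a holomorphic map, which is the
    factor by which quadratic differentials transform. *)
Lemma b_jacobian (x y : R) : 0 < x < PI / 2 -> 0 < y ->
  bdV x (bU x y) * - bdU x y = (2 * t / bden x y) ^ 2.
Proof.
intros hx y0. assert (hT := tan_pos _ hx). assert (hc := cos_pos _ hx).
assert (hd := bden_pos x y y0).
assert (h2y : 0 < sinh (2 * y)) by (apply sinh_pos; lra).
unfold bdV. rewrite bV_bU by auto. unfold bW, bdU, bU.
rewrite sin_2_tan by lra. field. repeat split; try nra.
Qed.

Lemma cosh_continuity_2d (x y : R) : continuity_2d_pt (fun _ v => cosh (2 * v)) x y.
Proof.
apply (continuity_1d_2d_pt_comp (fun v => cosh (2 * v)) (fun _ v => v)).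
- apply continuity_pt_filterlim, (ex_derive_continuous (fun v => cosh (2 * v))).
  unfold cosh. auto_derive. auto.
- apply continuity_2d_pt_id2.
Qed.

Lemma bden_continuous (x y : R) : continuity_2d_pt bden x y.
Proof.
apply continuity_2d_pt_plus; [|apply cosh_continuity_2d].
apply (continuity_1d_2d_pt_comp (fun v => cos (2 * v)) (fun v _ => v)).
- apply continuity_pt_filterlim, (ex_derive_continuous (fun v => cos (2 * v))).
  auto_derive. auto.
- apply continuity_2d_pt_id1.
Qed.

Lemma bU_continuous (x y : R) : 0 < y -> continuity_2d_pt bU x y.
Proof.
intros y0. apply continuity_2d_div; [apply Rgt_not_eq, bden_pos, y0| |apply bden_continuous].
apply continuity_2d_pt_mult; [apply continuity_2d_pt_const|].
apply (continuity_1d_2d_pt_comp (fun v => sin (2 * v)) (fun v _ => v)).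
- apply continuity_pt_filterlim, (ex_derive_continuous (fun v => sin (2 * v))).
  auto_derive. auto.
- apply continuity_2d_pt_id1.
Qed.

Lemma bW_continuous (x y : R) : 0 < y -> continuity_2d_pt bW x y.
Proof.
intros y0. apply continuity_2d_div; [apply Rgt_not_eq, bden_pos, y0| |apply bden_continuous].
apply continuity_2d_pt_mult; [apply continuity_2d_pt_const|].
apply (continuity_1d_2d_pt_comp (fun v => sinh (2 * v)) (fun _ v => v)).
- apply continuity_pt_filterlim, (ex_derive_continuous (fun v => sinh (2 * v))).
  unfold sinh. auto_derive. auto.
- apply continuity_2d_pt_id2.
Qed.

Lemma bdU_continuity (x y : R) : 0 < y -> continuity_pt (bdU x) y.
Proof.
intros y0. apply continuity_pt_filterlim, (ex_derive_continuous (bdU x)).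
assert (h := bden_pos x y y0). unfold bdU, bden, cosh, sinh in *. auto_derive.
apply Rgt_not_eq. simpl. nra.
Qed.

Lemma bdV_continuity (x u : R) : bregion x u -> continuity_pt (fun x => bdV x u) x.
Proof.
intros h. assert (c := bdV_continuous _ _ h). intros eps e0.
destruct (c (mkposreal _ e0)) as [d hd]. exists d. split; [apply cond_pos|].
intros z [_ hz]. apply hd; [exact hz|]. rewrite Rminus_diag, Rabs_R0. apply cond_pos.
Qed.

End bipolar.

(** * The mass comparison for the tangent *)

Module TanMass.
Import all_boot all_order all_algebra all_classical all_reals all_analysis measurable_realfun.
Import Rstruct Rstruct_topology PlanarMeasure.
Set Implicit Arguments. Unset Strict Implicit. Unset Printing Implicit Defensive.
Import Order.TTheory GRing.Theory Num.Theory numFieldNormedType.Exports.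
Local Open Scope classical_set_scope.
Local Open Scope ring_scope.

Section bridge.
Local Notation R := Rdefinitions.R.
Let RR : realType := R.

Lemma is_derive_of_Reals (f : R -> R) (x l : R) :
  derivable_pt_lim f x l -> derive.is_derive (x : RR) (1 : RR) (f : RR -> RR) l.
Proof.
move=> fl.
have cfl : h^-1 *: ((f : RR -> RR) (h *: (1 : RR) + x) - f x) @[h --> (0 : RR)^'] --> (l : RR).
  apply/cvgrPdist_lt => e /RltP e0; have [[d /= /RltP d0] df] := fl e e0.
  have near_d : \forall h \near (0 : RR)^', `|h| < (d : RR) by exact: dnbhs0_lt.
  have near_0 : \forall h \near (0 : RR)^', h != 0 by exact: nbhs_dnbhs_neq.
  move: near_d near_0; apply: filterS2 => h hd h0.
  have /RltP := df h (elimN eqP h0) (elimT RltP hd); rewrite RabsE.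
  have -> : ((f (x + h) - f x) / h - l)%coqR =
      h^-1 *: ((f : RR -> RR) (h *: (1 : RR) + x) - f x) - l.
    rewrite /GRing.scale/= mulr1 RminusE RdivE RminusE mulrC RplusE.
    by rewrite [x + h]addrC.
  by rewrite distrC.
split; first by apply/cvg_ex; exists l.
exact/cvg_lim.
Qed.

Lemma continuous_of_Reals (f : R -> R) (x : RR) :
  continuity_pt f x -> {for x, continuous (f : RR -> RR)}.
Proof. by move=> /continuity_pt_cvg. Qed.

Lemma box_continuous_of_Reals (A : set (RR * RR)) (f : RR -> RR -> RR) :
  (forall x y, A (x, y) -> continuity_2d_pt f x y) -> box_continuous A f.
Proof.
move=> cf [x y] /cf cxy e /RltP e0; have [d df] := cxy (mkposreal e e0).
exists (pos d); first exact/RltP/cond_pos.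
by move=> [u v] /= /RltP ux /RltP vy; apply/RltP; exact: df.
Qed.

Lemma box_open_of_Reals (A : set (RR * RR)) :
  (forall x y, A (x, y) -> locally_2d (fun u v => A (u, v)) x y) -> box_open A.
Proof.
move=> oA [x y] /oA [d dA]; exists (pos d); first exact/RltP/cond_pos.
by move=> [u v] /= /RltP ux /RltP vy; exact: dA.
Qed.
End bridge.

Section tan_mass.
Local Notation R := Rdefinitions.R.
Let RR : realType := R.

Definition inv_weight (s : R) : R := (/ (sqrt (Rabs s) * (1 + Rabs s)))%coqR.

Lemma weight_of_Reals (s : RR) : weight s = inv_weight s.
Proof. by rewrite /weight /inv_weight RsqrtE RinvE RmultE RplusE RabsE. Qed.

(** Two consecutive tiles of width [PI / 2] folded together. If [H] is even in its first variable,
    these are the values at [x + k PI] and [x - (k + 1) PI], so the pairs run over all translates by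
    multiples of [PI]. *)
Definition fold_pair (H : R -> R -> R) (x y : R) (k : nat) : R :=
  (H (INR k * PI + x) y + H (INR (S k) * PI - x) y)%coqR.

Lemma sum_fold_term (H : RR -> RR -> RR) (x y : RR) (n : nat) :
  \sum_(j < n.+1.*2) fold_term (PI / 2 : RR) H j x y = sum_f_R0 (fold_pair H x y) n.
Proof.
have term k : fold_term (PI / 2 : RR) H k.*2 x y + fold_term (PI / 2 : RR) H k.*2.+1 x y =
    fold_pair H x y k.
  have e2 j : j.*2%:R * (PI / 2) = j%:R * PI :> RR.
    by rewrite -muln2 natrM mulrA mulrAC mulfK// pnatr_eq0.
  rewrite /fold_term /= odd_double /fold_pair !RealsE -doubleS e2.
  by rewrite /= e2.
elim: n => [|n IHn]; first by rewrite 2!big_ord_recr big_ord0 /= add0r -(term 0%N).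
by rewrite doubleS 2!big_ord_recr /= IHn -addrA RplusE -(term n.+1).
Qed.

(* The first summand on the left is the pullback of [H] under the bijection [t tan] from the
   strip to the quadrant and the series on the right folds [H] onto the strip, so both have
   the same finite mass and the excess [rho] has mass zero. *)
Lemma tan_mass_rigidity (t : R) (H rho : R -> R -> R) (n : nat) (K a b : nat -> R) :
  (0 < t)%coqR ->
  (forall x y, 0 < x -> 0 < y -> 0 <= H x y)%coqR ->
  (forall x y, (0 < x)%coqR -> (0 < y)%coqR -> continuity_2d_pt H x y) ->
  (forall i, 0 <= K i)%coqR ->
  (forall x y, 0 < x -> 0 < y -> (forall i, x <> a i /\ y <> b i) ->
    H x y <= sum_f_R0 (fun i => K i * (inv_weight (x - a i) * inv_weight (y - b i))) n)%coqR ->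
  (forall x y, 0 < x < PI / 2 -> 0 < y -> 0 <= rho x y)%coqR ->
  (forall x y, (0 < x < PI / 2)%coqR -> (0 < y)%coqR -> continuity_2d_pt rho x y) ->
  (forall x y, 0 < x < PI / 2 -> 0 < y -> forall e, 0 < e -> exists N,
    H (bW t x y) (bU t x y) * (2 * t / bden x y) ^ 2 + rho x y <=
    sum_f_R0 (fold_pair H x y) N + e)%coqR ->
  forall x y, (0 < x < PI / 2)%coqR -> (0 < y)%coqR -> rho x y = 0%coqR.
Proof.
move=> t0 H0 cH K0 HK r0 cr HL x y hx hy.
pose h : RR := PI / 2.
have hE : h = (PI / 2)%coqR by rewrite RdivE.
have stripP u v : half_strip h (u, v) -> (0 < u < PI / 2)%coqR /\ (0 < v)%coqR.
  move=> [/= /andP[/RltP u0 /RltP uh] /RltP v0].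
  by rewrite -hE; split => //; split.
have quadP u v : quadrant ((u, v) : RR * RR) -> (0 < u)%coqR /\ (0 < v)%coqR.
  by move=> [/= /RltP u0 /RltP v0].
pose L (u v : RR) : RR := (H (bW t u v) (bU t u v) * (2 * t / bden u v) ^ 2)%coqR.
have H0' (p : RR * RR) : quadrant p -> 0 <= H p.1 p.2.
  by case: p => u v /quadP[u0 v0]; apply/RleP; exact: H0.
have cH' : @box_continuous RR quadrant H.
  by apply: box_continuous_of_Reals => u v /quadP[u0 v0]; exact: cH.
have cL2 u v : (0 < u < PI / 2)%coqR -> (0 < v)%coqR -> continuity_2d_pt L u v.
  move=> hu v0.
  apply: continuity_2d_pt_mult.
    apply: continuity_2d_pt_comp2.
    - by apply: cH; [exact: bW_pos|case: (bU_bound _ t0 _ _ hu v0)].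
    - exact: bW_continuous.
    - exact: bU_continuous.
  apply: continuity_2d_pow2; apply: continuity_2d_div.
  - by apply: Rgt_not_eq; exact: bden_pos.
  - exact: continuity_2d_pt_const.
  - exact: bden_continuous.
have cL : @box_continuous RR (half_strip h) L.
  by apply: box_continuous_of_Reals => u v /stripP[hu v0]; exact: cL2.
have L0 (p : RR * RR) : half_strip h p -> 0 <= L p.1 p.2.
  case: p => u v /stripP[hu v0]; apply/RleP; apply: Rmult_le_pos; last exact: pow2_ge_0.
  by apply: H0; [exact: bW_pos|case: (bU_bound _ t0 _ _ hu v0)].
have r0' (p : RR * RR) : half_strip h p -> 0 <= rho p.1 p.2.
  by case: p => u v /stripP[hu v0]; apply/RleP; exact: r0.
have cr' : @box_continuous RR (half_strip h) rho.
  by apply: box_continuous_of_Reals => u v /stripP[hu v0]; exact: cr.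
(* [M] is the mass of [H] on the quadrant; what remains is its finiteness, the substitution by
   [t tan], and the folding. *)
apply: (@excess_eq0 RR h L rho _ cL L0 cr' r0' _ _ _ (x, y)).
4: by split; [apply/andP; split; apply/RltP; rewrite ?hE; case: hx|apply/RltP].
- apply: (@quadrant_integral_fin RR H n.+1 K a b H0' cH').
    by move=> i; apply/RleP.
  move=> u v /RltP u0 /RltP v0 huv; apply/RleP.
  have := HK u v u0 v0 huv; rewrite sum_f_R0E big_mkord => /RleP HK'; apply/RleP.
  apply: le_trans HK' _; rewrite le_eqVlt; apply/orP; left; apply/eqP.
  by apply: eq_bigr => i _; rewrite !weight_of_Reals.
(* The boundary curve of [bregion], solved for the abscissa and for the ordinate. *)
- pose lo (u : RR) : RR := Ratan.atan (u / t)%coqR.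
  pose top (u : RR) : RR := (t * Rtrigo1.tan u)%coqR.
  have regionP u v : ([set p : RR * RR | 0 < p.2 /\ lo p.2 < p.1 < h] (u, v)) <->
      bregion t u v.
    rewrite /bregion /= hE; split.
      move=> [/RltP v0 /andP[/RltP l1 /RltP l2]]; split; [exact: v0|split; [exact: l1|exact: l2]].
    by move=> [v0 [l1 l2]]; split; [apply/RltP; exact: v0|apply/andP; split; apply/RltP; [exact: l1|exact: l2]].
  apply: (@planar_substitution_le RR h H L lo top (bU t) (bdU t) (bV t) (bdV t)).
  + exact: H0'.
  + exact: cH'.
  + move=> u v; rewrite regionP bregionE// hE; split.
      by move=> [[? ?] [? ?]]; split; apply/andP; split; exact/RltP.
    by move=> [/andP[/RltP ? /RltP ?] /andP[/RltP ? /RltP ?]].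
  + apply: box_open_of_Reals => u v /regionP uv.
    have := bregion_open _ _ _ uv; apply: locally_2d_impl.
    by apply: locally_2d_forall => ? ?; exact: (iffRL (regionP _ _)).
  + apply: box_continuous_of_Reals => u v /regionP uv.
    apply: continuity_2d_pt_mult; last exact: bdV_continuous.
    apply: continuity_2d_pt_comp2.
    * by apply: cH; [exact: bV_pos|case: uv].
    * exact: bV_continuous.
    * exact: continuity_2d_pt_id2.
  + move=> u v /regionP uv; split.
    * apply: is_derive_of_Reals; apply/is_derive_Reals; exact: bV_derive.
    * by apply: continuous_of_Reals; exact: bdV_continuity.
    * by apply/RltP; exact: bdV_pos.
    * by apply/RltP; exact: bV_pos.
  + move=> u v /RltP u0 /RltP v0; have [z [uz <-]] := bV_surj _ t0 _ _ u0 v0.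
    by exists z => //; apply/regionP.
  + move=> u v /stripP[hu v0]; split.
    * by apply: is_derive_of_Reals; apply/is_derive_Reals; exact: bU_derive.
    * by apply: continuous_of_Reals; exact: bdU_continuity.
    * by apply/RltP; exact: bdU_neg.
    * by have [? ?] := bU_bound _ t0 _ _ hu v0; apply/andP; split; exact/RltP.
  + move=> u v /andP[/RltP u0 /RltP uh] /andP[/RltP v0 /RltP vt].
    rewrite hE in uh; have [z [z0 <-]] := bU_surj _ _ _ (conj u0 uh) (conj v0 vt).
    by exists z => //; exact/RltP.
  + move=> u v /stripP[hu v0].
    rewrite /L -bV_bU// -b_jacobian// !RealsE mulrA; congr (_ * _).
  + exact: cL.
- apply: (@folding_le RR h H _ H0' cH' (fun u v => L u v + rho u v)) => //.
  + by rewrite hE; apply/RltP; exact: PI2_RGT_0.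
  + apply: box_continuous_of_Reals => u v /stripP[hu v0].
    by apply: continuity_2d_pt_plus; [exact: cL2|exact: cr].
  + by move=> p hp; rewrite addr_ge0 ?L0 ?r0'.
  + move=> [u v] /stripP[hu v0] e /RltP e0; have [N HN] := HL u v hu v0 e e0.
    exists N.+1.*2; apply/RleP; rewrite sum_fold_term; exact: HN.
Qed.

End tan_mass.

End TanMass.
Import TanMass.

(** * Partial fractions of the cotangent *)

Lemma C_ext (z w : C) : Re z = Re w -> Im z = Im w -> z = w.
Proof. destruct z, w; simpl; congruence. Qed.

Definition Csin (z : C) : C := (sin (Re z) * cosh (Im z), cos (Re z) * sinh (Im z)).
Definition Ccos (z : C) : C := (cos (Re z) * cosh (Im z), - (sin (Re z) * sinh (Im z))).

Lemma cosh_plus (x y : R) : cosh (x + y) = cosh x * cosh y + sinh x * sinh y.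
Proof. unfold cosh, sinh. rewrite Ropp_plus_distr, !exp_plus. field. Qed.

Lemma sinh_plus (x y : R) : sinh (x + y) = sinh x * cosh y + cosh x * sinh y.
Proof. unfold cosh, sinh. rewrite Ropp_plus_distr, !exp_plus. field. Qed.

Lemma cosh_opp (x : R) : cosh (- x) = cosh x.
Proof. unfold cosh. rewrite Ropp_involutive. field. Qed.

Lemma sinh_opp (x : R) : sinh (- x) = - sinh x.
Proof. unfold sinh. rewrite Ropp_involutive. field. Qed.

Lemma Csin_plus (z w : C) : Csin (z + w)%C = (Csin z * Ccos w + Ccos z * Csin w)%C.
Proof.
destruct z as [x y], w as [u v].
apply C_ext; unfold Csin, Ccos; simpl;
  rewrite ?sin_plus, ?cos_plus, ?cosh_plus, ?sinh_plus; ring.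
Qed.

Lemma Ccos_plus (z w : C) : Ccos (z + w)%C = (Ccos z * Ccos w - Csin z * Csin w)%C.
Proof.
destruct z as [x y], w as [u v].
apply C_ext; unfold Csin, Ccos; simpl;
  rewrite ?sin_plus, ?cos_plus, ?cosh_plus, ?sinh_plus; ring.
Qed.

Lemma Csin_opp (z : C) : Csin (- z)%C = (- Csin z)%C.
Proof.
destruct z as [x y]. apply C_ext; unfold Csin; simpl;
  rewrite ?sin_neg, ?cos_neg, ?cosh_opp, ?sinh_opp; ring.
Qed.

Lemma Ccos_opp (z : C) : Ccos (- z)%C = Ccos z.
Proof.
destruct z as [x y]. apply C_ext; unfold Ccos; simpl;
  rewrite ?sin_neg, ?cos_neg, ?cosh_opp, ?sinh_opp; ring.
Qed.

Lemma Csin_minus (z w : C) : Csin (z - w)%C = (Csin z * Ccos w - Ccos z * Csin w)%C.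
Proof. unfold Cminus at 1. rewrite Csin_plus, Csin_opp, Ccos_opp. ring. Qed.

Lemma Csin2_Ccos2 (z : C) : (Csin z * Csin z + Ccos z * Ccos z)%C = RtoC 1.
Proof.
destruct z as [x y]. assert (h := cosh_sqr y). assert (h' := sin2_cos2 x). unfold Rsqr in h'.
apply C_ext; unfold Csin, Ccos; simpl; [|ring].
replace (sin x * cosh y * (sin x * cosh y) - cos x * sinh y * (cos x * sinh y) +
  (cos x * cosh y * (cos x * cosh y) - - (sin x * sinh y) * - (sin x * sinh y))) with
  ((sin x * sin x + cos x * cos x) * (cosh y ^ 2 - sinh y ^ 2)) by ring.
rewrite h, h'. ring.
Qed.

Lemma Ccos_half_pi : Ccos (RtoC (PI / 2)) = RtoC 0.
Proof.
apply C_ext; unfold Ccos; simpl; rewrite ?cos_PI2, ?sin_PI2, ?sinh_0; ring.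
Qed.

Lemma Csin_half_pi : Csin (RtoC (PI / 2)) = RtoC 1.
Proof.
apply C_ext; unfold Csin; simpl; rewrite ?cos_PI2, ?sin_PI2, ?sinh_0, ?cosh_0; ring.
Qed.

Lemma Csin_shift (z : C) : Csin (z + RtoC (PI / 2))%C = Ccos z.
Proof. rewrite Csin_plus, Ccos_half_pi, Csin_half_pi. ring. Qed.

Lemma Csin_pi (z : C) : Csin (z + RtoC PI)%C = (- Csin z)%C.
Proof.
destruct z as [x y]. apply C_ext; unfold Csin; simpl;
 rewrite Rplus_0_r, ?neg_sin, ?neg_cos; ring.
Qed.

Lemma Cmod_Csin (z : C) : Cmod (Csin z) ^ 2 = sin (Re z) ^ 2 + sinh (Im z) ^ 2.
Proof.
destruct z as [x y]. unfold Cmod. rewrite pow2_sqrt by (simpl; nra). unfold Csin; simpl fst; simpl snd.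
simpl Re; simpl Im. assert (h := cosh_sqr y). assert (h' := sin2_cos2 x). unfold Rsqr in h'.
rewrite !Rpow_mult_distr, h. replace (cos x ^ 2) with (1 - sin x ^ 2) by (simpl; lra). ring.
Qed.

Lemma mvt_sin (x : R) : 0 <= x <= PI -> x * cos x <= sin x.
Proof.
intros hx.
destruct (MVT_gen sin 0 x cos) as [c [hc hs]].
- intros u _. apply is_derive_sin.
- intros u _. apply continuity_sin.
- rewrite Rmin_left, Rmax_right in hc by lra. rewrite sin_0 in hs.
  assert (cos x <= cos c) by (apply cos_decr_1; lra). nra.
Qed.

(** From [sin x = 2 sin (x/2) cos (x/2)] and [sin u >= u cos u] at [u = x/2], which is at most
    [3 PI / 8]. The range has to reach [3 PI / 4]: in the scaled window the shifts contribute up to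
    [PI / 2] and the offset up to [PI / 4]. *)
Lemma sin_lower (x : R) : 0 <= x <= 3 * PI / 4 -> cos (3 * PI / 8) ^ 2 * x <= sin x.
Proof.
intros hx. assert (hpi := PI_RGT_0).
replace x with (2 * (x / 2)) at 2 by field. rewrite sin_2a.
assert (h1 : x / 2 * cos (x / 2) <= sin (x / 2)) by (apply mvt_sin; lra).
assert (h2 : cos (3 * PI / 8) <= cos (x / 2)) by (apply cos_decr_1; lra).
assert (h3 : 0 < cos (3 * PI / 8)) by (apply cos_gt_0; lra).
assert (h4 : 0 <= x / 2 * cos (x / 2)) by (apply Rmult_le_pos; lra).
assert (h5 : cos (3 * PI / 8) ^ 2 <= cos (x / 2) ^ 2) by nra.
assert (x * cos (3 * PI / 8) ^ 2 <= x * cos (x / 2) ^ 2) by (apply Rmult_le_compat_l; lra).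
assert (cos (x / 2) * (x / 2 * cos (x / 2)) <= cos (x / 2) * sin (x / 2)) by (apply Rmult_le_compat_l; lra).
nra.
Qed.

Lemma sinh_lower (y : R) : y ^ 2 <= sinh y ^ 2.
Proof.
assert (k : forall y, 0 <= y -> y <= sinh y).
{ intros u hu. destruct (MVT_gen sinh 0 u cosh) as [c [hc hs]].
  - intros v _. unfold sinh, cosh. auto_derive; [auto|field].
  - intros v _. apply derivable_continuous_pt, derivable_pt_sinh.
  - rewrite sinh_0 in hs. assert (1 <= cosh c).
    { assert (h := cosh_sqr c). assert (h' := cosh_pos c). nra. }
    nra. }
destruct (Rle_dec 0 y) as [h|h].
- apply pow_incr. auto.
- replace (y ^ 2) with ((- y) ^ 2) by ring. replace (sinh y ^ 2) with (sinh (- y) ^ 2).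
  + apply pow_incr. split; [lra|]. apply k. lra.
  + rewrite sinh_opp. ring.
Qed.

Definition ksin : R := cos (3 * PI / 8) ^ 2.

Lemma ksin_pos : 0 < ksin.
Proof. assert (hpi := PI_RGT_0). apply pow_lt, cos_gt_0; lra. Qed.

(** As [|sin z|^2] is [sin (Re z)^2 + sinh (Im z)^2], the two coordinates are bounded separately. *)
Lemma Csin_lower (z : C) : Rabs (Re z) <= 3 * PI / 4 -> ksin * Cmod z <= Cmod (Csin z).
Proof.
intros hz. assert (k0 := ksin_pos).
assert (k1 : ksin <= 1).
{ unfold ksin. assert (h := COS_bound (3 * PI / 8)). assert (hpi := PI_RGT_0).
  assert (h3 : 0 < cos (3 * PI / 8)) by (apply cos_gt_0; lra). nra. }
assert (hs : (ksin * Re z) ^ 2 <= sin (Re z) ^ 2).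
{ destruct (Rle_dec 0 (Re z)) as [h|h].
  - rewrite Rabs_pos_eq in hz by lra. apply pow_incr. split; [nra|]. apply sin_lower. lra.
  - rewrite Rabs_left in hz by lra.
    replace (sin (Re z) ^ 2) with (sin (- Re z) ^ 2) by (rewrite sin_neg; ring).
    replace ((ksin * Re z) ^ 2) with ((ksin * - Re z) ^ 2) by ring.
    apply pow_incr. split; [nra|]. apply sin_lower. lra. }
assert (hh := sinh_lower (Im z)).
apply Rsqr_incr_0; [|apply Rmult_le_pos; [lra|apply Cmod_ge_0]|apply Cmod_ge_0].
rewrite !Rsqr_pow2, Cmod_Csin, Rpow_mult_distr.
replace (Cmod z ^ 2) with (Re z ^ 2 + Im z ^ 2).
2: { destruct z; unfold Cmod; simpl fst; simpl snd; rewrite pow2_sqrt; simpl; nra. }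
assert (ksin ^ 2 * Im z ^ 2 <= Im z ^ 2). { assert (ksin ^ 2 <= 1) by nra. assert (0 <= Im z ^ 2) by nra. nra. }
nra.
Qed.

(** * Finite sums and the doubling formula of the cotangent *)

Fixpoint csum (f : nat -> C) (n : nat) : C :=
  match n with O => RtoC 0 | S n => (csum f n + f n)%C end.

Fixpoint rsum (f : nat -> R) (n : nat) : R :=
  match n with O => 0 | S n => rsum f n + f n end.

Lemma csum_ext (f g : nat -> C) (n : nat) :
  (forall k, (k < n)%nat -> f k = g k) -> csum f n = csum g n.
Proof. induction n as [|n IH]; intros h; simpl; [auto|]. rewrite IH, h; auto. Qed.

Lemma csum_plus (f g : nat -> C) (n : nat) :
  csum (fun k => (f k + g k)%C) n = (csum f n + csum g n)%C.
Proof. induction n as [|n IH]; simpl; [ring|rewrite IH; ring]. Qed.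

Lemma csum_scal (c : C) (f : nat -> C) (n : nat) :
  csum (fun k => (c * f k)%C) n = (c * csum f n)%C.
Proof. induction n as [|n IH]; simpl; [ring|rewrite IH; ring]. Qed.

Lemma csum_head (f : nat -> C) (n : nat) : csum f (S n) = (f O + csum (fun k => f (S k)) n)%C.
Proof.
induction n as [|n IH]; [simpl; ring|]. change (csum f (S (S n))) with (csum f (S n) + f (S n))%C.
rewrite IH. simpl. ring.
Qed.

Lemma csum_rev (f : nat -> C) (n : nat) : csum (fun k => f (n - 1 - k)%nat) n = csum f n.
Proof.
revert f. induction n as [|n IH]; intros f; [reflexivity|].
rewrite csum_head. change (csum f (S n)) with (csum f n + f n)%C.
rewrite <- IH. replace (S n - 1 - 0)%nat with n by lia. rewrite Cplus_comm. f_equal.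
apply csum_ext. intros k hk. f_equal. lia.
Qed.

Lemma csum_split (f : nat -> C) (n m : nat) :
  csum f (n + m) = (csum f n + csum (fun k => f (n + k)%nat) m)%C.
Proof.
induction m as [|m IH]; simpl; [rewrite Nat.add_0_r; ring|].
rewrite Nat.add_succ_r. simpl. rewrite IH. ring.
Qed.

Lemma Cmod_csum (f : nat -> C) (n : nat) : Cmod (csum f n) <= rsum (fun k => Cmod (f k)) n.
Proof.
induction n as [|n IH]; simpl; [rewrite Cmod_0; lra|].
eapply Rle_trans; [apply Cmod_triangle|]. lra.
Qed.

Lemma rsum_le (f g : nat -> R) (n : nat) :
  (forall k, (k < n)%nat -> f k <= g k) -> rsum f n <= rsum g n.
Proof.
induction n as [|n IH]; intros h; simpl; [lra|]. apply Rplus_le_compat; auto.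
Qed.

Lemma rsum_head (f : nat -> R) (n : nat) : rsum f (S n) = f O + rsum (fun k => f (S k)) n.
Proof. induction n as [|n IH]; cbn [rsum] in *; [ring|rewrite IH; ring]. Qed.

(* Sum of [f] over the integers of the window [-n, n). *)
Definition zsum (f : Z -> C) (n : nat) : C :=
  csum (fun k => (f (Z.of_nat k) + f (- Z.of_nat k - 1)%Z)%C) n.

(** The outer half of the window is listed backwards, so that [k] meets [k - 2 n] and [- k - 1]
    meets [2 n - k - 1]: each index is paired with a translate by [2 n], as the doubling formula
    requires. *)
Lemma zsum_double (f : Z -> C) (n : nat) :
  zsum f (2 * n) = (zsum f n + csum (fun k => f (Z.of_nat k - 2 * Z.of_nat n)%Z +
    f (2 * Z.of_nat n - Z.of_nat k - 1)%Z)%C n)%C.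
Proof.
unfold zsum. replace (2 * n)%nat with (n + n)%nat by lia. rewrite csum_split. f_equal.
rewrite <- csum_rev. apply csum_ext. intros k hk. rewrite Cplus_comm. f_equal; f_equal; lia.
Qed.

(* [(cot (a / M) - cot (b / M)) / M]. *)
Definition dcot (M : R) (a b : C) : C :=
  (RtoC M * Csin ((b - a) / RtoC M) / (RtoC M * Csin (a / RtoC M) * (RtoC M * Csin (b / RtoC M))))%C.

Definition zshift (a : C) (k : Z) : C := (a + RtoC (IZR k * PI))%C.

Lemma RtoC_neq0 (x : R) : x <> 0 -> RtoC x <> RtoC 0.
Proof. intros h e. apply h. now apply RtoC_inj. Qed.

Lemma Csin_double (z : C) : Csin (z + z)%C = (RtoC 2 * (Csin z * Ccos z))%C.
Proof. rewrite Csin_plus. ring. Qed.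

(* [cot a - cot b] split into the two preimages of the angle doubling. *)
Lemma dcot_double (M : R) (a b : C) : M <> 0 ->
  Csin (a / RtoC M) <> RtoC 0 -> Csin (b / RtoC M) <> RtoC 0 ->
  dcot M a b = (dcot (2 * M) a b +
    dcot (2 * M) (a + RtoC (M * PI)) (b + RtoC (M * PI)))%C.
Proof.
intros hM ha hb. assert (hMC := RtoC_neq0 _ hM).
assert (h2 : RtoC 2 <> RtoC 0) by (apply RtoC_neq0; lra).
unfold dcot. rewrite !RtoC_mult.
assert (half : forall z, (z / RtoC M = z / (RtoC 2 * RtoC M) + z / (RtoC 2 * RtoC M))%C).
{ intros z. field. repeat split; auto. }
replace ((b + RtoC M * RtoC PI - (a + RtoC M * RtoC PI)) / (RtoC 2 * RtoC M))%C with
  ((b - a) / (RtoC 2 * RtoC M))%C by (field; repeat split; auto).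
assert (sh : forall z, ((z + RtoC M * RtoC PI) / (RtoC 2 * RtoC M) =
   z / (RtoC 2 * RtoC M) + RtoC (PI / 2))%C).
{ intros z. rewrite RtoC_div by lra. field. repeat split; auto. }
rewrite !sh, !Csin_shift.
rewrite (half a) in ha |- *. rewrite (half b) in hb |- *. rewrite (half (b - a)%C).
rewrite Csin_double in ha, hb. rewrite !Csin_double.
set (al := (a / (RtoC 2 * RtoC M))%C) in *. set (be := (b / (RtoC 2 * RtoC M))%C) in *.
assert (hde : ((b - a) / (RtoC 2 * RtoC M) = be - al)%C).
{ unfold al, be. field. repeat split; auto. }
rewrite hde.
assert (sa : Csin al <> RtoC 0). { intros e. apply ha. rewrite e. ring. }
assert (ca : Ccos al <> RtoC 0). { intros e. apply ha. rewrite e. ring. }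
assert (sb : Csin be <> RtoC 0). { intros e. apply hb. rewrite e. ring. }
assert (cb : Ccos be <> RtoC 0). { intros e. apply hb. rewrite e. ring. }
assert (hc : Ccos (be - al)%C = (Ccos al * Ccos be + Csin al * Csin be)%C).
{ unfold Cminus. rewrite Ccos_plus, Ccos_opp, Csin_opp. ring. }
rewrite hc. field. repeat split; auto.
Qed.

Lemma dcot_periodic (M : R) (a b : C) : M <> 0 ->
  dcot M (a + RtoC (M * PI)) (b + RtoC (M * PI)) = dcot M a b.
Proof.
intros hM. assert (hMC := RtoC_neq0 _ hM). unfold dcot. rewrite !RtoC_mult.
replace ((b + RtoC M * RtoC PI - (a + RtoC M * RtoC PI)) / RtoC M)%C with
  ((b - a) / RtoC M)%C by (field; repeat split; auto).
assert (sh : forall z, ((z + RtoC M * RtoC PI) / RtoC M = z / RtoC M + RtoC PI)%C).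
{ intros z. field. auto. }
rewrite !sh, !Csin_pi. f_equal. ring.
Qed.

(** * Passage to the limit in the cotangent series *)

Definition clim (u : nat -> C) (l : C) : Prop :=
  is_lim_seq (fun n => Re (u n)) (Re l) /\ is_lim_seq (fun n => Im (u n)) (Im l).

Lemma clim_const (c : C) : clim (fun _ => c) c.
Proof. split; apply is_lim_seq_const. Qed.

Lemma clim_plus (u v : nat -> C) (a b : C) : clim u a -> clim v b ->
  clim (fun n => u n + v n)%C (a + b)%C.
Proof. intros [h1 h2] [k1 k2]. split; simpl; now apply is_lim_seq_plus'. Qed.

Lemma clim_mult (u v : nat -> C) (a b : C) : clim u a -> clim v b ->
  clim (fun n => u n * v n)%C (a * b)%C.
Proof.
intros [h1 h2] [k1 k2]. split; simpl.
- apply is_lim_seq_minus'; now apply is_lim_seq_mult'.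
- apply is_lim_seq_plus'; now apply is_lim_seq_mult'.
Qed.

Lemma clim_inv (u : nat -> C) (a : C) : a <> RtoC 0 -> clim u a ->
  clim (fun n => / u n)%C (/ a)%C.
Proof.
intros ha [h1 h2].
assert (d0 : Re a ^ 2 + Im a ^ 2 <> 0).
{ intros e. apply ha. apply C_ext; simpl; nra. }
assert (hd : is_lim_seq (fun n => Re (u n) ^ 2 + Im (u n) ^ 2) (Re a ^ 2 + Im a ^ 2)).
{ apply (is_lim_seq_ext (fun n => Re (u n) * Re (u n) + Im (u n) * Im (u n))); [intros; simpl; ring|].
  replace (Re a ^ 2 + Im a ^ 2) with (Re a * Re a + Im a * Im a) by ring.
  apply is_lim_seq_plus'; now apply is_lim_seq_mult'. }
split; simpl.
- now apply is_lim_seq_div'.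
- apply is_lim_seq_div'; auto. now apply (is_lim_seq_opp _ (Im a)).
Qed.

Lemma clim_ext (u v : nat -> C) (l : C) : (forall n, u n = v n) -> clim u l -> clim v l.
Proof. intros h [h1 h2]. split; eapply is_lim_seq_ext; eauto; intros n; simpl; now rewrite h. Qed.

Lemma clim_csum (u : nat -> nat -> C) (l : nat -> C) (n : nat) :
  (forall k, clim (fun m => u m k) (l k)) -> clim (fun m => csum (u m) n) (csum l n).
Proof.
intros h. induction n as [|n IH]; simpl; [apply clim_const|]. now apply clim_plus.
Qed.

Lemma Cmod_le_abs (z : C) : Cmod z <= Rabs (Re z) + Rabs (Im z).
Proof.
destruct z as [x y]. simpl. apply Rsqr_incr_0; [|apply Cmod_ge_0|].
2: { assert (h := Rabs_pos x); assert (h' := Rabs_pos y); lra. }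
unfold Cmod. rewrite Rsqr_sqrt by (apply Rplus_le_le_0_compat; apply pow2_ge_0). simpl fst; simpl snd.
unfold Rsqr. assert (h1 := pow2_abs x). assert (h2 := pow2_abs y).
assert (h := Rabs_pos x); assert (h' := Rabs_pos y).
assert (0 <= Rabs x * Rabs y) by (apply Rmult_le_pos; auto). simpl in *. nra.
Qed.

Lemma clim_Cmod (u : nat -> C) (l : C) : clim u l <->
  forall e, 0 < e -> exists N, forall n, (N <= n)%nat -> Cmod (u n - l)%C < e.
Proof.
split.
- intros [h1 h2] e e0. apply is_lim_seq_spec in h1. apply is_lim_seq_spec in h2.
  assert (e2 : 0 < e / 2) by lra.
  destruct (h1 (mkposreal _ e2)) as [N1 H1]. destruct (h2 (mkposreal _ e2)) as [N2 H2].
  exists (max N1 N2). intros n hn.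
  specialize (H1 n ltac:(lia)). specialize (H2 n ltac:(lia)). simpl in H1, H2.
  eapply Rle_lt_trans; [apply Cmod_le_abs|].
  replace (Re (u n - l)%C) with (Re (u n) - Re l) by (unfold Re; simpl; ring).
  replace (Im (u n - l)%C) with (Im (u n) - Im l) by (unfold Im; simpl; ring). lra.
- intros h. split; apply is_lim_seq_spec; intros e; destruct (h e (cond_pos e)) as [N HN];
    exists N; intros n hn; specialize (HN n hn).
  + eapply Rle_lt_trans; [|exact HN].
    replace (Re (u n) - Re l) with (Re (u n - l)%C) by (unfold Re; simpl; ring).
    eapply Rle_trans; [apply Rmax_l|apply (Rmax_Cmod (u n - l)%C)].
  + eapply Rle_lt_trans; [|exact HN].
    replace (Im (u n) - Im l) with (Im (u n - l)%C) by (unfold Im; simpl; ring).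
    eapply Rle_trans; [apply Rmax_r|apply (Rmax_Cmod (u n - l)%C)].
Qed.

(** Telescoping, from [1 / (r + 1)^2 <= 1 / r - 1 / (r + 1)]. *)
Lemma inv_sqr_tail (n m : nat) : (0 < n)%nat ->
  rsum (fun j => / (INR (n + j) + 1) ^ 2) m <= / INR n - / INR (n + m).
Proof.
intros hn. induction m as [|m IH]; cbn [rsum].
- rewrite Nat.add_0_r. lra.
- assert (h : 0 < INR (n + m)) by (apply lt_0_INR; lia).
  rewrite Nat.add_succ_r, S_INR. set (r := INR (n + m)) in *.
  assert (/ (r + 1) ^ 2 <= / r - / (r + 1)).
  { replace (/ r - / (r + 1)) with (/ (r * (r + 1))) by (field; lra).
    apply Rinv_le_contravar; nra. }
  lra.
Qed.

Lemma rsum_scal (c : R) (f : nat -> R) (n : nat) : rsum (fun k => c * f k) n = c * rsum f n.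
Proof. induction n as [|n IH]; simpl; [ring|rewrite IH; ring]. Qed.

Lemma pow2_ge_S (n : nat) : (n < 2 ^ n)%nat.
Proof. apply Nat.pow_gt_lin_r. lia. Qed.

(** Tannery's theorem, that is, dominated convergence for series: the bound makes all tails
    uniformly small, and each head converges term by term. *)
Lemma tannery (u : nat -> nat -> C) (G : nat -> C) (L : C) (B : R) (m0 : nat) :
  (forall k, clim (fun m => u m k) (G k)) ->
  (forall m k, (m0 <= m)%nat -> (k < 2 ^ m)%nat -> Cmod (u m k) <= B * / (INR k + 1) ^ 2) ->
  (forall m, csum (u m) (2 ^ m) = L) -> clim (csum G) L.
Proof.
intros hG hB hL. apply clim_Cmod. intros e e0.
assert (B0 : 0 <= B).
{ assert (hp := pow2_ge_S m0). assert (h := hB m0 O (Nat.le_refl _) ltac:(lia)).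
  assert (h' := Cmod_ge_0 (u m0 O)). simpl in h. rewrite Rplus_0_l, !Rmult_1_l, Rinv_1, Rmult_1_r in h. lra. }
destruct (INR_unbounded (2 * (B + 1) / e)) as [N0 hN0].
exists (S N0). intros n hn.
assert (e2 : 0 < e / 2) by lra.
destruct (proj1 (clim_Cmod _ _) (clim_csum u G n hG) (e / 2) e2) as [m1 hm1].
(* Large enough for the domination, for the convergence of the first [n] terms, and for [n < 2 ^ m],
   so that these terms form a head of the full sum. *)
set (m := max (max m0 m1) n).
assert (hm := hm1 m ltac:(lia)).
assert (hnm : (n < 2 ^ m)%nat). { assert (h := pow2_ge_S m). lia. }
rewrite <- (hL m). replace (2 ^ m)%nat with (n + (2 ^ m - n))%nat by lia.
rewrite csum_split.
replace (csum G n - (csum (u m) n + csum (fun k => u m (n + k)%nat) (2 ^ m - n)))%C with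
  (- (csum (u m) n - csum G n) + - csum (fun k => u m (n + k)%nat) (2 ^ m - n))%C by ring.
eapply Rle_lt_trans; [apply Cmod_triangle|]. rewrite !Cmod_opp.
assert (htail : Cmod (csum (fun k => u m (n + k)%nat) (2 ^ m - n)) <= B * / INR n).
{ eapply Rle_trans; [apply Cmod_csum|].
  eapply Rle_trans.
  - apply (rsum_le _ (fun j => B * / (INR (n + j) + 1) ^ 2)). intros k hk. apply hB; lia.
  - rewrite rsum_scal. apply Rmult_le_compat_l; [exact B0|].
    eapply Rle_trans; [apply inv_sqr_tail; lia|].
    assert (0 < / INR (n + (2 ^ m - n))) by (apply Rinv_0_lt_compat, lt_0_INR; lia). lra. }
assert (hn' : 2 * (B + 1) / e < INR n).
{ eapply Rlt_trans; [exact hN0|]. apply lt_INR. lia. }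
assert (n0 : 0 < INR n) by (apply lt_0_INR; lia).
assert (B * / INR n < e / 2).
{ apply (Rmult_lt_reg_r (INR n)); [exact n0|]. rewrite Rmult_assoc, Rinv_l by lra.
  apply (Rmult_lt_compat_l (e / 2)) in hn'; [|lra].
  replace (e / 2 * (2 * (B + 1) / e)) with (B + 1) in hn' by (field; lra). lra. }
lra.
Qed.

(** The exponent is [m + 1] because the window [[-2^m, 2^m)] contains [2^(m+1)] integers. *)
Definition pow2 (m : nat) : R := 2 ^ S m.

Lemma pow2_pos (m : nat) : 0 < pow2 m.
Proof. apply pow_lt. lra. Qed.

Lemma IZR_pow2 (m : nat) : IZR (2 * Z.of_nat (2 ^ m)) = pow2 m.
Proof.
rewrite mult_IZR, <- INR_IZR_INZ. unfold pow2. simpl pow. f_equal.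
rewrite pow_INR. reflexivity.
Qed.

Lemma zshift_plus (a : C) (k l : Z) : zshift a (k + l) = (zshift a k + RtoC (IZR l * PI))%C.
Proof. unfold zshift. rewrite plus_IZR, Rmult_plus_distr_r, RtoC_plus. ring. Qed.

Lemma Csin_zshift (a : C) (k : Z) : Csin a <> RtoC 0 -> Csin (zshift a k) <> RtoC 0.
Proof.
assert (up : forall a, Csin a <> RtoC 0 <-> Csin (a + RtoC PI)%C <> RtoC 0).
{ intros z. rewrite Csin_pi. split; intros h e; apply h.
  - replace (Csin z) with (- - Csin z)%C by ring. rewrite e. ring.
  - rewrite e. ring. }
intros h. revert k. apply Z.bi_induction.
- intros x y ->. reflexivity.
- unfold zshift. rewrite Rmult_0_l, Cplus_0_r. exact h.
- intros k. unfold Z.succ. rewrite zshift_plus, Rmult_1_l. apply up.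
Qed.

Lemma Csin_half (a : C) (m : nat) : Csin a <> RtoC 0 -> Csin (a / RtoC (2 ^ m))%C <> RtoC 0.
Proof.
intros h. induction m as [|m IH].
- simpl. replace (a / RtoC 1)%C with a by field. exact h.
- intros e. apply IH. simpl pow. assert (p : 2 ^ m <> 0) by (apply pow_nonzero; lra).
  assert (hp := RtoC_neq0 _ p). assert (h2 : RtoC 2 <> RtoC 0) by (apply RtoC_neq0; lra).
  replace (a / RtoC (2 ^ m))%C with (a / RtoC (2 ^ S m) + a / RtoC (2 ^ S m))%C.
  + rewrite Csin_double, e. ring.
  + simpl pow. rewrite RtoC_mult. field. repeat split; auto.
Qed.

(** Exact finite form of the partial fractions: each use of the doubling formula splits every term
    in two, and the [pow2 m] terms obtained after [m + 1] uses are indexed by a window thanks to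
    periodicity. *)
Lemma zsum_dcot (a b : C) (m : nat) : Csin a <> RtoC 0 -> Csin b <> RtoC 0 ->
  zsum (fun k => dcot (pow2 m) (zshift a k) (zshift b k)) (2 ^ m) = dcot 1 a b.
Proof.
intros ha hb. induction m as [|m IH].
- unfold zsum, pow2. change (2 ^ 0)%nat with 1%nat. cbn [csum].
  change (Z.of_nat 0) with 0%Z. change (- 0 - 1)%Z with (-1)%Z.
  rewrite (dcot_double 1 a b) by
    (try lra; replace (RtoC 1) with (RtoC (2 ^ 0)) by reflexivity; now apply Csin_half).
  rewrite Rmult_1_l. replace (2 * 1) with (2 ^ 1) by ring.
  rewrite <- (dcot_periodic (2 ^ 1) (zshift a (-1)) (zshift b (-1))) by (simpl; lra).
  assert (e0 : forall z, zshift z 0 = z) by (intros z; unfold zshift; rewrite Rmult_0_l; ring).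
  assert (e1 : forall z, (zshift z (-1) + RtoC (2 ^ 1 * PI))%C = (z + RtoC PI)%C).
  { intros z. unfold zshift. rewrite <- Cplus_assoc, <- RtoC_plus. f_equal. f_equal. simpl. ring. }
  rewrite !e0, !e1. ring.
- rewrite <- IH. replace (2 ^ S m)%nat with (2 * 2 ^ m)%nat by reflexivity.
  rewrite zsum_double. unfold zsum. rewrite <- csum_plus. apply csum_ext. intros k _.
  set (n := Z.of_nat (2 ^ m)). assert (hM := pow2_pos m).
  assert (hn : IZR (2 * n) = pow2 m) by apply IZR_pow2.
  assert (h2 : pow2 (S m) = 2 * pow2 m) by reflexivity.
  assert (split : forall j, dcot (pow2 m) (zshift a j) (zshift b j) =
    (dcot (pow2 (S m)) (zshift a j) (zshift b j) +
     dcot (pow2 (S m)) (zshift a (j + 2 * n)) (zshift b (j + 2 * n)))%C).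
  { intros j. rewrite !zshift_plus, hn, h2. apply dcot_double; [lra| |];
      apply Csin_half; now apply Csin_zshift. }
  rewrite !split.
  (* The indices [j + 2 n] and [j - 2 n] differ by [4 n], which is a full period at level [S m];
     this recentres the window. *)
  assert (per : forall j, dcot (pow2 (S m)) (zshift a (j + 2 * n)) (zshift b (j + 2 * n)) =
     dcot (pow2 (S m)) (zshift a (j - 2 * n)) (zshift b (j - 2 * n))).
  { intros j. replace (j + 2 * n)%Z with (j - 2 * n + 2 * (2 * n))%Z by ring.
    rewrite (zshift_plus a), (zshift_plus b), mult_IZR, hn. change (IZR 2 * pow2 m) with (pow2 (S m)).
    apply dcot_periodic. assert (h := pow2_pos (S m)). lra. }
  rewrite (per (Z.of_nat k)).
  replace (- Z.of_nat k - 1 + 2 * n)%Z with (2 * n - Z.of_nat k - 1)%Z by ring. ring.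
Qed.

Lemma lim_inv_pow2 : is_lim_seq (fun m => / pow2 m) 0.
Proof.
apply (is_lim_seq_ext (fun m => / 2 * (/ 2) ^ m)).
- intros m. unfold pow2. simpl. rewrite Rinv_mult, pow_inv. reflexivity.
- replace 0 with (/ 2 * 0) by ring. apply is_lim_seq_mult'; [apply is_lim_seq_const|].
  apply is_lim_seq_geom. rewrite Rabs_pos_eq; lra.
Qed.

Lemma lim_scaled (f : R -> R) (l x : R) : f 0 = 0 -> is_derive f 0 l ->
  is_lim_seq (fun m => pow2 m * f (x / pow2 m)) (l * x).
Proof.
intros f0 df.
assert (dg : is_derive (fun s => f (s * x)) 0 (l * x)).
{ evar_last.
  - apply (is_derive_comp f (fun s => s * x)).
    + rewrite Rmult_0_l. exact df.
    + auto_derive; auto.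
  - unfold scal; simpl; unfold mult; simpl. ring. }
apply is_derive_Reals in dg. apply is_lim_seq_spec. intros e.
destruct (dg e (cond_pos e)) as [d hd].
assert (hl := lim_inv_pow2). apply is_lim_seq_spec in hl. destruct (hl d) as [N hN].
exists N. intros m hm. specialize (hN m hm). simpl in hN. rewrite Rminus_0_r in hN.
assert (hp := pow2_pos m).
assert (hi : / pow2 m <> 0) by (apply Rinv_neq_0_compat; lra).
specialize (hd _ hi hN). rewrite Rplus_0_l, Rmult_0_l, f0, Rminus_0_r in hd.
replace (pow2 m * f (x / pow2 m)) with (f (/ pow2 m * x) / / pow2 m); [exact hd|].
replace (/ pow2 m * x) with (x / pow2 m) by (field; lra). field. lra.
Qed.

Lemma lim_vanishing (f : R -> R) (x : R) : continuity_pt f 0 ->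
  is_lim_seq (fun m => f (x / pow2 m)) (f 0).
Proof.
intros cf. apply (is_lim_seq_continuous f (fun m => x / pow2 m) 0 cf).
replace 0 with (x * 0) by ring. apply is_lim_seq_mult'; [apply is_lim_seq_const|].
apply lim_inv_pow2.
Qed.

Lemma clim_scaled_sin (w : C) :
  clim (fun m => RtoC (pow2 m) * Csin (w / RtoC (pow2 m)))%C w.
Proof.
destruct w as [x y].
assert (hdiv : forall m, Cdiv (x, y) (RtoC (pow2 m)) = (x / pow2 m, y / pow2 m)).
{ intros m. assert (h := pow2_pos m). apply C_ext; simpl; field; lra. }
assert (hsin : is_lim_seq (fun m => pow2 m * sin (x / pow2 m)) x).
{ replace (Finite x) with (Finite (1 * x)) by (f_equal; ring).
  apply lim_scaled; [apply sin_0|]. rewrite <- cos_0. apply is_derive_sin. }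
assert (hsinh : is_lim_seq (fun m => pow2 m * sinh (y / pow2 m)) y).
{ replace (Finite y) with (Finite (1 * y)) by (f_equal; ring).
  apply lim_scaled; [apply sinh_0|]. unfold sinh. auto_derive; [auto|].
  rewrite Ropp_0, exp_0. field. }
assert (hcos : is_lim_seq (fun m => cos (x / pow2 m)) 1).
{ rewrite <- cos_0. apply lim_vanishing, continuity_cos. }
assert (hcosh : is_lim_seq (fun m => cosh (y / pow2 m)) 1).
{ rewrite <- cosh_0. apply lim_vanishing. apply derivable_continuous_pt, derivable_pt_cosh. }
split.
- apply (is_lim_seq_ext (fun m => (pow2 m * sin (x / pow2 m)) * cosh (y / pow2 m))).
  + intros m. rewrite hdiv. unfold Csin, Re. simpl. ring.
  + simpl. replace (Finite x) with (Finite (x * 1)) by (f_equal; ring). now apply is_lim_seq_mult'.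
- apply (is_lim_seq_ext (fun m => cos (x / pow2 m) * (pow2 m * sinh (y / pow2 m)))).
  + intros m. rewrite hdiv. unfold Csin, Im. simpl. ring.
  + simpl. replace (Finite y) with (Finite (1 * y)) by (f_equal; ring). now apply is_lim_seq_mult'.
Qed.

Lemma clim_bounded (u : nat -> C) (l : C) : clim u l ->
  exists N, forall n, (N <= n)%nat -> Cmod (u n) <= Cmod l + 1.
Proof.
intros h. destruct (proj1 (clim_Cmod u l) h 1 Rlt_0_1) as [N hN].
exists N. intros n hn. specialize (hN n hn).
replace (u n) with (l + (u n - l))%C by ring.
eapply Rle_trans; [apply Cmod_triangle|]. lra.
Qed.

(** The real part gives [|k| PI <= |a + k PI| + |Re a|], and [d] absorbs the constants; [K] collects
    both contributions. *)
Lemma zshift_lower (a : C) (d : R) : 0 < d -> (forall k, d <= Cmod (zshift a k)) ->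
  exists c, 0 < c /\ forall k, c * (IZR (Z.abs k) + 1) <= Cmod (zshift a k).
Proof.
intros d0 hd. assert (hpi := PI_RGT_0). assert (ha := Rabs_pos (Re a)).
set (K := / PI + (Rabs (Re a) / PI + 1) / d).
assert (K0 : 0 < K).
{ unfold K. assert (0 < / PI) by now apply Rinv_0_lt_compat.
  assert (0 < (Rabs (Re a) / PI + 1) / d).
  { apply Rdiv_lt_0_compat; [|exact d0]. assert (0 <= Rabs (Re a) / PI) by (apply Rdiv_le_0_compat; auto). lra. }
  lra. }
exists (/ K). split; [now apply Rinv_0_lt_compat|]. intros k.
apply (Rmult_le_reg_l K); [exact K0|]. rewrite <- Rmult_assoc, Rinv_r, Rmult_1_l by lra.
specialize (hd k). set (w := Cmod (zshift a k)) in *.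
assert (hre : Rabs (Re a + IZR k * PI) <= w).
{ unfold w. replace (Re a + IZR k * PI) with (Re (zshift a k)) by (unfold zshift, Re; simpl; ring).
  eapply Rle_trans; [apply Rmax_l|apply (Rmax_Cmod (zshift a k))]. }
assert (hk : IZR (Z.abs k) * PI <= w + Rabs (Re a)).
{ rewrite abs_IZR. rewrite <- (Rabs_pos_eq PI) at 1 by lra. rewrite <- Rabs_mult.
  replace (IZR k * PI) with ((Re a + IZR k * PI) + - Re a) by ring.
  eapply Rle_trans; [apply Rabs_triang|]. rewrite Rabs_Ropp. lra. }
assert (hk' : IZR (Z.abs k) <= (w + Rabs (Re a)) / PI).
{ apply (Rmult_le_reg_r PI); [exact hpi|].
  replace ((w + Rabs (Re a)) / PI * PI) with (w + Rabs (Re a)) by (field; lra). exact hk. }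
assert (hw : Rabs (Re a) / PI + 1 <= (Rabs (Re a) / PI + 1) / d * w).
{ replace (Rabs (Re a) / PI + 1) with ((Rabs (Re a) / PI + 1) / d * d) at 1 by (field; lra).
  apply Rmult_le_compat_l; [|exact hd]. apply Rlt_le, Rdiv_lt_0_compat; [|exact d0].
  assert (0 <= Rabs (Re a) / PI) by (apply Rdiv_le_0_compat; auto). lra. }
unfold K. replace ((/ PI + (Rabs (Re a) / PI + 1) / d) * w) with
  (w / PI + (Rabs (Re a) / PI + 1) / d * w) by (field; lra).
replace ((w + Rabs (Re a)) / PI) with (w / PI + Rabs (Re a) / PI) in hk' by (field; lra). lra.
Qed.

Lemma dcot_limit (a b : C) : a <> RtoC 0 -> b <> RtoC 0 ->
  clim (fun m => dcot (pow2 m) a b) ((b - a) / (a * b))%C.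
Proof.
intros ha hb. unfold dcot, Cdiv. apply clim_mult; [apply clim_scaled_sin|].
apply clim_inv; [now apply Cmult_neq_0|]. apply clim_mult; apply clim_scaled_sin.
Qed.

Lemma scaled_sin_lower (w : C) (m : nat) : Rabs (Re w) <= 3 * PI / 4 * pow2 m ->
  ksin * Cmod w <= Cmod (RtoC (pow2 m) * Csin (w / RtoC (pow2 m)))%C.
Proof.
intros h. assert (hp := pow2_pos m). assert (hC := RtoC_neq0 _ (Rgt_not_eq _ _ hp)).
rewrite Cmod_mult, Cmod_R, Rabs_pos_eq by lra.
assert (hre : Re (w / RtoC (pow2 m))%C = Re w / pow2 m).
{ destruct w as [x y]. unfold Re. simpl. field. lra. }
assert (hmod : Cmod (w / RtoC (pow2 m))%C = Cmod w / pow2 m).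
{ rewrite Cmod_div by exact hC. rewrite Cmod_R, Rabs_pos_eq by lra. reflexivity. }
assert (hb : Rabs (Re (w / RtoC (pow2 m))%C) <= 3 * PI / 4).
{ rewrite hre. unfold Rdiv at 1. rewrite Rabs_mult, (Rabs_pos_eq (/ pow2 m)).
  2: { apply Rlt_le, Rinv_0_lt_compat, hp. }
  apply (Rmult_le_reg_r (pow2 m)); [exact hp|]. rewrite Rmult_assoc, Rinv_l by lra. lra. }
assert (hl := Csin_lower _ hb). rewrite hmod in hl.
apply (Rmult_le_compat_l (pow2 m)) in hl; [|lra].
replace (pow2 m * (ksin * (Cmod w / pow2 m))) with (ksin * Cmod w) in hl by (field; lra). exact hl.
Qed.

(** Domination for Tannery's theorem; [z] stands for either of the indices [k] and [- k - 1] of a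
    summand of [zsum]. *)
Lemma dcot_bound (a b : C) (m : nat) (B ca cb : R) (k : nat) (z : Z) : 0 < ca -> 0 < cb ->
  Cmod (RtoC (pow2 m) * Csin ((b - a) / RtoC (pow2 m)))%C <= B ->
  (INR k + 1 <= IZR (Z.abs z) + 1) -> IZR (Z.abs z) * PI <= PI / 2 * pow2 m ->
  ca * (IZR (Z.abs z) + 1) <= Cmod (zshift a z) ->
  cb * (IZR (Z.abs z) + 1) <= Cmod (zshift b z) ->
  Rabs (Re a) <= PI / 4 * pow2 m -> Rabs (Re b) <= PI / 4 * pow2 m ->
  Cmod (dcot (pow2 m) (zshift a z) (zshift b z)) <= B / (ksin ^ 2 * ca * cb) * / (INR k + 1) ^ 2.
Proof.
intros ca0 cb0 hB hk hz hla hlb ra rb. assert (hk0 := ksin_pos). assert (hpi := PI_RGT_0).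
assert (k0 := pos_INR k).
assert (hre : forall c, Rabs (Re c) <= PI / 4 * pow2 m -> Rabs (Re (zshift c z)) <= 3 * PI / 4 * pow2 m).
{ intros c hc. replace (Re (zshift c z)) with (Re c + IZR z * PI) by (unfold zshift, Re; simpl; ring).
  eapply Rle_trans; [apply Rabs_triang|]. rewrite Rabs_mult, <- abs_IZR, (Rabs_pos_eq PI) by lra. lra. }
assert (la := scaled_sin_lower _ _ (hre a ra)). assert (lb := scaled_sin_lower _ _ (hre b rb)).
unfold dcot.
replace (zshift b z - zshift a z)%C with (b - a)%C by (unfold zshift; ring).
set (A := (RtoC (pow2 m) * Csin (zshift a z / RtoC (pow2 m)))%C) in *.
set (D := (RtoC (pow2 m) * Csin (zshift b z / RtoC (pow2 m)))%C) in *.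
assert (hA : ksin * ca * (INR k + 1) <= Cmod A).
{ eapply Rle_trans; [|exact la]. rewrite Rmult_assoc. apply Rmult_le_compat_l; [lra|].
  eapply Rle_trans; [|exact hla]. apply Rmult_le_compat_l; lra. }
assert (hD : ksin * cb * (INR k + 1) <= Cmod D).
{ eapply Rle_trans; [|exact lb]. rewrite Rmult_assoc. apply Rmult_le_compat_l; [lra|].
  eapply Rle_trans; [|exact hlb]. apply Rmult_le_compat_l; lra. }
assert (pa : 0 < ksin * ca * (INR k + 1)) by (apply Rmult_lt_0_compat; [apply Rmult_lt_0_compat|]; lra).
assert (pb : 0 < ksin * cb * (INR k + 1)) by (apply Rmult_lt_0_compat; [apply Rmult_lt_0_compat|]; lra).
assert (nA : A <> RtoC 0) by (apply Cmod_gt_0; lra).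
assert (nD : D <> RtoC 0) by (apply Cmod_gt_0; lra).
rewrite Cmod_div by now apply Cmult_neq_0. rewrite (Cmod_mult A D).
replace (B / (ksin ^ 2 * ca * cb) * / (INR k + 1) ^ 2) with
  (B * / ((ksin * ca * (INR k + 1)) * (ksin * cb * (INR k + 1)))) by (field; lra).
unfold Rdiv. apply Rmult_le_compat; [apply Cmod_ge_0| |exact hB|].
- apply Rlt_le, Rinv_0_lt_compat, Rmult_lt_0_compat; lra.
- apply Rinv_le_contravar; [apply Rmult_lt_0_compat; lra|]. apply Rmult_le_compat; lra.
Qed.

(** The partial fractions of [cot a - cot b], with terms [1 / (a + k PI) - 1 / (b + k PI)]. Taking a
    difference makes the terms of order [1 / k^2], so that the finite identity [zsum_dcot] passes to
    the limit. *)
Lemma cot_difference_series (a b : C) (d : R) : 0 < d ->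
  Csin a <> RtoC 0 -> Csin b <> RtoC 0 ->
  (forall k, d <= Cmod (zshift a k)) -> (forall k, d <= Cmod (zshift b k)) ->
  clim (zsum (fun k => (b - a) / (zshift a k * zshift b k))%C)
    (Csin (b - a) / (Csin a * Csin b))%C.
Proof.
intros d0 ha hb hda hdb. assert (hpi := PI_RGT_0). assert (hk0 := ksin_pos).
destruct (zshift_lower a d d0 hda) as [ca [ca0 hca]].
destruct (zshift_lower b d d0 hdb) as [cb [cb0 hcb]].
destruct (clim_bounded _ _ (clim_scaled_sin (b - a)%C)) as [m1 hm1].
(* From [m2] on, both offsets are at most [PI / 4 * pow2 m], as [dcot_bound] demands. *)
destruct (INR_unbounded ((Rabs (Re a) + Rabs (Re b)) / (PI / 4))) as [m2 hm2].
set (B := Cmod (b - a)%C + 1).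
set (Q := B / (ksin ^ 2 * ca * cb)).
unfold zsum at 1. fold (zsum (fun k => (b - a) / (zshift a k * zshift b k))%C).
apply (tannery (fun m k => (dcot (pow2 m) (zshift a (Z.of_nat k)) (zshift b (Z.of_nat k)) +
  dcot (pow2 m) (zshift a (- Z.of_nat k - 1)) (zshift b (- Z.of_nat k - 1)))%C)
  (fun k => ((b - a) / (zshift a (Z.of_nat k) * zshift b (Z.of_nat k)) +
   (b - a) / (zshift a (- Z.of_nat k - 1) * zshift b (- Z.of_nat k - 1)))%C) _ (Q + Q) (max m1 m2)).
- assert (nz : forall c, (forall k, d <= Cmod (zshift c k)) -> forall k, zshift c k <> RtoC 0).
  { intros c hc k. apply Cmod_gt_0. specialize (hc k). lra. }
  assert (hh : forall k, clim (fun m => dcot (pow2 m) (zshift a k) (zshift b k))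
    ((b - a) / (zshift a k * zshift b k))%C).
  { intros k. replace (b - a)%C with (zshift b k - zshift a k)%C by (unfold zshift; ring).
    apply dcot_limit; auto. }
  intros k. apply clim_plus; apply hh.
- intros m k hm hk.
  assert (hpow : INR m2 <= pow2 m).
  { unfold pow2. apply Rle_trans with (INR (2 ^ S m)).
    - apply le_INR. assert (h := pow2_ge_S (S m)). lia.
    - rewrite pow_INR. replace (INR 2) with 2 by (simpl; ring). apply Rle_refl. }
  assert (hre : Rabs (Re a) + Rabs (Re b) <= PI / 4 * pow2 m).
  { apply Rle_trans with (PI / 4 * INR m2); [|apply Rmult_le_compat_l; lra].
    apply Rlt_le in hm2. apply (Rmult_le_compat_l (PI / 4)) in hm2; [|lra].
    replace (PI / 4 * ((Rabs (Re a) + Rabs (Re b)) / (PI / 4))) with (Rabs (Re a) + Rabs (Re b)) in hm2 by (field; lra).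
    exact hm2. }
  assert (pa := Rabs_pos (Re a)). assert (pb := Rabs_pos (Re b)).
  assert (hz : forall z : Z, (Z.abs z <= Z.of_nat (2 ^ m))%Z -> IZR (Z.abs z) * PI <= PI / 2 * pow2 m).
  { intros z hz. apply IZR_le in hz. rewrite <- IZR_pow2, mult_IZR.
    apply (Rmult_le_compat_r PI) in hz; lra. }
  eapply Rle_trans; [apply Cmod_triangle|]. rewrite Rmult_plus_distr_r.
  apply Rplus_le_compat.
  + apply dcot_bound; auto; try lra; [apply hm1; lia| |apply hz; lia].
    rewrite INR_IZR_INZ, Z.abs_eq by lia. lra.
  + apply dcot_bound; auto; try lra; [apply hm1; lia| |apply hz; lia].
    rewrite INR_IZR_INZ. apply Rplus_le_compat_r, IZR_le. lia.
- intros m. assert (h := zsum_dcot a b m ha hb). unfold zsum in h. rewrite h.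
  unfold dcot.
  assert (e1 : forall w, (w / RtoC 1)%C = w) by (intros w; field; apply RtoC_neq0; lra).
  rewrite !e1. f_equal; [ring|]. ring.
Qed.

(** * The invariant quadratic differential *)

(* [e] and [sg] are [sin (2 p) / (2 p)] and [sin p ^ 2] at a square root [p] of [X],
   which is real or purely imaginary. *)
Inductive root_data : R -> R -> R -> Prop :=
| root_real (a : R) : a <> 0 -> root_data (a ^ 2) (sin (2 * a) / (2 * a)) (sin a ^ 2)
| root_imag (b : R) : b <> 0 -> root_data (- b ^ 2) (sinh (2 * b) / (2 * b)) (- sinh b ^ 2).

Lemma Csin_neq0_im (z : C) : Im z <> 0 -> Csin z <> RtoC 0.
Proof.
intros h e. assert (h' := Cmod_Csin z). rewrite e, Cmod_0 in h'.
assert (h2 := sinh_lower (Im z)). assert (h3 := pow2_ge_0 (sin (Re z))).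
assert (0 < Im z ^ 2) by (destruct (Rdichotomy _ _ h); nra). lra.
Qed.

Lemma Csin_neq0_re (z : C) : 0 < Re z < PI -> Csin z <> RtoC 0.
Proof.
intros h e. assert (h' := Cmod_Csin z). rewrite e, Cmod_0 in h'.
assert (h2 := pow2_ge_0 (sinh (Im z))). assert (0 < sin (Re z)) by (apply sin_gt_0; lra).
assert (0 < sin (Re z) ^ 2) by (apply pow_lt; auto). lra.
Qed.

Lemma Cmod_ge_im (z : C) : Rabs (Im z) <= Cmod z.
Proof. eapply Rle_trans; [apply Rmax_r|apply (Rmax_Cmod z)]. Qed.

Lemma Cmod_ge_re (z : C) : Rabs (Re z) <= Cmod z.
Proof. eapply Rle_trans; [apply Rmax_l|apply (Rmax_Cmod z)]. Qed.

(** For [Re a] between [0] and [PI / 2], the nearest multiple of [PI] is [0]. *)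
Lemma zshift_re_lower (a : C) (k : Z) : 0 < Re a < PI / 2 -> Re a <= Cmod (zshift a k).
Proof.
intros h. eapply Rle_trans; [|apply Cmod_ge_re].
replace (Re (zshift a k)) with (Re a + IZR k * PI) by (unfold zshift, Re; simpl; ring).
destruct (Z_le_gt_dec 0 k) as [hk|hk].
- apply IZR_le in hk. assert (0 <= IZR k * PI) by (apply Rmult_le_pos; lra). rewrite Rabs_pos_eq; lra.
- assert (hk' : (k <= -1)%Z) by lia. apply IZR_le in hk'.
  assert (IZR k * PI <= -1 * PI) by (apply Rmult_le_compat_r; lra). rewrite Rabs_left; lra.
Qed.

Lemma zshift_im_lower (a : C) (k : Z) : Rabs (Im a) <= Cmod (zshift a k).
Proof.
eapply Rle_trans; [|apply Cmod_ge_im].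
replace (Im (zshift a k)) with (Im a) by (unfold zshift, Im; simpl; ring). lra.
Qed.

Lemma Csin_product (z p : C) :
  (Csin (z - p) * Csin (z + p) = Csin z * Csin z - Csin p * Csin p)%C.
Proof.
rewrite Csin_minus, Csin_plus.
assert (hz := Csin2_Ccos2 z). assert (hp := Csin2_Ccos2 p).
replace ((Csin z * Ccos p - Ccos z * Csin p) * (Csin z * Ccos p + Ccos z * Csin p))%C with
 (Csin z * Csin z * (Csin p * Csin p + Ccos p * Ccos p) -
  Csin p * Csin p * (Csin z * Csin z + Ccos z * Ccos z))%C by ring.
rewrite hz, hp. ring.
Qed.

Lemma clim_zsum_scal (c : C) (f g : Z -> C) (l : C) : (forall k, g k = (c * f k)%C) ->
  clim (zsum f) l -> clim (zsum g) (c * l)%C.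
Proof.
intros h hf. apply (clim_ext (fun n => c * zsum f n)%C).
- intros n. unfold zsum. rewrite <- csum_scal. apply csum_ext. intros k _. rewrite !h. ring.
- apply clim_mult; [apply clim_const|exact hf].
Qed.

(** As [1 / (z^2 - p^2)] is [(1 / (z - p) - 1 / (z + p)) / (2 p)], this is the cotangent series at
    [z - p] and [z + p], with the denominator rewritten by [Csin_product]. *)
Lemma pole_series_aux (z p : C) (d : R) : 0 < d -> p <> RtoC 0 ->
  Csin (z - p)%C <> RtoC 0 -> Csin (z + p)%C <> RtoC 0 ->
  (forall k, d <= Cmod (zshift (z - p)%C k)) -> (forall k, d <= Cmod (zshift (z + p)%C k)) ->
  clim (zsum (fun k => / (zshift z k * zshift z k - p * p))%C)
    (Csin (p + p) / (RtoC 2 * p) / (Csin z * Csin z - Csin p * Csin p))%C.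
Proof.
intros d0 hp ha hb hda hdb.
assert (h2 : RtoC 2 <> RtoC 0) by (apply RtoC_neq0; lra).
assert (hz : forall c k, (forall k, d <= Cmod (zshift c k)) -> zshift c k <> RtoC 0).
{ intros c k hc. apply Cmod_gt_0. specialize (hc k). lra. }
assert (h := cot_difference_series _ _ d d0 ha hb hda hdb).
replace (z + p - (z - p))%C with (p + p)%C in h by ring.
replace (Csin (p + p) / (RtoC 2 * p) / (Csin z * Csin z - Csin p * Csin p))%C with
  (/ (RtoC 2 * p) * (Csin (p + p) / (Csin (z - p) * Csin (z + p))))%C.
- eapply clim_zsum_scal; [|exact h]. intros k. simpl.
  assert (e1 : zshift (z - p)%C k = (zshift z k - p)%C) by (unfold zshift; ring).
  assert (e2 : zshift (z + p)%C k = (zshift z k + p)%C) by (unfold zshift; ring).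
  assert (n1 := hz _ k hda). assert (n2 := hz _ k hdb). rewrite e1 in n1. rewrite e2 in n2.
  rewrite e1, e2. replace (zshift z k * zshift z k - p * p)%C with
    ((zshift z k - p) * (zshift z k + p))%C by ring.
  field. repeat split; auto.
- rewrite <- Csin_product. field. repeat split; auto.
Qed.

(** The points [z - p] and [z + p] stay away from the multiples of [PI] for different reasons: by
    [Im z > 0] when [p] is real, and by [0 < Re z < PI / 2] when [p] is imaginary. *)
Lemma pole_series (z : C) (X e sg : R) : 0 < Re z < PI / 2 -> 0 < Im z -> root_data X e sg ->
  clim (zsum (fun k => / (zshift z k * zshift z k - RtoC X))%C)
    (RtoC e / (Csin z * Csin z - RtoC sg))%C /\ (Csin z * Csin z - RtoC sg)%C <> RtoC 0.
Proof.
intros hx hy hr. assert (h2 : RtoC 2 <> RtoC 0) by (apply RtoC_neq0; lra).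
assert (hpi := PI_RGT_0).
destruct hr as [a ha|b hb].
- assert (hp : RtoC a <> RtoC 0) by now apply RtoC_neq0.
  assert (n1 : Csin (z - RtoC a)%C <> RtoC 0).
  { apply Csin_neq0_im. unfold Im in *. simpl. lra. }
  assert (n2 : Csin (z + RtoC a)%C <> RtoC 0).
  { apply Csin_neq0_im. unfold Im in *. simpl. lra. }
  assert (hs : (Csin (RtoC a) * Csin (RtoC a))%C = RtoC (sin a ^ 2)).
  { apply C_ext; unfold Csin; simpl; rewrite sinh_0, cosh_0; ring. }
  split.
  2: { rewrite <- hs, <- Csin_product. now apply Cmult_neq_0. }
  assert (h := pole_series_aux z (RtoC a) (Im z) hy hp n1 n2).
  replace (RtoC (a ^ 2)) with (RtoC a * RtoC a)%C by (rewrite <- RtoC_mult; f_equal; ring).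
  rewrite <- hs. replace (RtoC (sin (2 * a) / (2 * a))) with (Csin (RtoC a + RtoC a) / (RtoC 2 * RtoC a))%C.
  + apply h; intros k.
    * rewrite <- (Rabs_pos_eq (Im z)) by lra.
      replace (Im z) with (Im (z - RtoC a)%C) by (unfold Im; simpl; ring). apply zshift_im_lower.
    * rewrite <- (Rabs_pos_eq (Im z)) by lra.
      replace (Im z) with (Im (z + RtoC a)%C) by (unfold Im; simpl; ring). apply zshift_im_lower.
  + rewrite RtoC_div by lra. rewrite RtoC_mult. f_equal. replace (2 * a) with (a + a) by ring.
    apply C_ext; unfold Csin; simpl; rewrite Rplus_0_r, ?sinh_0, ?cosh_0; ring.
- set (p := (Ci * RtoC b)%C).
  assert (pE : p = (0, b)) by (apply C_ext; unfold p; simpl; ring).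
  assert (hp : p <> RtoC 0). { rewrite pE. intros e'. apply hb. now injection e'. }
  assert (r1 : Re (z - p)%C = Re z) by (rewrite pE; unfold Re; simpl; ring).
  assert (r2 : Re (z + p)%C = Re z) by (rewrite pE; unfold Re; simpl; ring).
  assert (n1 : Csin (z - p)%C <> RtoC 0) by (apply Csin_neq0_re; lra).
  assert (n2 : Csin (z + p)%C <> RtoC 0) by (apply Csin_neq0_re; lra).
  assert (hs : (Csin p * Csin p)%C = RtoC (- sinh b ^ 2)).
  { rewrite pE. apply C_ext; unfold Csin; simpl; rewrite sin_0, cos_0; ring. }
  split.
  2: { rewrite <- hs, <- Csin_product. now apply Cmult_neq_0. }
  assert (h := pole_series_aux z p (Re z) (proj1 hx) hp n1 n2).
  replace (RtoC (- b ^ 2)) with (p * p)%C by (rewrite pE; apply C_ext; simpl; ring).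
  rewrite <- hs. replace (RtoC (sinh (2 * b) / (2 * b))) with (Csin (p + p) / (RtoC 2 * p))%C.
  + apply h; intros k.
    * rewrite <- r1. apply zshift_re_lower. lra.
    * rewrite <- r2. apply zshift_re_lower. lra.
  + rewrite RtoC_div by lra. rewrite RtoC_mult.
    replace (Csin (p + p)%C) with (Ci * RtoC (sinh (2 * b)))%C.
    * unfold p. assert (hbC := RtoC_neq0 _ hb).
      assert (hi : Ci <> RtoC 0). { intros e'. injection e'. lra. }
      field. repeat split; auto.
    * rewrite pE. replace (2 * b) with (b + b) by ring.
      apply C_ext; unfold Csin; simpl; rewrite Rplus_0_r, ?sin_0, ?cos_0; ring.
Qed.

(* Coefficient of the quadratic differential [q(z) dz^2]; invariance under [T z = i t tan z]
   reads [sum_k q (z + k pi) = T'(z)^2 q (T z)]. *)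
Definition qdiff (xi X : nat -> R) (n : nat) (z : C) : C :=
  csum (fun i => RtoC (xi i) / (z * z - RtoC (X i)))%C (S n).

Lemma zsum_csum (F : nat -> Z -> C) (n m : nat) :
  zsum (fun k => csum (fun i => F i k) m) n = csum (fun i => zsum (F i) n) m.
Proof.
induction m as [|m IH]; cbn [csum].
- unfold zsum. cbn [csum]. induction n as [|n IHn]; cbn [csum]; [ring|rewrite IHn; ring].
- rewrite <- IH. unfold zsum. rewrite <- csum_plus. apply csum_ext. intros k _. ring.
Qed.

Lemma clim_csum_const (u : nat -> nat -> C) (l : nat -> C) (n : nat) :
  (forall k, (k < n)%nat -> clim (u k) (l k)) -> clim (fun m => csum (fun k => u k m) n) (csum l n).
Proof.
induction n as [|n IH]; intros h; cbn [csum]; [apply clim_const|].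
apply clim_plus; auto.
Qed.

Lemma csum_RtoC (f : nat -> R) (m : nat) : csum (fun i => RtoC (f i)) m = RtoC (rsum f m).
Proof. induction m as [|m IH]; cbn [csum rsum]; [reflexivity|]. now rewrite IH, RtoC_plus. Qed.

Section pushforward.
Variables (t : R) (n : nat) (X e sg xi : nat -> R).
Hypothesis t0 : 0 < t.
Hypothesis hroot : forall i, (i <= n)%nat -> root_data (X i) (e i) (sg i).
Hypothesis X0 : X O = t ^ 2.
(** As [sg] is [sin p ^ 2], the quotient is [tan p ^ 2]: the next point is [i t tan p], and
    [sg <> 1] keeps [p] off the poles of the tangent. *)
Hypothesis hlink : forall i, (i < n)%nat -> sg i <> 1 /\ X (S i) = - t ^ 2 * (sg i / (1 - sg i)).
Hypothesis en : e n = 0.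
Hypothesis xi0 : xi O = 1.
Hypothesis xiS : forall i, (i < n)%nat -> xi (S i) = xi i * e i.
Hypothesis xi_sum : rsum xi (S n) = 0.

(** The condition on [w] is [w^2 = T(z)^2] with denominators cleared, which suffices because [q]
    depends only on the square; the factor in front is [T'(z)^2]. *)
Lemma qdiff_pushforward (z w : C) : 0 < Re z < PI / 2 -> 0 < Im z -> Ccos z <> RtoC 0 ->
  (w * w * (Ccos z * Ccos z) = - RtoC (t ^ 2) * (Csin z * Csin z))%C ->
  clim (zsum (fun k => qdiff xi X n (zshift z k)))
    (- RtoC (t ^ 2) / (Ccos z * Ccos z * (Ccos z * Ccos z)) * qdiff xi X n w)%C.
Proof.
intros hx hy hc hw.
assert (tC : RtoC (t ^ 2) <> RtoC 0) by (apply RtoC_neq0; nra).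
set (S2 := (Csin z * Csin z)%C) in *. set (c2 := (Ccos z * Ccos z)%C) in *.
assert (hS : (S2 = RtoC 1 - c2)%C). { unfold S2, c2. rewrite <- (Csin2_Ccos2 z). ring. }
assert (c2n : c2 <> RtoC 0) by now apply Cmult_neq_0.
assert (hw' : (w * w)%C = (- RtoC (t ^ 2) * S2 / c2)%C).
{ rewrite <- hw. field. exact c2n. }
assert (hser : forall i, (i <= n)%nat ->
  clim (zsum (fun k => / (zshift z k * zshift z k - RtoC (X i)))%C) (RtoC (e i) / (S2 - RtoC (sg i)))%C
  /\ (S2 - RtoC (sg i))%C <> RtoC 0).
{ intros i hi. apply pole_series; auto. }
set (r := fun i => (/ (w * w - RtoC (X i)))%C).
assert (hlim : clim (zsum (fun k => qdiff xi X n (zshift z k)))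
  (csum (fun i => RtoC (xi i) * (RtoC (e i) / (S2 - RtoC (sg i))))%C (S n))).
{ apply (clim_ext (fun N => csum (fun i =>
    zsum (fun k => RtoC (xi i) / (zshift z k * zshift z k - RtoC (X i)))%C N) (S n))).
  - intros N. unfold qdiff. now rewrite zsum_csum.
  - apply (clim_csum_const (fun i N => zsum (fun k => RtoC (xi i) / (zshift z k * zshift z k - RtoC (X i)))%C N)).
    intros i hi. eapply clim_zsum_scal; [|apply hser; lia]. intros k. reflexivity. }
assert (w0 : (w * w - RtoC (X O))%C = (- RtoC (t ^ 2) / c2)%C).
{ rewrite X0, hw', hS. field. exact c2n. }
(* A pole at [p] is carried to a pole at [T p], with the opposite pole at [X O = t^2], the square of
   the asymptotic values of [T]. *)
assert (hterm : forall i, (i < n)%nat ->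
  (RtoC (e i) / (S2 - RtoC (sg i)))%C = (- RtoC (t ^ 2) / (c2 * c2) * (RtoC (e i) * (r (S i) - r O)))%C).
{ intros i hi. destruct (hlink i hi) as [h1 h2]. destruct (hser i ltac:(lia)) as [_ hn].
  assert (h1C : RtoC (1 - sg i) <> RtoC 0) by (apply RtoC_neq0; lra).
  assert (wS : (w * w - RtoC (X (S i)))%C = (- RtoC (t ^ 2) * (S2 - RtoC (sg i)) / (c2 * RtoC (1 - sg i)))%C).
  { rewrite h2, hw', RtoC_mult, RtoC_div by lra. rewrite RtoC_opp.
    rewrite hS. rewrite RtoC_minus in *. field. repeat split; auto. }
  unfold r. rewrite wS, w0. rewrite hS in *. rewrite RtoC_minus in *. field. repeat split; auto. }
replace (- RtoC (t ^ 2) / (c2 * c2) * qdiff xi X n w)%C with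
  (csum (fun i => RtoC (xi i) * (RtoC (e i) / (S2 - RtoC (sg i))))%C (S n)); [exact hlim|].
(* The last pole sits at a pole of [T], and its push-forward vanishes. *)
cbn [csum]. rewrite en.
replace (RtoC (xi n) * (RtoC 0 / (S2 - RtoC (sg n))))%C with (RtoC 0).
2: { destruct (hser n (Nat.le_refl _)) as [_ hn]. field. exact hn. }
rewrite Cplus_0_r.
rewrite (csum_ext _ (fun i => - RtoC (t ^ 2) / (c2 * c2) * (RtoC (xi (S i)) * r (S i) + - r O * RtoC (xi (S i))))%C).
2: { intros i hi. rewrite hterm by exact hi. rewrite (xiS i hi), RtoC_mult. ring. }
rewrite csum_scal. f_equal. rewrite csum_plus, csum_scal, (csum_RtoC (fun i => xi (S i))).
(* The vanishing sum enters here: the poles created at [X O] have total coefficient [1 = xi O]. *)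
assert (hs : rsum (fun i => xi (S i)) n = - 1).
{ rewrite rsum_head, xi0 in xi_sum. lra. }
rewrite hs. unfold qdiff. rewrite csum_head, xi0. unfold r.
replace (csum (fun i => RtoC (xi (S i)) / (w * w - RtoC (X (S i))))%C n) with
 (csum (fun i => RtoC (xi (S i)) * / (w * w - RtoC (X (S i))))%C n) by (apply csum_ext; reflexivity).
replace (RtoC (-1)) with (- RtoC 1)%C by (apply C_ext; simpl; ring). unfold Cdiv. ring.
Qed.
End pushforward.

(** * Continuity and integrability of the modulus of [q] *)

Definition ccont (F : R -> R -> C) (x y : R) : Prop :=
  continuity_2d_pt (fun u v => Re (F u v)) x y /\ continuity_2d_pt (fun u v => Im (F u v)) x y.

Lemma ccont_const (c : C) (x y : R) : ccont (fun _ _ => c) x y.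
Proof. split; apply continuity_2d_pt_const. Qed.

Lemma ccont_plus (F G : R -> R -> C) (x y : R) : ccont F x y -> ccont G x y ->
  ccont (fun u v => F u v + G u v)%C x y.
Proof. intros [h1 h2] [k1 k2]. split; simpl; now apply continuity_2d_pt_plus. Qed.

Lemma ccont_mult (F G : R -> R -> C) (x y : R) : ccont F x y -> ccont G x y ->
  ccont (fun u v => F u v * G u v)%C x y.
Proof.
intros [h1 h2] [k1 k2]. split; simpl.
- apply continuity_2d_pt_minus; now apply continuity_2d_pt_mult.
- apply continuity_2d_pt_plus; now apply continuity_2d_pt_mult.
Qed.

Lemma ccont_inv (F : R -> R -> C) (x y : R) : F x y <> RtoC 0 -> ccont F x y ->
  ccont (fun u v => / F u v)%C x y.
Proof.
intros h [h1 h2].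
assert (d0 : Re (F x y) ^ 2 + Im (F x y) ^ 2 <> 0).
{ intros e. apply h. apply C_ext; simpl; nra. }
assert (hd : continuity_2d_pt (fun u v => Re (F u v) ^ 2 + Im (F u v) ^ 2) x y).
{ apply continuity_2d_pt_plus; now apply continuity_2d_pow2. }
split; simpl; apply continuity_2d_div; auto.
now apply continuity_2d_pt_opp.
Qed.

Lemma ccont_csum (F : nat -> R -> R -> C) (n : nat) (x y : R) :
  (forall i, (i < n)%nat -> ccont (F i) x y) -> ccont (fun u v => csum (fun i => F i u v) n) x y.
Proof.
induction n as [|n IH]; intros h; cbn [csum]; [apply ccont_const|]. apply ccont_plus; auto.
Qed.

Lemma ccont_Cmod (F : R -> R -> C) (x y : R) : ccont F x y ->
  continuity_2d_pt (fun u v => Cmod (F u v)) x y.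
Proof.
intros [h1 h2].
apply (continuity_1d_2d_pt_comp sqrt (fun u v => Re (F u v) ^ 2 + Im (F u v) ^ 2)).
- apply continuity_pt_sqrt. nra.
- apply continuity_2d_pt_plus; now apply continuity_2d_pow2.
Qed.

Definition cpt (x y : R) : C := (x, y).

Section modulus.
Variables (xi X : nat -> R) (n : nat).

Definition qpt (x y : R) : C := qdiff xi X n (cpt x y).

Lemma qpt_ccont (c x y : R) :
  (forall i, (i <= n)%nat -> (cpt (x + c) y * cpt (x + c) y - RtoC (X i))%C <> RtoC 0) ->
  ccont (fun u v => qpt (u + c) v) x y.
Proof.
intros h. apply (ccont_csum (fun i u v => RtoC (xi i) / (cpt (u + c) v * cpt (u + c) v - RtoC (X i)))%C).
intros i hi. apply ccont_mult; [apply ccont_const|]. apply ccont_inv; [apply h; lia|].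
assert (hz : ccont (fun u v => cpt (u + c) v) x y).
{ split; simpl; [|apply continuity_2d_pt_id2].
  apply continuity_2d_pt_plus; [apply continuity_2d_pt_id1|apply continuity_2d_pt_const]. }
apply (ccont_plus (fun u v => cpt (u + c) v * cpt (u + c) v)%C (fun _ _ => - RtoC (X i))%C).
- now apply ccont_mult.
- apply ccont_const.
Qed.

Lemma sqr_neq_real (x y r : R) : x <> 0 -> y <> 0 -> (cpt x y * cpt x y - RtoC r)%C <> RtoC 0.
Proof.
intros hx hy e. apply (f_equal snd) in e. simpl in e.
assert (x * y <> 0) by now apply Rmult_integral_contrapositive. lra.
Qed.

(** [q] is even with real coefficients, so its value at [- conj z] is the conjugate of its value at
    [z]. *)
Lemma qpt_opp (x y : R) : Cmod (qpt (- x) y) = Cmod (qpt x y).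
Proof.
rewrite <- (Cmod_conj (qpt x y)). f_equal. unfold qpt, qdiff.
assert (h : forall f m, Cconj (csum f m) = csum (fun i => Cconj (f i)) m).
{ intros f m. induction m as [|m IH]; cbn [csum].
  - apply C_ext; simpl; ring.
  - rewrite <- IH. apply C_ext; simpl; ring. }
rewrite h. apply csum_ext. intros i _.
apply C_ext; simpl; unfold Rdiv;
 replace (- x * - x - y * y + - X i) with (x * x - y * y + - X i) by ring;
 replace (- x * y + y * - x + - 0) with (- (x * y + y * x + - 0)) by ring;
 rewrite ?Rmult_1_r; set (A := x * x - y * y + - X i); set (B := x * y + y * x + - 0);
 replace (- B * - B) with (B * B) by ring; ring.
Qed.

End modulus.

Definition pole_weight (p : R * R) (x y : R) : R :=
  inv_weight (x - fst p) * inv_weight (y - snd p).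

Definition dist2 (p : R * R) (x y : R) : R := (x - fst p) ^ 2 + (y - snd p) ^ 2.
Definition nrm2 (p : R * R) : R := fst p ^ 2 + snd p ^ 2.

Lemma inv_weight_pos (s : R) : s <> 0 -> 0 < inv_weight s.
Proof.
intros h. assert (0 < Rabs s) by now apply Rabs_pos_lt.
apply Rinv_0_lt_compat, Rmult_lt_0_compat; [now apply sqrt_lt_R0|lra].
Qed.

(** With [dx] and [dy] the coordinates of [z - p], one has [sqrt |dx| sqrt |dy| <= |z - p|], while
    [(1 + |dx|) (1 + |dy|) <= 2 + dx^2 + dy^2] is at most a constant times [k + |z|^2]. *)
Lemma pole_weight_lower (p : R * R) (k x y : R) : 0 < k -> x <> fst p -> y <> snd p ->
  / (sqrt (dist2 p x y) * (k + (x ^ 2 + y ^ 2))) <=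
  ((2 + 2 * nrm2 p) / k + 2) * pole_weight p x y.
Proof.
intros k0 hx hy. destruct p as [px py]. unfold pole_weight, dist2, nrm2, inv_weight. simpl fst in *; simpl snd in *.
set (dx := x - px). set (dy := y - py).
assert (x0 : 0 < Rabs dx) by (apply Rabs_pos_lt; unfold dx; lra).
assert (y0 : 0 < Rabs dy) by (apply Rabs_pos_lt; unfold dy; lra).
assert (sx : 0 < sqrt (Rabs dx)) by now apply sqrt_lt_R0.
assert (sy : 0 < sqrt (Rabs dy)) by now apply sqrt_lt_R0.
assert (ex := pow2_abs dx). assert (ey := pow2_abs dy).
assert (hs : sqrt (Rabs dx) * sqrt (Rabs dy) <= sqrt (dx ^ 2 + dy ^ 2)).
{ rewrite <- sqrt_mult by lra. apply sqrt_le_1; nra. }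
set (K := (2 + 2 * (px ^ 2 + py ^ 2)) / k + 2).
assert (hK : (1 + Rabs dx) * (1 + Rabs dy) <= K * (k + (x ^ 2 + y ^ 2))).
{ assert (e : K * (k + (x ^ 2 + y ^ 2)) = 2 + 2 * (px ^ 2 + py ^ 2) + 2 * k + K * (x ^ 2 + y ^ 2)).
  { unfold K. field. lra. }
  assert (K2 : 2 <= K). { unfold K. assert (0 <= (2 + 2 * (px ^ 2 + py ^ 2)) / k).
    { apply Rdiv_le_0_compat; [nra|exact k0]. } lra. }
  assert (dx ^ 2 <= 2 * x ^ 2 + 2 * px ^ 2) by (assert (h := pow2_ge_0 (x + px)); unfold dx; nra).
  assert (dy ^ 2 <= 2 * y ^ 2 + 2 * py ^ 2) by (assert (h := pow2_ge_0 (y + py)); unfold dy; nra).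
  assert (0 <= x ^ 2 + y ^ 2) by nra.
  assert (2 * (x ^ 2 + y ^ 2) <= K * (x ^ 2 + y ^ 2)) by (apply Rmult_le_compat_r; lra).
  assert ((1 + Rabs dx) * (1 + Rabs dy) <= 2 + Rabs dx ^ 2 + Rabs dy ^ 2).
  { assert (h := pow2_ge_0 (Rabs dx - Rabs dy)). assert (h' := pow2_ge_0 (Rabs dx - 1)).
    assert (h'' := pow2_ge_0 (Rabs dy - 1)). nra. }
  rewrite e. lra. }
assert (q : 0 < k + (x ^ 2 + y ^ 2)) by nra.
assert (K0 : 0 < K). { assert (0 < (1 + Rabs dx) * (1 + Rabs dy)) by nra. nra. }
set (A := sqrt (Rabs dx)) in *. set (B := sqrt (Rabs dy)) in *.
set (s := sqrt (dx ^ 2 + dy ^ 2)) in *.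
set (a := 1 + Rabs dx) in *. set (b := 1 + Rabs dy) in *.
assert (a0 : 0 < a) by (unfold a; lra). assert (b0 : 0 < b) by (unfold b; lra).
assert (AB : 0 < A * B) by nra. assert (s0 : 0 < s) by lra. assert (ab : 0 < a * b) by nra.
replace (K * (/ (A * a) * / (B * b))) with (/ ((A * B) * (a * b) / K)) by (field; lra).
apply Rinv_le_contravar.
- apply Rdiv_lt_0_compat; [nra|exact K0].
- apply (Rmult_le_reg_r K); [exact K0|]. replace (A * B * (a * b) / K * K) with (A * B * (a * b)) by (field; lra).
  replace (s * (k + (x ^ 2 + y ^ 2)) * K) with (s * (K * (k + (x ^ 2 + y ^ 2)))) by ring.
  apply Rmult_le_compat; lra.
Qed.

(* Square root of [X] with nonnegative coordinates: [sqrt] vanishes on negative reals. *)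
Definition root_pt (X : R) : R * R := (sqrt X, sqrt (- X)).

(** [|z^2 - X|] is [|z - p| |z + p|], and [|z + p|^2 >= |z|^2 + |p|^2] because [z] and [p] have
    nonnegative coordinates. *)
Lemma root_point (X : R) : X <> 0 -> 0 < nrm2 (root_pt X) /\
  X = fst (root_pt X) ^ 2 - snd (root_pt X) ^ 2 /\
  forall x y, 0 < x -> 0 < y ->
  sqrt (dist2 (root_pt X) x y) * sqrt (nrm2 (root_pt X) + (x ^ 2 + y ^ 2)) <=
    Cmod (cpt x y * cpt x y - RtoC X)%C.
Proof.
intros hX. unfold nrm2, dist2, root_pt. simpl fst; simpl snd.
assert (h1 := sqrt_pos X). assert (h2 := sqrt_pos (- X)).
assert (hc : sqrt X * sqrt (- X) = 0 /\ sqrt X ^ 2 + sqrt (- X) ^ 2 = Rabs X /\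
  X = sqrt X ^ 2 - sqrt (- X) ^ 2).
{ destruct (Rle_dec 0 X) as [h|h].
  - rewrite (sqrt_neg_0 (- X)), pow2_sqrt, Rabs_pos_eq by lra. repeat split; ring.
  - apply Rnot_le_lt in h. rewrite (sqrt_neg_0 X), (pow2_sqrt (- X)), Rabs_left by lra. repeat split; ring. }
destruct hc as [h3 [h4 h5]].
set (px := sqrt X) in *. set (py := sqrt (- X)) in *.
split; [rewrite h4; now apply Rabs_pos_lt|]. split; [exact h5|].
intros x y x0 y0.
assert (h6 : 0 <= (x - px) ^ 2 + (y - py) ^ 2) by (apply Rplus_le_le_0_compat; apply pow2_ge_0).
assert (h7 : 0 <= px ^ 2 + py ^ 2 + (x ^ 2 + y ^ 2)).
{ assert (hx := pow2_ge_0 x). assert (hy := pow2_ge_0 y).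
  assert (k1 := pow2_ge_0 px). assert (k2 := pow2_ge_0 py). lra. }
rewrite <- sqrt_mult by lra.
assert (hm : Cmod (cpt x y * cpt x y - RtoC X)%C =
  sqrt (((x - px) ^ 2 + (y - py) ^ 2) * ((x + px) ^ 2 + (y + py) ^ 2))).
{ unfold Cmod. f_equal. replace (RtoC X) with (RtoC (px ^ 2 - py ^ 2)) by (now rewrite <- h5). simpl fst; simpl snd.
  (* The two correction terms contain [px * py], which is [0] since [p] lies on an axis. *)
  replace (((x - px) ^ 2 + (y - py) ^ 2) * ((x + px) ^ 2 + (y + py) ^ 2)) with
   ((x * x - y * y + - (px ^ 2 - py ^ 2)) ^ 2 + (x * y + y * x + - 0) ^ 2
     + 4 * (px * py) ^ 2 - 8 * (px * py) * (x * y)) by ring.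
  rewrite h3. ring. }
rewrite hm. apply sqrt_le_1_alt. apply Rmult_le_compat_l; nra.
Qed.

(** The difference is [(X - X') / ((z^2 - X) (z^2 - X'))]. Its denominator is at least
    [s s' (k + |z|^2)], with [s] and [s'] the distances from [z] to [p] and [p']; then
    [|p - p'| <= s + s'] replaces [1 / (s s')] by a sum of terms with a single singularity each. *)
Lemma pole_pair_bound (X X' : R) (p p' : R * R) :
  0 < nrm2 p -> 0 < nrm2 p' -> X = fst p ^ 2 - snd p ^ 2 -> X' = fst p' ^ 2 - snd p' ^ 2 ->
  (forall x y, 0 < x -> 0 < y ->
    sqrt (dist2 p x y) * sqrt (nrm2 p + (x ^ 2 + y ^ 2)) <= Cmod (cpt x y * cpt x y - RtoC X)%C) ->
  (forall x y, 0 < x -> 0 < y ->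
    sqrt (dist2 p' x y) * sqrt (nrm2 p' + (x ^ 2 + y ^ 2)) <= Cmod (cpt x y * cpt x y - RtoC X')%C) ->
  exists A, 0 <= A /\ forall x y, 0 < x -> 0 < y ->
   x <> fst p -> y <> snd p -> x <> fst p' -> y <> snd p' ->
   Cmod (/ (cpt x y * cpt x y - RtoC X) - / (cpt x y * cpt x y - RtoC X'))%C <=
   A * (pole_weight p x y + pole_weight p' x y).
Proof.
intros hp hp' hX hX' hl hl'.
destruct (Req_dec X X') as [->|hne].
{ exists 0. split; [lra|]. intros x y _ _ _ _ _ _.
  replace (/ (cpt x y * cpt x y - RtoC X') - / (cpt x y * cpt x y - RtoC X'))%C with (RtoC 0) by ring.
  rewrite Cmod_0. lra. }
set (k := Rmin (nrm2 p) (nrm2 p')).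
assert (k0 : 0 < k) by now apply Rmin_pos.
set (D := sqrt ((fst p - fst p') ^ 2 + (snd p - snd p') ^ 2)).
assert (D0 : 0 < D).
{ apply sqrt_lt_R0. destruct (Req_dec (fst p) (fst p')) as [e1|e1]; destruct (Req_dec (snd p) (snd p')) as [e2|e2].
  - exfalso. apply hne. now rewrite hX, hX', e1, e2.
  - assert (0 < (snd p - snd p') ^ 2) by (apply pow2_gt_0; lra). nra.
  - assert (0 < (fst p - fst p') ^ 2) by (apply pow2_gt_0; lra). nra.
  - assert (0 < (snd p - snd p') ^ 2) by (apply pow2_gt_0; lra). nra. }
set (K1 := (2 + 2 * nrm2 p) / k + 2). set (K2 := (2 + 2 * nrm2 p') / k + 2).
assert (K1p : 0 <= K1). { unfold K1. assert (0 <= (2 + 2 * nrm2 p) / k) by (apply Rdiv_le_0_compat; lra). lra. }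
assert (K2p : 0 <= K2). { unfold K2. assert (0 <= (2 + 2 * nrm2 p') / k) by (apply Rdiv_le_0_compat; lra). lra. }
assert (hXX : 0 <= Rabs (X - X') / D) by (apply Rdiv_le_0_compat; [apply Rabs_pos|exact D0]).
exists (Rabs (X - X') / D * (K1 + K2)).
split; [apply Rmult_le_pos; lra|].
intros x y x0 y0 n1 n2 n3 n4.
specialize (hl x y x0 y0). specialize (hl' x y x0 y0).
set (s := sqrt (dist2 p x y)) in *. set (s' := sqrt (dist2 p' x y)) in *.
assert (s0 : 0 < s). { apply sqrt_lt_R0. unfold dist2. assert (0 < (x - fst p) ^ 2) by (apply pow2_gt_0; lra). nra. }
assert (s0' : 0 < s'). { apply sqrt_lt_R0. unfold dist2. assert (0 < (x - fst p') ^ 2) by (apply pow2_gt_0; lra). nra. }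
set (r := x ^ 2 + y ^ 2) in *. assert (r0 : 0 < r) by (unfold r; nra).
assert (w1 : / (s * (k + r)) <= K1 * pole_weight p x y) by now apply pole_weight_lower.
assert (w2 : / (s' * (k + r)) <= K2 * pole_weight p' x y) by now apply pole_weight_lower.
assert (tri : D <= s + s').
{ assert (ht := Cmod_triangle (fst p - x, snd p - y) (x - fst p', y - snd p')).
  unfold Cmod in ht. unfold s, s', dist2, D. simpl fst in ht. simpl snd in ht.
  replace (fst p - x + (x - fst p')) with (fst p - fst p') in ht by ring.
  replace (snd p - y + (y - snd p')) with (snd p - snd p') in ht by ring.
  replace ((x - fst p) ^ 2) with ((fst p - x) ^ 2) by ring.
  replace ((y - snd p) ^ 2) with ((snd p - y) ^ 2) by ring. exact ht. }
set (Z := (cpt x y * cpt x y)%C) in *.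
set (m := Cmod (Z - RtoC X)%C) in *. set (m' := Cmod (Z - RtoC X')%C) in *.
assert (hk1 : sqrt (k + r) <= sqrt (nrm2 p + r)).
{ apply sqrt_le_1_alt. assert (h := Rmin_l (nrm2 p) (nrm2 p')). unfold k. lra. }
assert (hk2 : sqrt (k + r) <= sqrt (nrm2 p' + r)).
{ apply sqrt_le_1_alt. assert (h := Rmin_r (nrm2 p) (nrm2 p')). unfold k. lra. }
assert (hkr : sqrt (k + r) * sqrt (k + r) = k + r) by (apply sqrt_def; lra).
assert (hk0 : 0 < sqrt (k + r)) by (apply sqrt_lt_R0; lra).
assert (hm1 : s * sqrt (k + r) <= m). { eapply Rle_trans; [|exact hl]. apply Rmult_le_compat_l; lra. }
assert (hm2 : s' * sqrt (k + r) <= m'). { eapply Rle_trans; [|exact hl']. apply Rmult_le_compat_l; lra. }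
assert (m0 : 0 < m) by nra. assert (m0' : 0 < m') by nra.
assert (nz : (Z - RtoC X)%C <> RtoC 0) by now apply Cmod_gt_0.
assert (nz' : (Z - RtoC X')%C <> RtoC 0) by now apply Cmod_gt_0.
replace (/ (Z - RtoC X) - / (Z - RtoC X'))%C with (RtoC (X - X') / ((Z - RtoC X) * (Z - RtoC X')))%C.
2: { rewrite RtoC_minus. field. split; auto. }
rewrite Cmod_div by now apply Cmult_neq_0. rewrite Cmod_mult, Cmod_R. fold m m'.
assert (hmm : s * s' * (k + r) <= m * m').
{ rewrite <- hkr.
  replace (s * s' * (sqrt (k + r) * sqrt (k + r))) with ((s * sqrt (k + r)) * (s' * sqrt (k + r))) by ring.
  apply Rmult_le_compat; [apply Rmult_le_pos; lra|apply Rmult_le_pos; lra|exact hm1|exact hm2]. }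
assert (ss : 0 < s * s') by (apply Rmult_lt_0_compat; lra). assert (kr : 0 < k + r) by lra.
assert (sk : 0 < s * s' * (k + r)) by (apply Rmult_lt_0_compat; lra).
assert (h1 : / (m * m') <= / (s * s' * (k + r))) by (apply Rinv_le_contravar; [exact sk|exact hmm]).
assert (h2 : D * / (s * s' * (k + r)) <= / (s * (k + r)) + / (s' * (k + r))).
{ replace (/ (s * (k + r)) + / (s' * (k + r))) with ((s + s') * / (s * s' * (k + r))) by (field; lra).
  apply Rmult_le_compat_r; [|exact tri]. apply Rlt_le, Rinv_0_lt_compat. exact sk. }
assert (pw1 : 0 < pole_weight p x y) by (apply Rmult_lt_0_compat; apply inv_weight_pos; lra).
assert (pw2 : 0 < pole_weight p' x y) by (apply Rmult_lt_0_compat; apply inv_weight_pos; lra).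
unfold Rdiv at 1.
replace (Rabs (X - X') * / (m * m')) with (Rabs (X - X') / D * (D * / (m * m'))) by (field; repeat split; lra).
rewrite Rmult_assoc. apply Rmult_le_compat_l; [exact hXX|].
apply Rle_trans with (D * / (s * s' * (k + r))); [apply Rmult_le_compat_l; lra|].
eapply Rle_trans; [exact h2|].
assert (0 <= K1 * pole_weight p' x y) by (apply Rmult_le_pos; lra).
assert (0 <= K2 * pole_weight p x y) by (apply Rmult_le_pos; lra).
lra.
Qed.

Lemma rsum_plus (f g : nat -> R) (n : nat) : rsum (fun k => f k + g k) n = rsum f n + rsum g n.
Proof. induction n as [|n IH]; cbn [rsum]; [ring|rewrite IH; ring]. Qed.

Lemma rsum_ext (f g : nat -> R) (n : nat) :
  (forall k, (k < n)%nat -> f k = g k) -> rsum f n = rsum g n.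
Proof. induction n as [|n IH]; intros h; cbn [rsum]; [auto|]. rewrite IH, h; auto. Qed.

Lemma rsum_f_R0 (f : nat -> R) (n : nat) : sum_f_R0 f n = rsum f (S n).
Proof. induction n as [|n IH]; cbn [rsum sum_f_R0] in *; [ring|rewrite IH; ring]. Qed.

Section mass.
Variables (xi X : nat -> R) (n : nat).
Hypothesis Xn0 : forall i, (i <= n)%nat -> X i <> 0.
Hypothesis xi_sum : rsum xi (S n) = 0.

Let W (i : nat) (x y : R) : R := pole_weight (root_pt (X i)) x y.

(** Every pole is compared with the last one: the pair [X i], [X n] contributes to the coefficient
    of index [i] and adds its share to [K']. *)
Lemma qpt_partial_bound (m : nat) : (m <= n)%nat -> exists (K : nat -> R) (K' : R),
  (forall i, 0 <= K i) /\ 0 <= K' /\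
  forall x y, 0 < x -> 0 < y ->
   (forall i, x <> fst (root_pt (X i)) /\ y <> snd (root_pt (X i))) ->
   Cmod (csum (fun i => RtoC (xi i) * (/ (cpt x y * cpt x y - RtoC (X i)) -
     / (cpt x y * cpt x y - RtoC (X n))))%C m) <= rsum (fun i => K i * W i x y) m + K' * W n x y.
Proof.
induction m as [|m IH]; intros hm.
- exists (fun _ => 0), 0. repeat split; try lra; intros; try lra. cbn [csum rsum]. rewrite Cmod_0. lra.
- destruct (IH ltac:(lia)) as [K [K' [hK [hK' hb]]]].
  destruct (root_point _ (Xn0 m ltac:(lia))) as [a1 [a2 a3]].
  destruct (root_point _ (Xn0 n ltac:(lia))) as [b1 [b2 b3]].
  destruct (pole_pair_bound _ _ _ _ a1 b1 a2 b2 a3 b3) as [A [A0 hA]].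
  assert (xA : 0 <= Rabs (xi m) * A) by (apply Rmult_le_pos; [apply Rabs_pos|exact A0]).
  exists (fun i => if Nat.eqb i m then Rabs (xi m) * A else K i), (K' + Rabs (xi m) * A).
  split; [intros i; destruct (Nat.eqb i m); auto|]. split; [lra|].
  intros x y x0 y0 hl. specialize (hb x y x0 y0 hl).
  destruct (hl m) as [l1 l2]. destruct (hl n) as [l3 l4].
  specialize (hA x y x0 y0 l1 l2 l3 l4).
  cbn [csum rsum]. rewrite Nat.eqb_refl.
  rewrite (rsum_ext _ (fun i => K i * W i x y)).
  2: { intros k hk. replace (Nat.eqb k m) with false; auto. symmetry. apply Nat.eqb_neq. lia. }
  eapply Rle_trans; [apply Cmod_triangle|]. rewrite Cmod_mult, Cmod_R.
  apply (Rmult_le_compat_l (Rabs (xi m))) in hA; [|apply Rabs_pos].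
  fold (W m x y) (W n x y) in hA. lra.
Qed.

Lemma qpt_split (x y : R) : qpt xi X n x y =
  csum (fun i => RtoC (xi i) * (/ (cpt x y * cpt x y - RtoC (X i)) -
     / (cpt x y * cpt x y - RtoC (X n))))%C n.
Proof.
unfold qpt, qdiff. set (Z := (cpt x y * cpt x y)%C).
replace (csum (fun i => RtoC (xi i) * (/ (Z - RtoC (X i)) - / (Z - RtoC (X n))))%C n) with
  (csum (fun i => RtoC (xi i) * (/ (Z - RtoC (X i)) - / (Z - RtoC (X n))))%C (S n)).
2: { cbn [csum]. ring. }
rewrite (csum_ext (fun i => RtoC (xi i) * (/ (Z - RtoC (X i)) - / (Z - RtoC (X n))))%C
  (fun i => RtoC (xi i) / (Z - RtoC (X i)) + (- / (Z - RtoC (X n))) * RtoC (xi i))%C).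
2: { intros. unfold Cdiv. ring. }
rewrite csum_plus, csum_scal, csum_RtoC, xi_sum. ring.
Qed.

(* As [sum xi = 0], [q] is a combination of differences of two poles, of order [|z|^-4]. *)
Lemma qpt_bound : exists (K : nat -> R), (forall i, 0 <= K i) /\
  forall x y, 0 < x -> 0 < y ->
   (forall i, x <> fst (root_pt (X i)) /\ y <> snd (root_pt (X i))) ->
   Cmod (qpt xi X n x y) <= sum_f_R0 (fun i => K i * (inv_weight (x - fst (root_pt (X i))) *
     inv_weight (y - snd (root_pt (X i))))) n.
Proof.
destruct (qpt_partial_bound n (Nat.le_refl _)) as [K [K' [hK [hK' hb]]]].
exists (fun i => if Nat.eqb i n then K' else K i). split; [intros i; destruct (Nat.eqb i n); auto|].
intros x y x0 y0 hl. rewrite rsum_f_R0. cbn [rsum]. rewrite Nat.eqb_refl.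
rewrite (rsum_ext _ (fun i => K i * W i x y)).
2: { intros k hk. replace (Nat.eqb k n) with false; auto. symmetry. apply Nat.eqb_neq. lia. }
rewrite qpt_split. now apply hb.
Qed.

End mass.

(* The defect in the triangle inequality for two of the summands. *)
Lemma zsum_defect (f : Z -> C) (k m : nat) : (0 < k)%nat -> (k < m)%nat ->
  Cmod (zsum f m) + (Cmod (f (-1)%Z) + Cmod (f (Z.of_nat k)) -
    Cmod (f (-1)%Z + f (Z.of_nat k))%C) <=
  rsum (fun j => Cmod (f (Z.of_nat j)) + Cmod (f (- Z.of_nat j - 1)%Z)) m.
Proof.
intros k0. induction m as [|m IH]; intros hm; [lia|].
unfold zsum in *.
set (g := fun j => (f (Z.of_nat j) + f (- Z.of_nat j - 1)%Z)%C) in *.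
set (h := fun j => Cmod (f (Z.of_nat j)) + Cmod (f (- Z.of_nat j - 1)%Z)) in *.
assert (gh : forall j, Cmod (g j) <= h j) by (intros j; apply Cmod_triangle).
cbn [csum rsum].
(* [f (-1)] belongs to the pair of index [0] and [f k] to the pair of index [k]. When the latter is
   added, the sum is regrouped to bring the two together; later pairs only use the triangle
   inequality. *)
destruct (Nat.eq_dec k m) as [e|ne].
- clear IH. subst m. destruct k as [|k]; [lia|].
  rewrite csum_head.
  rewrite rsum_head.
  assert (hs : Cmod (csum (fun j => g (S j)) k) <= rsum (fun j => h (S j)) k).
  { eapply Rle_trans; [apply Cmod_csum|]. apply rsum_le. intros j _. apply gh. }
  assert (g0 : g O = (f 0%Z + f (-1)%Z)%C) by reflexivity.
  assert (gk : g (S k) = (f (Z.of_nat (S k)) + f (- Z.of_nat (S k) - 1)%Z)%C) by reflexivity.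
  assert (h0 : h O = Cmod (f 0%Z) + Cmod (f (-1)%Z)) by reflexivity.
  assert (hk : h (S k) = Cmod (f (Z.of_nat (S k))) + Cmod (f (- Z.of_nat (S k) - 1)%Z)) by reflexivity.
  rewrite g0, gk, h0, hk.
  set (u := f (Z.of_nat (S k))) in *. set (v := f (- Z.of_nat (S k) - 1)%Z) in *.
  replace (f 0%Z + f (-1)%Z + csum (fun j => g (S j)) k + (u + v))%C with
   ((f (-1)%Z + u) + (f 0%Z + (v + csum (fun j => g (S j)) k)))%C by ring.
  assert (t1 := Cmod_triangle (f (-1)%Z + u)%C (f 0%Z + (v + csum (fun j => g (S j)) k))%C).
  assert (t2 := Cmod_triangle (f 0%Z) (v + csum (fun j => g (S j)) k)%C).
  assert (t3 := Cmod_triangle v (csum (fun j => g (S j)) k)). lra.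
- specialize (IH ltac:(lia)). assert (t1 := Cmod_triangle (csum g m) (g m)).
  specialize (gh m). lra.
Qed.

Lemma bden_half (x y : R) : bden x y = 2 * (cos x ^ 2 + sinh y ^ 2).
Proof. unfold bden. rewrite cos_2a_cos, cosh_2a. ring. Qed.

Lemma sinh_2a (y : R) : sinh (2 * y) = 2 * sinh y * cosh y.
Proof. replace (2 * y) with (y + y) by ring. rewrite sinh_plus. ring. Qed.

Lemma Cmod_Ccos (x y : R) : Cmod (Ccos (cpt x y)) ^ 2 = bden x y / 2.
Proof.
rewrite bden_half. unfold Cmod. rewrite pow2_sqrt by (simpl; nra). unfold Ccos, cpt; simpl fst; simpl snd.
simpl Re; simpl Im. assert (h := cosh_sqr y). assert (h' := sin2_cos2 x). unfold Rsqr in h'.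
rewrite <- (pow2_abs (- _)), Rabs_Ropp, pow2_abs, !Rpow_mult_distr, h.
replace (sin x ^ 2) with (1 - cos x ^ 2) by (simpl; lra). field.
Qed.

(** Multiplying [t tan z = bU + i bW] by [i] puts [T z] at [- bW + i bU], in the second quadrant;
    the symmetry of [|q|] later moves it to [(bW, bU)]. *)
Lemma rotated_tan (t x y : R) : 0 < y ->
  (cpt (- bW t x y) (bU t x y) * Ccos (cpt x y))%C = (Ci * RtoC t * Csin (cpt x y))%C.
Proof.
intros y0. assert (hd := bden_pos x y y0). unfold bW, bU.
rewrite sin_2a, sinh_2a.
assert (h := cosh_sqr y). assert (h' := sin2_cos2 x). unfold Rsqr in h'.
assert (e : cosh y ^ 2 - sin x ^ 2 = bden x y / 2).
{ rewrite bden_half, h. replace (sin x ^ 2) with (1 - cos x ^ 2) by (simpl; lra). field. }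
assert (e2 : cos x ^ 2 + sinh y ^ 2 = bden x y / 2) by (rewrite bden_half; field).
set (D := bden x y) in *. unfold cpt, Ccos, Csin. apply C_ext; simpl.
- replace (- (t * (2 * sinh y * cosh y) / D) * (cos x * cosh y) -
   t * (2 * sin x * cos x) / D * - (sin x * sinh y)) with
   (- 2 * t * cos x * sinh y * (cosh y ^ 2 - sin x ^ 2) / D) by (field; lra).
  rewrite e. field. lra.
- replace (- (t * (2 * sinh y * cosh y) / D) * - (sin x * sinh y) +
   t * (2 * sin x * cos x) / D * (cos x * cosh y)) with
   (2 * t * sin x * cosh y * (cos x ^ 2 + sinh y ^ 2) / D) by (field; lra).
  rewrite e2. field. lra.
Qed.

Lemma Ccos_neq0 (x y : R) : 0 < y -> Ccos (cpt x y) <> RtoC 0.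
Proof.
intros y0 h. assert (h' := Cmod_Ccos x y). rewrite h, Cmod_0 in h'.
assert (hd := bden_pos x y y0). lra.
Qed.

(** * Absence of cancellation in the push-forward *)

Section rigidity.
Variables (t : R) (n : nat) (X e sg xi : nat -> R).
Hypothesis t0 : 0 < t.
Hypothesis hroot : forall i, (i <= n)%nat -> root_data (X i) (e i) (sg i).
Hypothesis X0 : X O = t ^ 2.
Hypothesis hlink : forall i, (i < n)%nat -> sg i <> 1 /\ X (S i) = - t ^ 2 * (sg i / (1 - sg i)).
Hypothesis en : e n = 0.
Hypothesis xi0 : xi O = 1.
Hypothesis xiS : forall i, (i < n)%nat -> xi (S i) = xi i * e i.
Hypothesis xi_sum : rsum xi (S n) = 0.

Let Q := qpt xi X n.

Lemma qpt_pushforward (x y : R) : 0 < x < PI / 2 -> 0 < y ->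
  exists l, clim (zsum (fun k => Q (x + IZR k * PI) y)) l /\
  Cmod l = Cmod (Q (bW t x y) (bU t x y)) * (2 * t / bden x y) ^ 2.
Proof.
intros hx y0. assert (hd := bden_pos x y y0).
assert (hw : (cpt (- bW t x y) (bU t x y) * cpt (- bW t x y) (bU t x y) *
  (Ccos (cpt x y) * Ccos (cpt x y)) = - RtoC (t ^ 2) * (Csin (cpt x y) * Csin (cpt x y)))%C).
{ replace (cpt (- bW t x y) (bU t x y) * cpt (- bW t x y) (bU t x y) *
    (Ccos (cpt x y) * Ccos (cpt x y)))%C with
   ((cpt (- bW t x y) (bU t x y) * Ccos (cpt x y)) * (cpt (- bW t x y) (bU t x y) * Ccos (cpt x y)))%C by ring.
  rewrite rotated_tan by auto. apply C_ext; simpl; ring. }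
assert (h := qdiff_pushforward t n X e sg xi t0 hroot X0 hlink en xi0 xiS xi_sum
  (cpt x y) _ hx y0 (Ccos_neq0 x y y0) hw).
eexists; split.
- eapply clim_ext; [|exact h]. intros m. apply csum_ext. intros k _. unfold Q, qpt.
  f_equal; f_equal; unfold zshift, cpt; apply C_ext; simpl; ring.
- rewrite Cmod_mult, Rmult_comm. f_equal.
  + unfold Q. rewrite <- qpt_opp. reflexivity.
  + rewrite Cmod_div.
    2: { assert (hc := Ccos_neq0 x y y0). repeat apply Cmult_neq_0; auto. }
    rewrite !Cmod_mult, Cmod_opp, Cmod_R, Rabs_pos_eq by nra.
    replace (Cmod (Ccos (cpt x y)) * Cmod (Ccos (cpt x y)) *
      (Cmod (Ccos (cpt x y)) * Cmod (Ccos (cpt x y)))) with ((Cmod (Ccos (cpt x y)) ^ 2) ^ 2) by ring.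
    rewrite Cmod_Ccos. field. lra.
Qed.

(** Mass rigidity applies with [|q|] on the quadrant and, as excess, the defect of the triangle
    inequality for the terms of index [-1] and [k]. *)
Lemma qpt_no_defect (k : nat) : (0 < k)%nat -> forall x y, 0 < x < PI / 2 -> 0 < y ->
  Cmod (Q (x - PI) y) + Cmod (Q (x + INR k * PI) y) = Cmod (Q (x - PI) y + Q (x + INR k * PI) y)%C.
Proof.
intros k0.
assert (Xn0 : forall i, (i <= n)%nat -> X i <> 0).
{ intros i hi. destruct (hroot i hi) as [a ha|b hb].
  - apply Rgt_not_eq. now apply pow2_gt_0.
  - apply Rlt_not_eq. assert (0 < b ^ 2) by now apply pow2_gt_0. lra. }
destruct (qpt_bound xi X n Xn0 xi_sum) as [K [hK hb]].
set (rho := fun x y => Cmod (Q (x - PI) y) + Cmod (Q (x + INR k * PI) y) -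
  Cmod (Q (x - PI) y + Q (x + INR k * PI) y)%C).
assert (hpi := PI_RGT_0). assert (hk : 0 <= INR k * PI) by (apply Rmult_le_pos; [apply pos_INR|lra]).
assert (hrho : forall x y, 0 < x < PI / 2 -> 0 < y -> rho x y = 0).
2: { intros x y hx hy. specialize (hrho x y hx hy). unfold rho in hrho. lra. }
apply (@tan_mass_rigidity t (fun x y => Cmod (Q x y)) rho n K
  (fun i => fst (root_pt (X i))) (fun i => snd (root_pt (X i)))); auto.
- intros. apply Cmod_ge_0.
- intros x y hx hy. apply ccont_Cmod.
  assert (h := qpt_ccont xi X n 0 x y).
  destruct h as [h1 h2].
  { intros i _. apply sqr_neq_real; lra. }
  split; [apply (continuity_2d_pt_ext (fun u v => Re (qpt xi X n (u + 0) v)))|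
    apply (continuity_2d_pt_ext (fun u v => Im (qpt xi X n (u + 0) v)))]; auto;
   intros u v; rewrite Rplus_0_r; reflexivity.
- intros x y _ _. unfold rho. assert (h := Cmod_triangle (Q (x - PI) y) (Q (x + INR k * PI) y)). lra.
- intros x y hx hy.
  assert (c1 : ccont (fun u v => Q (u - PI) v) x y).
  { apply (qpt_ccont xi X n (- PI) x y). intros i _. apply sqr_neq_real; lra. }
  assert (c2 : ccont (fun u v => Q (u + INR k * PI) v) x y).
  { apply (qpt_ccont xi X n (INR k * PI) x y). intros i _. apply sqr_neq_real; lra. }
  unfold rho. apply continuity_2d_pt_minus; [apply continuity_2d_pt_plus|]; apply ccont_Cmod; auto.
  now apply ccont_plus.
- intros x y hx hy eps eps0. destruct (qpt_pushforward x y hx hy) as [l [hl hm]].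
  rewrite <- hm. destruct (proj1 (clim_Cmod _ _) hl eps eps0) as [N HN].
  (* The window must be late enough for the approximation up to [eps] and must contain the index
     [k]. *)
  exists (N + k)%nat. specialize (HN (S (N + k)) ltac:(lia)).
  assert (hz := zsum_defect (fun j => Q (x + IZR j * PI) y) k (S (N + k)) k0 ltac:(lia)).
  rewrite rsum_f_R0.
  assert (hs : Cmod l <= Cmod (zsum (fun j => Q (x + IZR j * PI) y) (S (N + k))) + eps).
  { set (u := zsum _ _) in *. replace l with (u + - (u - l))%C by ring.
    eapply Rle_trans; [apply Cmod_triangle|]. rewrite Cmod_opp. lra. }
  simpl in hz. rewrite <- INR_IZR_INZ in hz.
  replace (x + -1 * PI) with (x - PI) in hz by ring. unfold rho.
  (* The negative index [- j - 1] gives the abscissa [x - (j + 1) PI], which the symmetry of [|q|]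
     turns into the reflected tile. *)
  assert (hf : forall j, Cmod (Q (x + IZR (Z.of_nat j) * PI) y) + Cmod (Q (x + IZR (- Z.of_nat j - 1) * PI) y)
     = fold_pair (fun x y => Cmod (Q x y)) x y j).
  { intros j. unfold fold_pair. rewrite <- INR_IZR_INZ. f_equal.
    - do 2 f_equal. ring.
    - unfold Q. rewrite <- qpt_opp. do 2 f_equal.
      rewrite minus_IZR, opp_IZR, <- INR_IZR_INZ, S_INR. ring. }
  rewrite <- (rsum_ext _ _ (S (N + k)) (fun j _ => hf j)).
  cbn [rsum] in *. lra.
Qed.

End rigidity.

(** * Behaviour on the real axis *)

(** On the real axis, off the poles, this is [q] as a function of [Z = z^2]. *)
Definition pole_sum (c X : nat -> R) (n : nat) (Z : R) : R := rsum (fun i => c i / (Z - X i)) n.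

Lemma is_lim_seq_rsum0 (u : nat -> nat -> R) (n : nat) :
  (forall i, (i < n)%nat -> is_lim_seq (fun k => u k i) 0) -> is_lim_seq (fun k => rsum (u k) n) 0.
Proof.
induction n as [|n IH]; intros h; cbn [rsum]; [apply is_lim_seq_const|].
replace 0 with (0 + 0) by ring. apply is_lim_seq_plus'; auto.
Qed.

(* Multiplying by [Z - X n] kills the last pole; the constant term [sum c] vanishes in the limit. *)
Lemma pole_sum_coef0 (X Z : nat -> R) (n : nat) (c : nat -> R) : is_lim_seq Z p_infty ->
  (forall k i, (i <= n)%nat -> Z k <> X i) ->
  (forall i, (0 < i <= n)%nat -> X i <> X O) ->
  (forall k, pole_sum c X (S n) (Z k) = 0) -> c O = 0.
Proof.
intros hZ. revert c. induction n as [|n IH]; intros c hne hX h.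
- specialize (h O). unfold pole_sum in h. cbn [rsum] in h. assert (hz := hne O O (Nat.le_refl _)).
  apply (f_equal (fun r => r * (Z O - X O))) in h. field_simplify in h; lra.
- assert (e : forall k, rsum c (S (S n)) = - rsum (fun i => c i * (X i - X (S n)) / (Z k - X i)) (S n)).
  { intros k. specialize (h k). unfold pole_sum in h. apply (f_equal (fun r => (Z k - X (S n)) * r)) in h.
    rewrite Rmult_0_r, <- rsum_scal in h.
    rewrite (rsum_ext _ (fun i => c i + c i * (X i - X (S n)) / (Z k - X i))) in h.
    2: { intros i hi. assert (hz := hne k i ltac:(lia)). field. lra. }
    rewrite rsum_plus in h.
    change (rsum (fun i => c i * (X i - X (S n)) / (Z k - X i)) (S (S n))) with
     (rsum (fun i => c i * (X i - X (S n)) / (Z k - X i)) (S n) +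
        c (S n) * (X (S n) - X (S n)) / (Z k - X (S n))) in h.
    replace (c (S n) * (X (S n) - X (S n)) / (Z k - X (S n))) with 0 in h.
    2: { unfold Rdiv. ring. }
    lra. }
  assert (l : is_lim_seq (fun k => rsum (fun i => c i * (X i - X (S n)) / (Z k - X i)) (S n)) 0).
  { apply is_lim_seq_rsum0. intros i hi. unfold Rdiv.
    replace 0 with (c i * (X i - X (S n)) * 0) by ring.
    apply (is_lim_seq_mult' (fun _ => c i * (X i - X (S n)))); [apply is_lim_seq_const|].
    apply (is_lim_seq_inv _ p_infty); [|discriminate].
    apply (is_lim_seq_plus _ _ p_infty (- X i)); [exact hZ|apply is_lim_seq_const|reflexivity]. }
  assert (s0 : rsum c (S (S n)) = 0).
  { apply is_lim_seq_opp in l.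
    assert (l' : is_lim_seq (fun _ => rsum c (S (S n))) 0).
    { replace (Finite 0) with (Rbar_opp 0) by (simpl; f_equal; ring).
      eapply is_lim_seq_ext; [|exact l]. intros k. simpl. symmetry. apply e. }
    apply is_lim_seq_unique in l'. rewrite Lim_seq_const in l'. now injection l'. }
  assert (c0 : c O * (X O - X (S n)) = 0).
  { apply (IH (fun i => c i * (X i - X (S n)))).
    - intros k i hi. apply hne. lia.
    - intros i hi. apply hX. lia.
    - intros k. specialize (e k). unfold pole_sum. lra. }
  assert (hx := hX (S n) ltac:(lia)). apply Rmult_integral in c0. destruct c0; [auto|exfalso; lra].
Qed.

Lemma qpt_real (xi X : nat -> R) (n : nat) (u : R) :
  (forall i, (i <= n)%nat -> u ^ 2 <> X i) ->
  qpt xi X n u 0 = RtoC (pole_sum xi X (S n) (u ^ 2)).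
Proof.
intros h. unfold qpt, qdiff, pole_sum. rewrite <- csum_RtoC. apply csum_ext. intros i hi.
rewrite RtoC_div. 2: { specialize (h i ltac:(lia)). lra. }
f_equal. apply C_ext; unfold cpt; simpl; ring.
Qed.

Lemma qpt_ccont_real (xi X : nat -> R) (n : nat) (c x : R) :
  (forall i, (i <= n)%nat -> (x + c) ^ 2 <> X i) ->
  ccont (fun u v => qpt xi X n (u + c) v) x 0.
Proof.
intros h. apply qpt_ccont. intros i hi e. apply (h i hi). apply (f_equal fst) in e. simpl in e. lra.
Qed.

Lemma continuity_2d_pt_axis (F : R -> R -> R) (x : R) : continuity_2d_pt F x 0 ->
  is_lim_seq (fun k => F x (/ INR (S k))) (F x 0).
Proof.
intros h. apply is_lim_seq_spec. intros eps. destruct (h eps) as [d hd].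
assert (hl : is_lim_seq (fun k => / INR (S k)) 0).
{ apply (is_lim_seq_inv _ p_infty); [|discriminate].
  apply (is_lim_seq_incr_1 INR). apply is_lim_seq_INR. }
apply is_lim_seq_spec in hl. destruct (hl d) as [N HN]. exists N. intros k hk. apply hd.
- rewrite Rminus_diag, Rabs_R0. apply cond_pos.
- now apply HN.
Qed.

Lemma continuous_pole_sum (c X : nat -> R) (m : nat) (Z : R -> R) (x : R) : continuous Z x ->
  (forall i, (i < m)%nat -> Z x <> X i) -> continuous (fun u => pole_sum c X m (Z u)) x.
Proof.
intros hZ. unfold pole_sum. induction m as [|m IH]; intros h; cbn [rsum]; [apply continuous_const|].
apply (continuous_plus (fun u => rsum (fun i => c i / (Z u - X i)) m)); [auto|].
apply (continuous_scal_r (c m) (fun u => / (Z u - X m))).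
apply (continuous_comp (fun u => Z u - X m) Rinv).
- apply (continuous_minus Z); [auto|apply continuous_const].
- apply continuous_Rinv. assert (h' := h m (Nat.lt_succ_diag_r _)). lra.
Qed.

Lemma locally_avoid (X : nat -> R) (m : nat) (Z : R -> R) (x : R) : continuous Z x ->
  (forall i, (0 < i <= m)%nat -> Z x <> X i) ->
  locally x (fun u => forall i, (0 < i <= m)%nat -> Z u <> X i).
Proof.
intros hZ. induction m as [|m IH]; intros h; [apply filter_forall; intros; lia|].
assert (h1 : locally x (fun u => Z u <> X (S m))).
{ apply (hZ (fun y => y <> X (S m))). apply (open_neq (X (S m)) (Z x)). apply h. lia. }
assert (h2 := IH ltac:(intros; apply h; lia)).
generalize (filter_and _ _ h1 h2). apply filter_imp. intros u [a b] i hi.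
destruct (Nat.eq_dec i (S m)) as [->|ne]; [auto|apply b; lia].
Qed.

Section contradiction.
Variables (t : R) (n : nat) (X e sg xi : nat -> R).
Hypothesis t0 : PI / 2 < t < PI.
Hypothesis hroot : forall i, (i <= n)%nat -> root_data (X i) (e i) (sg i).
Hypothesis X0 : X O = t ^ 2.
Hypothesis Xlt : forall i, (0 < i <= n)%nat -> X i < t ^ 2.
Hypothesis hlink : forall i, (i < n)%nat -> sg i <> 1 /\ X (S i) = - t ^ 2 * (sg i / (1 - sg i)).
Hypothesis en : e n = 0.
Hypothesis xi0 : xi O = 1.
Hypothesis xiS : forall i, (i < n)%nat -> xi (S i) = xi i * e i.
Hypothesis xi_sum : rsum xi (S n) = 0.

Let phi := pole_sum xi X (S n).

(** Letting the ordinate tend to [0] in [qpt_no_defect] gives [|a| + |b| = |a + b|] for two real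
    numbers, which therefore cannot have opposite signs. *)
Lemma pole_sum_same_sign (k : nat) (x : R) : (0 < k)%nat -> 0 < x < PI / 2 ->
  (forall i, (i <= n)%nat -> (x - PI) ^ 2 <> X i) ->
  (forall i, (i <= n)%nat -> (x + INR k * PI) ^ 2 <> X i) ->
  0 <= phi ((x - PI) ^ 2) * phi ((x + INR k * PI) ^ 2).
Proof.
intros k0 hx h1 h2.
assert (c1 := qpt_ccont_real xi X n (- PI) x h1).
assert (c2 := qpt_ccont_real xi X n (INR k * PI) x h2).
assert (l1 := continuity_2d_pt_axis _ _ (ccont_Cmod _ _ _ c1)).
assert (l2 := continuity_2d_pt_axis _ _ (ccont_Cmod _ _ _ c2)).
assert (l3 := continuity_2d_pt_axis _ _ (ccont_Cmod _ _ _ (ccont_plus _ _ _ _ c1 c2))).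
cbv beta in l1, l2, l3.
assert (l4 := is_lim_seq_plus' _ _ _ _ l1 l2).
assert (hpi := PI_RGT_0).
assert (heq : Cmod (qpt xi X n (x + - PI) 0) + Cmod (qpt xi X n (x + INR k * PI) 0) =
  Cmod (qpt xi X n (x + - PI) 0 + qpt xi X n (x + INR k * PI) 0)%C).
{ assert (Finite (Cmod (qpt xi X n (x + - PI) 0) + Cmod (qpt xi X n (x + INR k * PI) 0)) =
    Finite (Cmod (qpt xi X n (x + - PI) 0 + qpt xi X n (x + INR k * PI) 0)%C)).
  2: { now injection H. }
  rewrite <- (is_lim_seq_unique _ _ l4), <- (is_lim_seq_unique _ _ l3).
  apply Lim_seq_ext. intros j.
  apply (qpt_no_defect t n X e sg xi); auto; [lra|].
  apply Rinv_0_lt_compat. apply lt_0_INR. lia. }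
change (x + - PI) with (x - PI) in heq.
rewrite !qpt_real in heq by auto. rewrite <- RtoC_plus, !Cmod_R in heq. fold phi in heq.
set (a := phi ((x - PI) ^ 2)) in *. set (b := phi ((x + INR k * PI) ^ 2)) in *.
destruct (Rle_dec 0 (a * b)) as [p|p]; auto. exfalso.
assert (h := Rsqr_abs (a + b)). rewrite <- heq in h. unfold Rsqr in h.
assert (ha := Rsqr_abs a). assert (hb := Rsqr_abs b). unfold Rsqr in ha, hb.
assert (0 <= Rabs a * Rabs b) by (apply Rmult_le_pos; apply Rabs_pos). nra.
Qed.

(** A nonzero value would fix the sign of the second factor near [PI - t], while the first factor
    changes sign at its simple pole. *)
Lemma pole_sum_zero (k : nat) : (0 < k)%nat -> phi ((PI - t + INR k * PI) ^ 2) = 0.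
Proof.
intros k0. assert (hpi := PI_RGT_0). set (x0 := PI - t).
destruct (Req_dec (phi ((x0 + INR k * PI) ^ 2)) 0) as [h|hB]; auto. exfalso.
set (B := phi _) in *.
assert (hk : 1 <= INR k) by (apply (le_INR 1); lia).
assert (cl : forall c, continuous (fun x => (x + c) ^ 2) x0).
{ intros c. apply (ex_derive_continuous (fun x => (x + c) ^ 2)). auto_derive; auto. }
(* All [X i] are at most [t^2 < PI^2], so the translate by [k PI] never meets a pole. *)
assert (hle : forall i x, (i <= n)%nat -> 0 < x -> (x + INR k * PI) ^ 2 <> X i).
{ intros i x hi hx. assert (X i <= t ^ 2).
  { destruct i as [|i]; [lra|]. left. apply Xlt. lia. }
  assert (PI <= INR k * PI) by nra. apply Rgt_not_eq. nra. }
(* [r] is the regular part of [phi] at [X O]. Near [PI - t], [g] is the product of the two values of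
   [phi] multiplied by [(x - PI)^2 - t^2]; written with [r], it is continuous there, with value
   [B]. *)
set (r := pole_sum (fun i => xi (S i)) (fun i => X (S i)) n).
set (g := fun x => (1 + ((x + - PI) ^ 2 - t ^ 2) * r ((x + - PI) ^ 2)) * phi ((x + INR k * PI) ^ 2)).
assert (x0e : (x0 + - PI) ^ 2 = t ^ 2) by (unfold x0; ring).
assert (cg : continuous g x0).
{ apply (continuous_mult (fun x => 1 + ((x + - PI) ^ 2 - t ^ 2) * r ((x + - PI) ^ 2))).
  - apply (continuous_plus (fun _ => 1)); [apply continuous_const|].
    apply (continuous_mult (fun x => (x + - PI) ^ 2 - t ^ 2)).
    + apply (continuous_minus (fun x => (x + - PI) ^ 2)); [apply cl|apply continuous_const].
    + apply (continuous_pole_sum _ (fun i => X (S i)) n (fun x => (x + - PI) ^ 2)); [apply cl|].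
      intros i hi. cbv beta. rewrite x0e. assert (h := Xlt (S i) ltac:(lia)). lra.
  - apply (continuous_pole_sum _ X (S n) (fun x => (x + INR k * PI) ^ 2)); [apply cl|].
    intros i hi. apply hle; [lia|unfold x0; lra]. }
assert (gB : g x0 = B) by (unfold g; rewrite x0e; fold B; ring).
assert (pos : locally x0 (fun x => 0 < g x * B)).
{ apply (continuous_mult g (fun _ => B) x0 cg (continuous_const _ _) (fun y => 0 < y)).
  apply (open_gt 0 (g x0 * B)). rewrite gB. nra. }
assert (av := locally_avoid X n (fun x => (x + - PI) ^ 2) x0 (cl _)
  ltac:(intros i hi; cbv beta; rewrite x0e; specialize (Xlt i hi); lra)).
destruct (filter_and _ _ pos av) as [d hd].
(* [PI - t - s] and [PI - t + s] must stay in the ball where [g] keeps the sign of [B], and in the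
   base of the half strip. *)
set (s := Rmin (d / 2) (Rmin (x0 / 2) ((PI / 2 - x0) / 2))).
assert (s0 : 0 < s /\ s <= d / 2 /\ s <= x0 / 2 /\ s <= (PI / 2 - x0) / 2).
{ assert (d0 := cond_pos d). assert (m1 := Rmin_l (d / 2) (Rmin (x0 / 2) ((PI / 2 - x0) / 2))).
  assert (m2 := Rmin_r (d / 2) (Rmin (x0 / 2) ((PI / 2 - x0) / 2))).
  assert (m3 := Rmin_l (x0 / 2) ((PI / 2 - x0) / 2)). assert (m4 := Rmin_r (x0 / 2) ((PI / 2 - x0) / 2)).
  split; [repeat apply Rmin_glb_lt; unfold x0; lra|]. unfold s. lra. }
destruct s0 as [s0 [s1 [s2 s3]]].
assert (key : forall x, x0 - s <= x <= x0 + s -> x <> x0 -> 0 < g x * B /\ 0 <= g x * ((x + - PI) ^ 2 - t ^ 2)).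
{ intros x hx hne.
  assert (hb : ball x0 d x).
  { change (Rabs (x - x0) < d). assert (d0 := cond_pos d). apply Rabs_def1; lra. }
  destruct (hd x hb) as [h1 h2]. split; auto.
  assert (hx' : 0 < x < PI / 2) by lra.
  assert (hp : (x + - PI) ^ 2 - t ^ 2 <> 0).
  { replace ((x + - PI) ^ 2 - t ^ 2) with ((x - x0) * (x - PI - t)) by (unfold x0; ring).
    apply Rmult_integral_contrapositive.
    split; [now apply Rminus_eq_contra|apply Rlt_not_eq; lra]. }
  assert (h3 : forall i, (i <= n)%nat -> (x + - PI) ^ 2 <> X i).
  { intros i hi. destruct i as [|i]; [rewrite X0; intros e'; apply hp; rewrite e'; ring|apply h2; lia]. }
  assert (h4 := pole_sum_same_sign k x k0 hx' h3 (fun i hi => hle i x hi (proj1 hx'))).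
  replace (g x) with (((x + - PI) ^ 2 - t ^ 2) * (phi ((x - PI) ^ 2) * phi ((x + INR k * PI) ^ 2))).
  2: { unfold g, phi at 1, pole_sum. rewrite rsum_head, xi0, X0. change (x - PI) with (x + - PI).
       unfold r, pole_sum. field. exact hp. }
  set (w := (x + - PI) ^ 2 - t ^ 2). set (v := _ * phi _) in *.
  replace (w * v * w) with (w ^ 2 * v) by ring. apply Rmult_le_pos; [apply pow2_ge_0|exact h4]. }
destruct (key (x0 + s)) as [a1 a2]; [lra|lra|]. destruct (key (x0 - s)) as [b1 b2]; [lra|lra|].
assert (w1 : (x0 + s + - PI) ^ 2 - t ^ 2 < 0).
{ replace ((x0 + s + - PI) ^ 2 - t ^ 2) with (s * (s - 2 * t)) by (unfold x0; ring).
  unfold x0 in *. nra. }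
assert (w2 : 0 < (x0 - s + - PI) ^ 2 - t ^ 2).
{ replace ((x0 - s + - PI) ^ 2 - t ^ 2) with (s * (s + 2 * t)) by (unfold x0; ring).
  unfold x0 in *. nra. }
assert (g1 : g (x0 + s) <= 0) by nra. assert (g2 : 0 <= g (x0 - s)) by nra. nra.
Qed.

(** The zeros of [phi] tend to infinity, which forces the coefficient of its pole at [X O] to
    vanish; that pole is distinct from all others. *)
Lemma chain_sum_contradiction : False.
Proof.
assert (hpi := PI_RGT_0).
assert (c0 : xi O = 0); [|lra].
apply (pole_sum_coef0 X (fun k => (PI - t + INR (S k) * PI) ^ 2) n).
- apply (is_lim_seq_le_p_loc INR).
  + exists O. intros k _. assert (hP := PI2_3_2). rewrite S_INR. assert (hk := pos_INR k).
    assert (INR k + 1 <= PI - t + (INR k + 1) * PI) by nra. nra.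
  + apply is_lim_seq_INR.
- intros k i hi. assert (X i <= t ^ 2).
  { destruct i as [|i]; [lra|]. left. apply Xlt. lia. }
  assert (hk := pos_INR k). rewrite S_INR. apply Rgt_not_eq.
  assert (0 <= INR k * PI) by nra. nra.
- intros i hi. rewrite X0. apply Rlt_not_eq. auto.
- intros k. apply pole_sum_zero. lia.
Qed.

End contradiction.

(** * The critical orbit *)

Lemma is_derive_tanh (x : R) : is_derive tanh x (/ cosh x ^ 2).
Proof.
assert (h := cosh_pos x). assert (e := cosh_sqr x).
replace (/ cosh x ^ 2) with ((cosh x * cosh x - sinh x * sinh x) / cosh x ^ 2).
- apply is_derive_div; [| |lra]; apply is_derive_Reals;
   [apply derivable_pt_lim_sinh|apply derivable_pt_lim_cosh].
- replace (cosh x * cosh x - sinh x * sinh x) with (cosh x ^ 2 - sinh x ^ 2) by ring.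
  rewrite e. field. rewrite <- e. nra.
Qed.

Lemma is_derive_ftan (Y : R -> R) (t d : R) : is_derive Y t d -> cos (Y t) <> 0 ->
  let b := t * tan (Y t) in
  is_derive (fun s => ftan s (Y s)) t
    (- (tanh b + t * (/ cosh b ^ 2 * (tan (Y t) + t * (d / cos (Y t) ^ 2))))).
Proof.
intros hY hc b.
assert (h1 : is_derive (fun s => tan (Y s)) t (d / cos (Y t) ^ 2)).
{ replace (d / cos (Y t) ^ 2) with (d * (tan (Y t) ^ 2 + 1)).
  - apply (is_derive_comp tan Y); [now apply is_derive_tan|auto].
  - unfold tan. assert (h := sin2_cos2 (Y t)). unfold Rsqr in h.
    field_simplify; auto.
    replace (d * sin (Y t) ^ 2 + d * cos (Y t) ^ 2) with
      (d * (sin (Y t) * sin (Y t) + cos (Y t) * cos (Y t))) by ring. rewrite h. field. auto. }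
assert (h2 : is_derive (fun s => s * tan (Y s)) t (tan (Y t) + t * (d / cos (Y t) ^ 2))).
{ evar_last; [apply (is_derive_mult (fun s => s) (fun s => tan (Y s)));
   [apply is_derive_id|exact h1|intros; apply Rmult_comm]|].
  match goal with |- ?u = ?v => change (@eq R u v) end. unfold plus, mult, one; simpl. ring. }
assert (h3 : is_derive (fun s => tanh (s * tan (Y s))) t
  (/ cosh b ^ 2 * (tan (Y t) + t * (d / cos (Y t) ^ 2)))).
{ rewrite Rmult_comm. apply (is_derive_comp tanh (fun s => s * tan (Y s))); [apply is_derive_tanh|auto]. }
unfold ftan.
apply (is_derive_ext (fun s => - (s * tanh (s * tan (Y s))))); [intros; apply Ropp_mult_distr_l|].
apply (is_derive_opp (fun s => s * tanh (s * tan (Y s)))).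
evar_last; [apply (is_derive_mult (fun s => s) (fun s => tanh (s * tan (Y s))));
   [apply is_derive_id|exact h3|intros; apply Rmult_comm]|].
match goal with |- ?u = ?v => change (@eq R u v) end. unfold plus, mult, one, b; simpl. ring.
Qed.

Lemma ratio_neq0 (u v w : R) : u <> 0 -> v <> 0 -> w <> 0 -> 2 * u * v / (2 * w) <> 0.
Proof.
intros hu hv hw h. apply (f_equal (fun r => r * w)) in h. field_simplify in h; auto.
apply Rmult_integral in h. tauto.
Qed.

Lemma tanh_sqr (x : R) : tanh x ^ 2 = sinh x ^ 2 / (1 + sinh x ^ 2).
Proof. assert (h := cosh_pos x). assert (h2 := cosh_sqr x). unfold tanh. rewrite <- h2. field. lra. Qed.

Lemma sinh_neq0 (x : R) : x <> 0 -> sinh x <> 0.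
Proof.
intros h. destruct (Rdichotomy _ _ h) as [h1|h1].
- assert (h2 := sinh_pos (- x) ltac:(lra)). rewrite sinh_opp in h2. lra.
- assert (h2 := sinh_pos x h1). lra.
Qed.

Lemma even_step (j : nat) : Nat.even (2 * j) = true /\ Nat.div2 (2 * j) = j /\
  Nat.even (S (2 * j)) = false /\ Nat.div2 (S (2 * j)) = j.
Proof.
repeat split.
- rewrite Nat.even_mul. reflexivity.
- apply Nat.div2_double.
- rewrite Nat.even_succ, Nat.odd_mul. reflexivity.
- apply Nat.div2_succ_double.
Qed.

Lemma parity (i : nat) : exists j, i = (2 * j)%nat \/ i = S (2 * j).
Proof.
destruct (Nat.Even_or_Odd i) as [[j hj]|[j hj]]; exists j; lia.
Qed.

Section orbit.
Variables (t : R) (N : nat) (y : nat -> R).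
Hypothesis t0 : 0 < t < PI.
Hypothesis y0 : y O = t.
Hypothesis yS : forall j, y (S j) = ftan t (y j).
Hypothesis ycos : forall j, (j < N)%nat -> cos (y j) <> 0.
Hypothesis N0 : (0 < N)%nat.
Hypothesis yN : y N = PI / 2 \/ y N = - (PI / 2).

(** The orbit of [T] is [y 0, i b 0, y 1, i b 1, ...]: even indices of the chain are real points and
    odd indices are imaginary ones, whose squares are negative. *)
Let b (j : nat) : R := t * tan (y j).
Let X (i : nat) : R := if Nat.even i then y (Nat.div2 i) ^ 2 else - b (Nat.div2 i) ^ 2.
Let e (i : nat) : R :=
  if Nat.even i then sin (2 * y (Nat.div2 i)) / (2 * y (Nat.div2 i))
  else sinh (2 * b (Nat.div2 i)) / (2 * b (Nat.div2 i)).
Let sg (i : nat) : R :=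
  if Nat.even i then sin (y (Nat.div2 i)) ^ 2 else - sinh (b (Nat.div2 i)) ^ 2.
Let xi (i : nat) : R := nat_rect (fun _ => R) 1 (fun j r => r * e j) i.

Lemma orbit_sqr (j : nat) : y (S j) ^ 2 = t ^ 2 * tanh (b j) ^ 2.
Proof. rewrite yS. unfold ftan, b. ring. Qed.

Lemma orbit_sqr_lt (j : nat) : y (S j) ^ 2 < t ^ 2.
Proof.
rewrite orbit_sqr, tanh_sqr. assert (h := pow2_ge_0 (sinh (b j))).
assert (sinh (b j) ^ 2 / (1 + sinh (b j) ^ 2) < 1).
{ apply (Rmult_lt_reg_r (1 + sinh (b j) ^ 2)); [lra|]. field_simplify; lra. }
assert (0 < t ^ 2) by (apply pow2_gt_0; lra). nra.
Qed.

Lemma orbit_end_neq0 : y N <> 0.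
Proof. assert (h := PI_RGT_0). destruct yN as [->| ->]; lra. Qed.

(** [0] is fixed by [ftan t], so an orbit that reached it could not end at [PI / 2] or
    [- PI / 2]. *)
Lemma orbit_neq0 (j : nat) : (j <= N)%nat -> y j <> 0.
Proof.
intros hj h. apply orbit_end_neq0. replace N with (j + (N - j))%nat by lia.
induction (N - j)%nat as [|k IH]; [now rewrite Nat.add_0_r|].
rewrite Nat.add_succ_r, yS, IH. unfold ftan. rewrite tan_0, Rmult_0_r. unfold tanh.
rewrite sinh_0. unfold Rdiv. ring.
Qed.

Lemma orbit_b_neq0 (j : nat) : (j < N)%nat -> b j <> 0.
Proof.
intros hj h. apply (orbit_neq0 (S j) hj). assert (h' := orbit_sqr j).
rewrite h, tanh_sqr, sinh_0 in h'. apply Rsqr_0_uniq. rewrite Rsqr_pow2, h'. field.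
Qed.

Lemma orbit_sin_neq0 (j : nat) : (j < N)%nat -> sin (y j) <> 0.
Proof.
intros hj h. apply (orbit_b_neq0 j hj). unfold b, tan. rewrite h. unfold Rdiv. ring.
Qed.

(** The end point has modulus [PI / 2] and, being an image, has modulus less than [t]. *)
Lemma orbit_half_pi_lt : PI / 2 < t.
Proof.
destruct N as [|k]; [lia|]. assert (h := orbit_sqr_lt k). assert (hp := PI_RGT_0).
destruct yN as [hy|hy]; rewrite hy in h; nra.
Qed.

Lemma chainE (j : nat) : X (2 * j) = y j ^ 2 /\ X (S (2 * j)) = - b j ^ 2 /\
  e (2 * j) = sin (2 * y j) / (2 * y j) /\ e (S (2 * j)) = sinh (2 * b j) / (2 * b j) /\
  sg (2 * j) = sin (y j) ^ 2 /\ sg (S (2 * j)) = - sinh (b j) ^ 2.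
Proof.
destruct (even_step j) as [h1 [h2 [h3 h4]]]. unfold X, e, sg. rewrite h1, h2, h3, h4. repeat split.
Qed.

Lemma chain_root (i : nat) : (i <= 2 * N)%nat -> root_data (X i) (e i) (sg i).
Proof.
intros hi. destruct (parity i) as [j [hj|hj]]; rewrite hj; destruct (chainE j) as [h1 [h2 [h3 [h4 [h5 h6]]]]].
- rewrite h1, h3, h5. constructor. apply orbit_neq0. lia.
- rewrite h2, h4, h6. constructor. apply orbit_b_neq0. lia.
Qed.

Lemma chain_link (i : nat) : (i < 2 * N)%nat ->
  sg i <> 1 /\ X (S i) = - t ^ 2 * (sg i / (1 - sg i)).
Proof.
intros hi. destruct (parity i) as [j [hj|hj]]; rewrite hj; destruct (chainE j) as [h1 [h2 [h3 [h4 [h5 h6]]]]].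
- rewrite h2, h5. assert (hc := ycos j ltac:(lia)). assert (h := sin2_cos2 (y j)). unfold Rsqr in h.
  assert (e1 : sin (y j) ^ 2 = 1 - cos (y j) ^ 2) by (simpl; lra).
  assert (0 < cos (y j) ^ 2) by now apply pow2_gt_0.
  split; [lra|]. unfold b, tan. replace (1 - sin (y j) ^ 2) with (cos (y j) ^ 2) by lra. field. auto.
- replace (S (S (2 * j))) with (2 * S j)%nat by lia. destruct (chainE (S j)) as [k1 _].
  assert (h := pow2_ge_0 (sinh (b j))).
  rewrite k1, h6, orbit_sqr, tanh_sqr. split; [lra|]. field. lra.
Qed.

Lemma chain_lt (i : nat) : (0 < i <= 2 * N)%nat -> X i < t ^ 2.
Proof.
intros hi. destruct (parity i) as [j [hj|hj]]; rewrite hj; destruct (chainE j) as [h1 [h2 _]].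
- rewrite h1. destruct j as [|j]; [lia|]. apply orbit_sqr_lt.
- rewrite h2. assert (h := pow2_ge_0 (b j)). assert (0 < t ^ 2) by (apply pow2_gt_0; lra). lra.
Qed.

Lemma chain_end : e (2 * N) = 0.
Proof.
destruct (chainE N) as [_ [_ [h _]]]. rewrite h.
destruct yN as [hy|hy]; rewrite hy.
- replace (2 * (PI / 2)) with PI by field. rewrite sin_PI. unfold Rdiv. ring.
- replace (2 * - (PI / 2)) with (- PI) by field. rewrite sin_neg, sin_PI. unfold Rdiv. ring.
Qed.

Lemma chain_sum_neq0 : rsum xi (S (2 * N)) <> 0.
Proof.
intros h. apply (chain_sum_contradiction t (2 * N) X e sg xi); auto.
- split; [apply orbit_half_pi_lt|apply t0].
- apply chain_root.
- destruct (chainE O) as [h1 _]. simpl in h1. rewrite <- y0. exact h1.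
- apply chain_lt.
- apply chain_link.
- apply chain_end.
Qed.

(* [A] is the logarithmic derivative of the orbit point with respect to [ln t]. *)
Lemma orbit_derive (Y : nat -> R -> R) : (forall s, Y O s = s) ->
  (forall j s, Y (S j) s = ftan s (Y j s)) ->
  (forall j, Y j t = y j) -> forall j, (j <= N)%nat ->
  exists A, is_derive (Y j) t (y j / t * A) /\ A * xi (2 * j) = rsum xi (S (2 * j)).
Proof.
intros Y0 YS Yt. induction j as [|j IH]; intros hj.
- exists 1. split.
  + rewrite y0. replace (t / t * 1) with 1 by (field; lra).
    apply (is_derive_ext (fun s => s)); [auto|auto_derive; auto].
  + simpl. ring.
- destruct (IH ltac:(lia)) as [A [hA hs]]. destruct (chainE j) as [_ [_ [h3 [h4 _]]]].
  assert (hc := ycos j ltac:(lia)). assert (hsn := orbit_sin_neq0 j ltac:(lia)).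
  assert (hy := orbit_neq0 j ltac:(lia)). assert (hb := orbit_b_neq0 j ltac:(lia)).
  assert (hsh := sinh_neq0 _ hb). assert (hch := cosh_pos (b j)).
  rewrite sin_2a in h3. rewrite sinh_2a in h4.
  assert (e1 : e (2 * j) <> 0).
  { rewrite h3. apply ratio_neq0; auto. }
  assert (e2 : e (S (2 * j)) <> 0).
  { rewrite h4. apply ratio_neq0; auto. lra. }
  (* In logarithmic derivatives, the factor [t] contributes [1] and the tangent multiplies by
     [2 p / sin (2 p)], which is [1 / e]. The first step leads from [y j] to [b j], the second from
     [b j] to [y (S j)]. *)
  exists (1 + (1 + A / e (2 * j)) / e (S (2 * j))). split.
  + apply (is_derive_ext (fun s => ftan s (Y j s))); [intros; symmetry; apply YS|].
    evar_last; [apply is_derive_ftan; [exact hA|now rewrite Yt]|].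
    rewrite Yt. fold (b j). rewrite h3, h4, yS. unfold ftan. fold (b j). unfold tanh.
    assert (hbe : tan (y j) = b j / t) by (unfold b; field; lra). rewrite hbe.
    assert (hb' : b j = t * (sin (y j) / cos (y j))) by reflexivity.
    field_simplify_eq; [|repeat split; auto; lra].
    rewrite hb'. field. auto.
  + replace (2 * S j)%nat with (S (S (2 * j))) by lia.
    change (rsum xi (S (S (S (2 * j))))) with
      (rsum xi (S (2 * j)) + xi (S (2 * j)) + xi (S (S (2 * j)))).
    rewrite <- hs. change (xi (S (S (2 * j)))) with (xi (S (2 * j)) * e (S (2 * j))).
    change (xi (S (2 * j))) with (xi (2 * j) * e (2 * j)). field. auto.
Qed.

Lemma orbit_derive_neq0 (Y : nat -> R -> R) : (forall s, Y O s = s) ->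
  (forall j s, Y (S j) s = ftan s (Y j s)) -> (forall j, Y j t = y j) ->
  exists d, is_derive (Y N) t d /\ d <> 0.
Proof.
intros h1 h2 h3. destruct (orbit_derive Y h1 h2 h3 N (Nat.le_refl _)) as [A [hA hs]].
eexists; split; [exact hA|]. intros h. apply chain_sum_neq0. rewrite <- hs.
apply Rmult_integral in h. destruct h as [h|h]; [|rewrite h; ring].
exfalso. apply orbit_end_neq0. apply (f_equal (fun r => r * t)) in h. field_simplify in h; lra.
Qed.

End orbit.

Theorem theorem3 (m : nat) (t0 c0 : R) (ht0 : 0 < t0 < PI)
  (hvc : virtual_cycle_parameter m t0 c0) :
  transversal m t0 c0.
Proof.
destruct hvc as [hm [hc [hend hpole]]].
assert (h : exists d : R, is_derive (fun t => Nat.iter (m - 1) (ftan t) t) t0 d /\ d <> 0).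
{ destruct (Nat.eq_dec m 1) as [->|m1].
  (* For [m = 1] the iterate is the identity in [t]. *)
  - exists 1. split; [simpl; auto_derive; auto|lra].
  - apply (orbit_derive_neq0 t0 (m - 1) (fun j => Nat.iter j (ftan t0) t0) ht0
     eq_refl (fun _ => eq_refl)) with (Y := fun j t => Nat.iter j (ftan t) t); auto; [|lia|now rewrite hend].
    (* A zero of the cosine is a pole in the sense of [pole], excluded before the last step. *)
    intros j hj h. apply cos_eq_0_0 in h. destruct h as [k hk]. apply (hpole j hj). exists k. exact hk. }
destruct h as [d [hd d0]].
assert (hPhi : is_derive (Phi m c0) t0 d).
{ unfold Phi. replace d with (d - 0) by ring.
  apply (is_derive_minus (fun t => Nat.iter (m - 1) (ftan t) t)); [exact hd|].
  apply (@is_derive_const R_AbsRing R_NormedModule). }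
split; [now exists d|]. now rewrite (is_derive_unique _ _ _ hPhi).
Qed.
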